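(* Let $D\subseteq\mathbb{C}$ be a domain and let $\mathcal{F}$ be a subfamily of $\mathcal{H}(D)$. (a) If $E(\mathcal{F})\neq\emptyset$, then for every $z\in\mathbb{C}$ with $z\notin E(\mathcal{F})$ one has $J(\mathcal{F})\subseteq\overline{\mathcal{O}^{-}_{\mathcal{F}}(z)}$. (b) If $J(\mathcal{F})\neq\emptyset$, then $\#E(\mathcal{F})\leq 1$.
   Context: For a domain $D\subseteq\mathbb{C}$, $\mathcal{H}(D)$ denotes the class of all holomorphic functions on $D$. A family $\mathcal{F}\subseteq\mathcal{H}(D)$ is normal on an open set $G\subseteq D$ if every sequence in $\mathcal{F}$ contains a subsequence that converges locally uniformly on $G$, where the limit is either a holomorphic function or identically $\infty$ (locally uniform convergence to $\infty$ is allowed). $\mathcal{F}$ is normal at a point $z_0\in D$ if it is normal in some neighborhood of $z_0$ in $D$. The Fatou-like set $F(\mathcal{F})$ is the set of points of $D$ at which $\mathcal{F}$ is normal, and the Julia-like set is $J(\mathcal{F}):=D\setminus F(\mathcal{F})$. For $z\in\mathbb{C}$ define $$\mathcal{O}^{-}_{\mathcal{F}}(z):=\{w\in D: f(w)=z\text{ for some }f\in\mathcal{F}\}=\bigcup_{f\in\mathcal{F}}f^{-1}\{z\},$$ and $$E(\mathcal{F}):=\{z\in\mathbb{C}:\mathcal{O}^{-}_{\mathcal{F}}(z)\text{ is finite}\}$$ (the empty set counts as finite). The bar denotes topological closure, and $\#$ denotes cardinality. *)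

(* Defs.v *)
(* Stdlib reals and Coquelicot.  A holomorphic function on D is represented by a
   total map C -> C, of which only the values on D are ever used. *)
From Stdlib Require Export Reals Ensembles Finite_sets.
From Coquelicot Require Export Coquelicot.
Open Scope R_scope.

Definition connected {T : UniformSpace} (A : T -> Prop) : Prop :=
  forall U V : T -> Prop, open U -> open V ->
    (forall z, A z -> U z \/ V z) ->
    (exists z, A z /\ U z) -> (exists z, A z /\ V z) ->
    exists z, A z /\ U z /\ V z.

Definition closure {T : UniformSpace} (A : T -> Prop) (z : T) : Prop :=
  forall U : T -> Prop, open U -> U z -> exists w, U w /\ A w.

Definition domain (D : C -> Prop) : Prop :=
  (exists z, D z) /\ open D /\ connected D.

(* Complex differentiability: the scalar field is C, not R. *)
Definition holomorphic_on (D : C -> Prop) (f : C -> C) : Prop :=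
  forall z, D z -> ex_derive (K := C_AbsRing) (V := C_NormedModule) f z.

Definition loc_unif_cv (G : C -> Prop) (u : nat -> C -> C) (g : C -> C) : Prop :=
  forall z, G z -> exists U : C -> Prop, locally z U /\
    forall eps : posreal,
      eventually (fun n => forall w, U w -> G w -> Cmod (u n w - g w)%C < eps).

Definition loc_unif_cv_infty (G : C -> Prop) (u : nat -> C -> C) : Prop :=
  forall z, G z -> exists U : C -> Prop, locally z U /\
    forall M : R,
      eventually (fun n => forall w, U w -> G w -> M < Cmod (u n w)).

Definition normal_on (F : (C -> C) -> Prop) (G : C -> Prop) : Prop :=
  forall u : nat -> C -> C, (forall n, F (u n)) ->
    exists phi : nat -> nat,
      (forall n, (phi n < phi (S n))%nat) /\
      ((exists g, holomorphic_on G g /\ loc_unif_cv G (fun n => u (phi n)) g) \/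
       loc_unif_cv_infty G (fun n => u (phi n))).

Definition normal_at (D : C -> Prop) (F : (C -> C) -> Prop) (z : C) : Prop :=
  exists G : C -> Prop,
    open G /\ G z /\ (forall w, G w -> D w) /\ normal_on F G.

Definition Fatou (D : C -> Prop) (F : (C -> C) -> Prop) : Ensemble C :=
  fun z => D z /\ normal_at D F z.

Definition Julia (D : C -> Prop) (F : (C -> C) -> Prop) : Ensemble C :=
  fun z => D z /\ ~ Fatou D F z.

Definition back_orbit (D : C -> Prop) (F : (C -> C) -> Prop) (z : C) : Ensemble C :=
  fun w => D w /\ exists f, F f /\ f w = z.

(* Qualified: Coquelicot's [Finite] is the injection R -> Rbar. *)
Definition exceptional (D : C -> Prop) (F : (C -> C) -> Prop) : Ensemble C :=
  fun z => Finite_sets.Finite C (back_orbit D F z).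

(* Main.v *)
(* Both parts say that the family is normal near w as soon as its members omit two values
   a <> b on a punctured disc about w.  Normalise a = 0, b = 1.  The metric
     |dz|^2 / (|z| |z-1| log(1+sqrt|z|) log(1+sqrt|z-1|))
   on C \ {0,1} has curvature bounded above by a negative constant and is complete at
   infinity.  By Ahlfors' lemma a holomorphic map of a disc of radius r into C \ {0,1} shrinks
   it at the centre by a factor O(1/r), so log(1+log(1+sqrt|f|)) has bounded oscillation on a
   circle about w.  Along a subsequence the functions are thus either uniformly bounded on the
   circle, hence on the disc by the maximum principle, and bounded families are precompact; or
   they tend to infinity uniformly on the circle.  In the latter case infinitely many of them
   omit 0, or infinitely many omit 1, at w too, and the maximum principle for 1/f or 1/(f-1)
   gives convergence to infinity on the disc. *)

Require Import Defs.
From Stdlib Require Import Lra Lia Classical ClassicalEpsilon List.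
From Stdlib Require Import FunctionalExtensionality PropExtensionality.

(** * Complex derivatives *)

(** The metric is deliberately lopsided. Near 0 it is of order |z|^(-3/2) |dz|^2, and likewise near
    1, so the punctures lie at finite distance; near infinity it is comparable to the cusp metric
    |dz|^2 / (|z| log|z|)^2. Only escape to infinity has to be controlled, which leaves room for an
    explicit elementary density. Since log|f|, log|f-1| and log|f'| are harmonic, only the two
    iterated logarithms contribute to the curvature. Near each puncture its own factor supplies the
    curvature, and |z| + |z-1| >= 1 keeps the other factor of the density bounded there.

    The value at the centre w is out of control, because w may itself be one of the finitely many
    preimages. Ahlfors' lemma is therefore applied only at points of a circle |z-w| = r, in discs of
    radius r that miss w; the loss 1/r cancels against the length 2 pi r of the circle, so the bound
    depends neither on r nor on the function.

    Applying the Laplacian to log|f'| requires f' to be differentiable, which is the reason for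
    building Cauchy's formula from Goursat's theorem. *)

Definition Cderiv (f : C -> C) (z l : C) : Prop :=
  forall eps, 0 < eps -> exists d, 0 < d /\ forall w, Cmod (w - z)%C < d ->
    Cmod (f w - f z - l * (w - z))%C <= eps * Cmod (w - z)%C.

Definition Ccont (f : C -> C) (z : C) : Prop :=
  forall eps, 0 < eps -> exists d, 0 < d /\ forall w, Cmod (w - z)%C < d ->
    Cmod (f w - f z)%C < eps.

Lemma is_derive_Cderiv (f : C -> C) (z l : C) :
  is_derive (K := C_AbsRing) (V := C_NormedModule) f z l <-> Cderiv f z l.
Proof.
  split.
  - intros [_ H] eps Heps.
    destruct (H z (fun P HP => HP) (mkposreal _ Heps)) as [d Hd].
    exists d. split; [apply cond_pos|]. intros w Hw.
    specialize (Hd w Hw). simpl in Hd.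
    change (Cmod (f w - f z - (w - z) * l)%C <= eps * Cmod (w - z)%C) in Hd.
    now rewrite (Cmult_comm l).
  - intros H. split; [apply (is_linear_scal_l (K:=C_AbsRing) (V:=C_NormedModule))|].
    intros x Hx eps.
    assert (x = z).
    { symmetry. apply (is_filter_lim_locally_unique (K:=C_AbsRing) (V:=AbsRing_NormedModule C_AbsRing) z x Hx). }
    subst x.
    destruct (H eps (cond_pos eps)) as [d [Hd H']].
    exists (mkposreal d Hd). intros w Hw.
    change (Cmod (f w - f z - (w - z) * l)%C <= eps * Cmod (w - z)%C).
    rewrite (Cmult_comm _ l). now apply H'.
Qed.

(** The product and chain rules ask for functions into the ring seen as a normed module over itself,
    whereas [holomorphic_on] uses [C_NormedModule]. Both amount to the same epsilon inequality, so
    [Cderiv] mediates between them. *)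
Lemma Cderiv_is_derive_ring (f : C -> C) (z l : C) :
  is_derive (K := C_AbsRing) (V := AbsRing_NormedModule C_AbsRing) f z l <-> Cderiv f z l.
Proof.
  split.
  - intros [_ H] eps Heps.
    destruct (H z (fun P HP => HP) (mkposreal _ Heps)) as [d Hd].
    exists d. split; [apply cond_pos|]. intros w Hw.
    specialize (Hd w Hw). simpl in Hd.
    change (Cmod (f w - f z - (w - z) * l)%C <= eps * Cmod (w - z)%C) in Hd.
    now rewrite (Cmult_comm l).
  - intros H. split; [apply is_linear_scal_l|].
    intros x Hx eps.
    assert (x = z).
    { symmetry. apply (is_filter_lim_locally_unique (K:=C_AbsRing) (V:=AbsRing_NormedModule C_AbsRing) z x Hx). }
    subst x.
    destruct (H eps (cond_pos eps)) as [d [Hd H']].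
    exists (mkposreal d Hd). intros w Hw.
    change (Cmod (f w - f z - (w - z) * l)%C <= eps * Cmod (w - z)%C).
    rewrite (Cmult_comm _ l). now apply H'.
Qed.

Lemma Cderiv_cont f z l : Cderiv f z l -> Ccont f z.
Proof.
  intros H eps Heps. destruct (H 1 Rlt_0_1) as [d [Hd H']].
  assert (Hl := Cmod_ge_0 l).
  exists (Rmin d (eps / (2 + Cmod l))). split.
  { apply Rmin_pos; auto. apply Rdiv_lt_0_compat; lra. }
  intros w Hw.
  assert (H1 := Rlt_le_trans _ _ _ Hw (Rmin_l _ _)).
  assert (H2 := Rlt_le_trans _ _ _ Hw (Rmin_r _ _)).
  specialize (H' w H1).
  replace (f w - f z)%C with ((f w - f z - l * (w - z)) + l * (w - z))%C by ring.
  eapply Rle_lt_trans; [apply Cmod_triangle|]. rewrite Cmod_mult.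
  assert (H3 : Cmod (w - z)%C * (2 + Cmod l) < eps).
  { apply Rmult_lt_compat_r with (r := 2 + Cmod l) in H2; [|lra].
    unfold Rdiv in H2. rewrite Rmult_assoc, Rinv_l in H2; lra. }
  assert (H4 := Cmod_ge_0 (w - z)%C). nra.
Qed.

Lemma Cderiv_const c z : Cderiv (fun _ => c) z 0.
Proof. apply Cderiv_is_derive_ring. apply (is_derive_const (K:=C_AbsRing) (V:=AbsRing_NormedModule C_AbsRing)). Qed.

Lemma Cderiv_id z : Cderiv (fun w => w) z 1.
Proof.
  intros eps Heps. exists 1. split; [lra|]. intros w _.
  replace (w - z - 1 * (w - z))%C with (RtoC 0) by ring.
  rewrite Cmod_0. assert (H := Cmod_ge_0 (w - z)%C). nra.
Qed.

Lemma Cderiv_plus f g z a b :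
  Cderiv f z a -> Cderiv g z b -> Cderiv (fun w => f w + g w)%C z (a + b)%C.
Proof.
  intros Hf Hg. apply Cderiv_is_derive_ring.
  apply (is_derive_plus (K:=C_AbsRing) (V:=AbsRing_NormedModule C_AbsRing)); now apply Cderiv_is_derive_ring.
Qed.

Lemma Cderiv_mult f g z a b :
  Cderiv f z a -> Cderiv g z b -> Cderiv (fun w => f w * g w)%C z (a * g z + f z * b)%C.
Proof.
  intros Hf Hg. apply Cderiv_is_derive_ring.
  apply (is_derive_mult (K:=C_AbsRing)); try (now apply Cderiv_is_derive_ring).
  intros; apply Cmult_comm.
Qed.

Lemma Cderiv_comp f g z a b :
  Cderiv f (g z) a -> Cderiv g z b -> Cderiv (fun w => f (g w)) z (b * a)%C.
Proof.
  intros Hf Hg. apply Cderiv_is_derive_ring.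
  apply (is_derive_comp (K:=C_AbsRing) (V:=AbsRing_NormedModule C_AbsRing)); now apply Cderiv_is_derive_ring.
Qed.

Lemma Cderiv_eq f z a b : Cderiv f z a -> a = b -> Cderiv f z b.
Proof. now intros H <-. Qed.

Lemma Cderiv_ext_loc f g z a r : 0 < r ->
  (forall w, Cmod (w - z)%C < r -> f w = g w) -> Cderiv f z a -> Cderiv g z a.
Proof.
  intros Hr He H eps Heps. destruct (H eps Heps) as [d [Hd H']].
  exists (Rmin d r). split. { now apply Rmin_pos. }
  intros w Hw. rewrite <- !He.
  - apply H'. eapply Rlt_le_trans; [apply Hw|apply Rmin_l].
  - replace (z - z)%C with (RtoC 0) by ring. now rewrite Cmod_0.
  - eapply Rlt_le_trans; [apply Hw|apply Rmin_r].
Qed.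

Lemma Cderiv_inv (z : C) : z <> 0 -> Cderiv Cinv z (- / (z * z))%C.
Proof.
  intros Hz eps Heps.
  assert (Hm : 0 < Cmod z) by (apply Cmod_gt_0; exact Hz).
  set (m := Cmod z) in *.
  assert (Hm3 : 0 < m ^ 3) by (apply pow_lt; auto).
  (* The error is (w-z)^2 / (w z^2). The first bound keeps |w| above m/2, so the denominator exceeds
     m^3/2; the second then makes the quotient at most eps |w-z|. *)
  exists (Rmin (m / 2) (eps * m ^ 3 / 2)). split.
  { apply Rmin_pos; [lra|]. assert (0 < eps * m ^ 3) by now apply Rmult_lt_0_compat. lra. }
  intros w Hw.
  assert (H1 := Rlt_le_trans _ _ _ Hw (Rmin_l _ _)).
  assert (H2 := Rlt_le_trans _ _ _ Hw (Rmin_r _ _)).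
  assert (H3 : m / 2 < Cmod w).
  { assert (T := Cmod_triangle w (z - w)%C).
    replace (w + (z - w))%C with z in T by ring. fold m in T.
    rewrite <- (Cmod_opp (z - w)) in T. replace (- (z - w))%C with (w - z)%C in T by ring. fold m in T. lra. }
  assert (Hw0 : w <> 0). { apply Cmod_gt_0. lra. }
  replace (/ w - / z - - / (z * z) * (w - z))%C with ((w - z) * ((w - z) / (w * (z * z))))%C
    by (field; auto).
  rewrite Cmod_mult, Rmult_comm. apply Rmult_le_compat_r; [apply Cmod_ge_0|].
  rewrite Cmod_div; [|now repeat apply Cmult_neq_0]. rewrite !Cmod_mult. fold m.
  apply Rmult_le_reg_r with (Cmod w * (m * m)). { apply Rmult_lt_0_compat; nra. }
  unfold Rdiv. rewrite Rmult_assoc, Rinv_l, Rmult_1_r; [|apply Rgt_not_eq; apply Rmult_lt_0_compat; nra].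
  apply Rle_trans with (eps * m ^ 3 / 2); [lra|].
  assert (0 < eps * (m * m)) by (apply Rmult_lt_0_compat; nra). nra.
Qed.

Lemma Cmod_sym a b : Cmod (a - b)%C = Cmod (b - a)%C.
Proof. rewrite <- Cmod_opp. f_equal. ring. Qed.

Lemma norm_C_R (z : C) : @norm R_AbsRing C_R_NormedModule z = Cmod z.
Proof.
  unfold Cmod. change (sqrt ((Rabs (fst z))^2 + (Rabs (snd z)) ^2) = sqrt (fst z ^ 2 + snd z ^ 2)).
  now rewrite !pow2_abs.
Qed.

Lemma scal_C_R (a : R) (z : C) : @scal R_AbsRing C_R_NormedModule a z = (RtoC a * z)%C.
Proof. apply scal_R_Cmult. Qed.

Lemma Ccont_minus f g z : Ccont f z -> Ccont g z -> Ccont (fun w => f w - g w)%C z.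
Proof.
  intros Hf Hg eps He.
  destruct (Hf (eps / 2)) as [d1 [P1 Q1]]; [lra|].
  destruct (Hg (eps / 2)) as [d2 [P2 Q2]]; [lra|].
  exists (Rmin d1 d2). split; [now apply Rmin_pos|]. intros w Hw.
  assert (T1 := Q1 w (Rlt_le_trans _ _ _ Hw (Rmin_l _ _))).
  assert (T2 := Q2 w (Rlt_le_trans _ _ _ Hw (Rmin_r _ _))).
  replace (f w - g w - (f z - g z))%C with ((f w - f z) + - (g w - g z))%C by ring.
  eapply Rle_lt_trans; [apply Cmod_triangle|]. rewrite Cmod_opp. lra.
Qed.

Lemma Cderiv_shift p z : Cderiv (fun w => w - p)%C z 1.
Proof.
  apply Cderiv_eq with (1 + 0)%C; [|ring].
  apply (Cderiv_plus (fun w => w) (fun _ => - p)%C); [apply Cderiv_id|apply Cderiv_const].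
Qed.

Lemma Cderiv_affine c l p z : Cderiv (fun w => c + l * (w - p))%C z l.
Proof.
  eapply Cderiv_eq.
  - apply Cderiv_plus; [apply Cderiv_const|].
    apply Cderiv_mult; [apply Cderiv_const|apply Cderiv_shift].
  - cbv beta. ring.
Qed.

(** * Goursat's theorem *)

Definition contC (g : R -> C) (t : R) : Prop :=
  continuous (T := R_UniformSpace) (U := C_UniformSpace) g t.

Definition CInt (g : R -> C) (a b : R) : C := @RInt C_R_CompleteNormedModule g a b.

Lemma contC_comp (h : C -> C) (g : R -> C) (t K : R) :
  (forall s, Cmod (g s - g t)%C <= K * Rabs (s - t)) -> Ccont h (g t) ->
  contC (fun s => h (g s)) t.
Proof.
  intros Hg Hh. apply filterlim_locally. intros eps.
  destruct (Hh eps (cond_pos eps)) as [d [Hd H]].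
  assert (HK : 0 < Rabs K + 1) by (assert (T := Rabs_pos K); lra).
  assert (Hd' : 0 < d / (Rabs K + 1)) by now apply Rdiv_lt_0_compat.
  exists (mkposreal _ Hd'). intros s Hs.
  apply C_NormedModule_mixin_compat1. apply H.
  eapply Rle_lt_trans; [apply Hg|].
  change (Rabs (s - t) < d / (Rabs K + 1)) in Hs.
  apply Rmult_lt_compat_r with (r := Rabs K + 1) in Hs; [|lra].
  unfold Rdiv in Hs. rewrite Rmult_assoc, Rinv_l, Rmult_1_r in Hs; [|lra].
  assert (T1 := Rle_abs K). assert (T2 := Rabs_pos (s - t)). nra.
Qed.

Lemma contC_const (c : C) (t : R) : contC (fun _ => c) t.
Proof. apply continuous_const. Qed.

Lemma CInt_ex (g : R -> C) a b : a <= b -> (forall t, a <= t <= b -> contC g t) ->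
  @ex_RInt C_R_NormedModule g a b.
Proof.
  intros Hab H. apply (ex_RInt_continuous (V := C_R_CompleteNormedModule)).
  intros t. rewrite Rmin_left, Rmax_right by lra. apply H.
Qed.

Lemma CInt_chasles (g : R -> C) a m b : a <= m <= b -> (forall t, a <= t <= b -> contC g t) ->
  CInt g a b = (CInt g a m + CInt g m b)%C.
Proof.
  intros Hm H. symmetry. apply (RInt_Chasles (V := C_R_CompleteNormedModule)); apply CInt_ex;
  try lra; intros; apply H; lra.
Qed.

Lemma CInt_bound (g : R -> C) a b M : a <= b -> (forall t, a <= t <= b -> contC g t) ->
  (forall t, a <= t <= b -> Cmod (g t) <= M) -> Cmod (CInt g a b) <= (b - a) * M.
Proof.
  intros Hab Hc HM. rewrite <- norm_C_R.
  apply (norm_RInt_le_const (V := C_R_NormedModule) g); auto.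
  - intros t Ht. rewrite norm_C_R. now apply HM.
  - apply (RInt_correct (V := C_R_CompleteNormedModule)). now apply CInt_ex.
Qed.

Lemma contC_minus (f g : R -> C) t : contC f t -> contC g t -> contC (fun s => f s - g s)%C t.
Proof. intros Hf Hg. apply (continuous_minus (V := C_R_NormedModule) f g t); auto. Qed.

Lemma CInt_minus (f g : R -> C) a b : a <= b ->
  (forall t, a <= t <= b -> contC f t) -> (forall t, a <= t <= b -> contC g t) ->
  CInt (fun t => f t - g t)%C a b = (CInt f a b - CInt g a b)%C.
Proof.
  intros Hab Hf Hg.
  apply (RInt_minus (V := C_R_CompleteNormedModule)); now apply CInt_ex.
Qed.

Lemma CInt_ext (f g : R -> C) a b : a <= b -> (forall t, a <= t <= b -> f t = g t) ->
  CInt f a b = CInt g a b.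
Proof.
  intros Hab H. apply (RInt_ext (V := C_R_CompleteNormedModule)).
  intros t. rewrite Rmin_left, Rmax_right by lra. intros; apply H; lra.
Qed.

Definition Rderiv (g : R -> C) (t : R) (l : C) : Prop :=
  forall eps, 0 < eps -> exists d, 0 < d /\ forall s, Rabs (s - t) < d ->
    Cmod (g s - g t - (s - t)%R * l)%C <= eps * Rabs (s - t).

Lemma is_derive_Rderiv (g : R -> C) (t : R) (l : C) :
  is_derive (K := R_AbsRing) (V := C_R_NormedModule) g t l <-> Rderiv g t l.
Proof.
  split.
  - intros [_ H] eps Heps.
    destruct (H t (fun P HP => HP) (mkposreal _ Heps)) as [d Hd].
    exists d. split; [apply cond_pos|]. intros w Hw.
    specialize (Hd w Hw). cbv beta in Hd. rewrite norm_C_R, scal_C_R in Hd. exact Hd.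
  - intros H. split; [apply is_linear_scal_l|].
    intros x Hx eps.
    assert (x = t).
    { symmetry. apply (is_filter_lim_locally_unique (K:=R_AbsRing) (V:=R_NormedModule) t x Hx). }
    subst x.
    destruct (H eps (cond_pos eps)) as [d [Hd H']].
    exists (mkposreal d Hd). intros w Hw.
    rewrite norm_C_R, scal_C_R. now apply H'.
Qed.

Lemma Cderiv_line (F : C -> C) (p e : C) (t : R) (l : C) :
  Cderiv F (p + t * e)%C l -> Rderiv (fun s : R => F (p + s * e)%C) t (e * l)%C.
Proof.
  intros H eps Heps.
  assert (He : 0 < Cmod e + 1) by (assert (T := Cmod_ge_0 e); lra).
  destruct (H (eps / (Cmod e + 1))) as [d [Hd H']]; [now apply Rdiv_lt_0_compat|].
  exists (d / (Cmod e + 1)). split; [now apply Rdiv_lt_0_compat|].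
  intros s Hs.
  assert (E : (p + s * e - (p + t * e))%C = ((s - t)%R * e)%C) by (rewrite RtoC_minus; ring).
  assert (E2 : Cmod (p + s * e - (p + t * e))%C = Rabs (s - t) * Cmod e)
    by (rewrite E, Cmod_mult, Cmod_R; reflexivity).
  assert (T := Cmod_ge_0 e). assert (T2 := Rabs_pos (s - t)).
  assert (Hs' : Rabs (s - t) * (Cmod e + 1) < d).
  { apply Rmult_lt_compat_r with (r := Cmod e + 1) in Hs; [|lra].
    unfold Rdiv in Hs. rewrite Rmult_assoc, Rinv_l in Hs; lra. }
  assert (HH := H' (p + s * e)%C). rewrite E2, E in HH.
  replace ((s - t)%R * (e * l))%C with (l * ((s - t)%R * e))%C by ring.
  eapply Rle_trans; [apply HH; nra|].
  replace (eps * Rabs (s - t)) with (eps / (Cmod e + 1) * (Rabs (s - t) * (Cmod e + 1))) by (field; lra).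
  apply Rmult_le_compat_l; [|nra]. apply Rlt_le. now apply Rdiv_lt_0_compat.
Qed.

Lemma CInt_derive (G g : R -> C) a b : a <= b ->
  (forall t, a <= t <= b -> Rderiv G t (g t)) -> (forall t, a <= t <= b -> contC g t) ->
  CInt g a b = (G b - G a)%C.
Proof.
  intros Hab HG Hg.
  apply (is_RInt_unique (V := C_R_CompleteNormedModule)).
  apply (is_RInt_derive (V := C_R_CompleteNormedModule) G g);
  intros t; rewrite Rmin_left, Rmax_right by lra; intros Ht.
  - apply is_derive_Rderiv. now apply HG.
  - now apply Hg.
Qed.

Lemma pair_horizontal (x y : R) : (x, y) = ((0, y) + x * 1)%C.
Proof. unfold Cplus, Cmult, RtoC; simpl. f_equal; ring. Qed.

Lemma pair_vertical (x y : R) : (x, y) = ((x, 0) + y * Ci)%C.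
Proof. unfold Cplus, Cmult, RtoC, Ci; simpl. f_equal; ring. Qed.

Lemma contC_horizontal (h : C -> C) (x y : R) : Ccont h (x, y) -> contC (fun s => h (s, y)) x.
Proof.
  intros H. apply (contC_comp h (fun s => (s, y)) x 1); auto.
  intros s. replace ((s, y) - (x, y))%C with (RtoC (s - x)).
  - rewrite Cmod_R. lra.
  - unfold RtoC, Cminus, Cplus, Copp; simpl. f_equal; ring.
Qed.

Lemma contC_vertical (h : C -> C) (x y : R) : Ccont h (x, y) -> contC (fun s => h (x, s)) y.
Proof.
  intros H. apply (contC_comp h (fun s => (x, s)) y 1); auto.
  intros s. replace ((x, s) - (x, y))%C with (RtoC (s - y) * Ci)%C.
  - rewrite Cmod_mult, Cmod_R, Cmod_Ci. lra.
  - unfold RtoC, Cmult, Ci, Cminus, Cplus, Copp; simpl. f_equal; ring.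
Qed.

(** The contour integral of h dz around the boundary of [a,b] x [c,d], counterclockwise; the factor
    [Ci] is dz/dy on the vertical sides. *)
Definition rect_int (h : C -> C) (a b c d : R) : C :=
  (CInt (fun x => h (x, c)) a b - CInt (fun x => h (x, d)) a b
   + Ci * (CInt (fun y => h (b, y)) c d - CInt (fun y => h (a, y)) c d))%C.

Definition rect_cont (h : C -> C) (a b c d : R) : Prop :=
  forall x y, a <= x <= b -> c <= y <= d -> Ccont h (x, y).

Lemma rect_int_split (h : C -> C) a m b c n d : a <= m <= b -> c <= n <= d ->
  rect_cont h a b c d ->
  rect_int h a b c d = (rect_int h a m c n + rect_int h m b c n +
                        (rect_int h a m n d + rect_int h m b n d))%C.
Proof.
  intros Hm Hn H. unfold rect_int.
  rewrite (CInt_chasles (fun x => h (x, c)) a m b), (CInt_chasles (fun x => h (x, d)) a m b),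
    (CInt_chasles (fun y => h (a, y)) c n d), (CInt_chasles (fun y => h (b, y)) c n d); auto.
  - ring.
  - intros t Ht. apply contC_vertical, H; lra.
  - intros t Ht. apply contC_vertical, H; lra.
  - intros t Ht. apply contC_horizontal, H; lra.
  - intros t Ht. apply contC_horizontal, H; lra.
Qed.

Lemma rect_int_bound (h : C -> C) a b c d M : a <= b -> c <= d -> rect_cont h a b c d ->
  (forall x y, a <= x <= b -> c <= y <= d -> Cmod (h (x, y)) <= M) ->
  Cmod (rect_int h a b c d) <= 2 * ((b - a) + (d - c)) * M.
Proof.
  intros Hab Hcd Hc HM. unfold rect_int, Cminus.
  assert (H1 := CInt_bound (fun x => h (x, c)) a b M Hab).
  assert (H2 := CInt_bound (fun x => h (x, d)) a b M Hab).
  assert (H3 := CInt_bound (fun y => h (a, y)) c d M Hcd).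
  assert (H4 := CInt_bound (fun y => h (b, y)) c d M Hcd).
  eapply Rle_trans; [apply Cmod_triangle|]. rewrite Cmod_mult, Cmod_Ci.
  eapply Rle_trans; [apply Rplus_le_compat; [apply Cmod_triangle|
    apply Rmult_le_compat_l; [lra|apply Cmod_triangle]]|]. rewrite !Cmod_opp.
  assert (K1 : Cmod (CInt (fun x => h (x, c)) a b) <= (b - a) * M).
  { apply H1; intros; [apply contC_horizontal, Hc|apply HM]; lra. }
  assert (K2 : Cmod (CInt (fun x => h (x, d)) a b) <= (b - a) * M).
  { apply H2; intros; [apply contC_horizontal, Hc|apply HM]; lra. }
  assert (K3 : Cmod (CInt (fun y => h (a, y)) c d) <= (d - c) * M).
  { apply H3; intros; [apply contC_vertical, Hc|apply HM]; lra. }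
  assert (K4 : Cmod (CInt (fun y => h (b, y)) c d) <= (d - c) * M).
  { apply H4; intros; [apply contC_vertical, Hc|apply HM]; lra. }
  lra.
Qed.

Lemma rect_int_minus (f g : C -> C) a b c d : a <= b -> c <= d ->
  rect_cont f a b c d -> rect_cont g a b c d ->
  rect_int (fun z => f z - g z)%C a b c d = (rect_int f a b c d - rect_int g a b c d)%C.
Proof.
  intros Hab Hcd Hf Hg. unfold rect_int.
  rewrite (CInt_minus (fun x => f (x, c)) (fun x => g (x, c))),
    (CInt_minus (fun x => f (x, d)) (fun x => g (x, d))),
    (CInt_minus (fun y => f (a, y)) (fun y => g (a, y))),
    (CInt_minus (fun y => f (b, y)) (fun y => g (b, y))); auto;
  try (intros; apply contC_vertical; (apply Hf || apply Hg); lra);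
  try (intros; apply contC_horizontal; (apply Hf || apply Hg); lra).
  ring.
Qed.

(** Each side contributes a difference of [F] at two corners, and these cancel around the boundary.
    On vertical sides the parameter derivative of [F] is i f, hence the primitive F/i there. *)
Lemma rect_int_primitive (F f : C -> C) a b c d : a <= b -> c <= d ->
  (forall z, Cderiv F z (f z)) -> (forall z, Ccont f z) -> rect_int f a b c d = 0.
Proof.
  intros Hab Hcd HF Hf. unfold rect_int.
  assert (HH : forall y, CInt (fun x => f (x, y)) a b = (F (b, y) - F (a, y))%C).
  { intros y. apply (CInt_derive (fun x => F (x, y))); auto.
    - intros t _ eps Heps. rewrite (pair_horizontal t y).
      destruct (Cderiv_line F (0, y) 1 t (f (t, y))) with (eps := eps) as [e [He H]]; auto.
      { rewrite <- pair_horizontal. apply HF. }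
      exists e. split; auto. intros s Hs. rewrite (pair_horizontal s y).
      rewrite <- (pair_horizontal t y) at 2.
      specialize (H s Hs). rewrite Cmult_1_l in H. exact H.
    - intros t _. apply contC_horizontal. apply Hf. }
  assert (HV : forall x, (Ci * CInt (fun y => f (x, y)) c d = F (x, d) - F (x, c))%C).
  { intros x.
    rewrite (CInt_derive (fun y => (/ Ci * F (x, y))%C) (fun y => f (x, y))); auto.
    - field. apply Ci_nz.
    - intros t _.
      assert (K : Rderiv (fun s : R => ((fun z => / Ci * F z) ((x, 0) + s * Ci))%C) t
                    (Ci * (0 * F (x, t) + / Ci * f (x, t)))%C).
      { apply (Cderiv_line (fun z => / Ci * F z)%C (x, 0) Ci t).
        rewrite <- pair_vertical.
        apply (Cderiv_mult (fun _ => / Ci)%C F); auto. apply Cderiv_const. }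
      intros eps Heps. destruct (K eps Heps) as [e [He H]].
      exists e. split; auto. intros s Hs. specialize (H s Hs). cbv beta in H.
      rewrite <- !pair_vertical in H.
      replace (Ci * (0 * F (x, t) + / Ci * f (x, t)))%C with (f (x, t)) in H by (field; apply Ci_nz).
      exact H.
    - intros t _. apply contC_vertical. apply Hf. }
  rewrite !HH.
  replace (Ci * (CInt (fun y => f (b, y)) c d - CInt (fun y => f (a, y)) c d))%C with
    (Ci * CInt (fun y => f (b, y)) c d - Ci * CInt (fun y => f (a, y)) c d)%C by ring.
  rewrite !HV. ring.
Qed.

Lemma Cmod_pair_le (x y : R) : Cmod (x, y) <= Rabs x + Rabs y.
Proof.
  replace ((x, y) : C) with (RtoC x + RtoC y * Ci)%C
    by (unfold Cplus, Cmult, RtoC, Ci; simpl; f_equal; ring).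
  eapply Rle_trans; [apply Cmod_triangle|].
  rewrite Cmod_mult, !Cmod_R, Cmod_Ci. lra.
Qed.

(** * Bisection of rectangles and the vanishing of contour integrals *)

Lemma nested_intervals (a b : nat -> R) :
  (forall n, a n <= a (S n)) -> (forall n, b (S n) <= b n) -> (forall n, a n <= b n) ->
  exists x, forall n, a n <= x <= b n.
Proof.
  intros Ha Hb Hab.
  assert (Ma : forall n m, (n <= m)%nat -> a n <= a m).
  { intros n m H. induction H; [lra|]. eapply Rle_trans; [apply IHle|apply Ha]. }
  assert (Mb : forall n m, (n <= m)%nat -> b m <= b n).
  { intros n m H. induction H; [lra|]. eapply Rle_trans; [apply Hb|apply IHle]. }
  assert (Mab : forall n m, a n <= b m).
  { intros n m. destruct (Nat.le_ge_cases n m) as [H|H].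
    - eapply Rle_trans; [apply (Ma n m H)|apply Hab].
    - eapply Rle_trans; [apply Hab|apply (Mb m n H)]. }
  destruct (completeness (fun x => exists n, x = a n)) as [x [H1 H2]].
  - exists (b 0%nat). intros y [n ->]. apply Mab.
  - exists (a 0%nat). now exists 0%nat.
  - exists x. intros n. split.
    + apply H1. now exists n.
    + apply H2. intros y [m ->]. apply Mab.
Qed.

(** Serves two arguments: in Goursat's theorem [P] says that the integral is large compared with the
    squared size, and for the existence of maxima that the rectangle contains values dominating all
    others. *)
Lemma rect_bisection (P : R -> R -> R -> R -> Prop) a0 b0 c0 d0 :
  (forall a b c d, a0 <= a <= b -> b <= b0 -> c0 <= c <= d -> d <= d0 -> P a b c d ->
     P a ((a + b) / 2) c ((c + d) / 2) \/ P ((a + b) / 2) b c ((c + d) / 2) \/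
     P a ((a + b) / 2) ((c + d) / 2) d \/ P ((a + b) / 2) b ((c + d) / 2) d) ->
  a0 <= b0 -> c0 <= d0 -> P a0 b0 c0 d0 ->
  exists x y, a0 <= x <= b0 /\ c0 <= y <= d0 /\ forall delta, 0 < delta ->
    exists a b c d, a0 <= a <= x /\ x <= b <= b0 /\ c0 <= c <= y /\ y <= d <= d0 /\
      b - a < delta /\ d - c < delta /\ P a b c d.
Proof.
  intros Hstep H0ab H0cd HP0.
  (* Packing the invariant into a subset type turns [choice] into dependent choice: the function
     [next] has to return a rectangle that can be bisected again. *)
  set (ok := fun q : R * R * (R * R) => let '((a, b), (c, d)) := q in
    a0 <= a <= b /\ b <= b0 /\ c0 <= c <= d /\ d <= d0 /\ P a b c d).
  set (child := fun q q' : R * R * (R * R) => let '((a, b), (c, d)) := q in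
    let '((a', b'), (c', d')) := q' in
    a <= a' /\ b' <= b /\ c <= c' /\ d' <= d /\ b' - a' = (b - a) / 2 /\ d' - c' = (d - c) / 2).
  assert (Hch : forall q : {q | ok q}, exists q' : {q | ok q}, child (proj1_sig q) (proj1_sig q')).
  { intros [[[a b] [c d]] Hq]. simpl proj1_sig.
    assert (Hq' := Hq). destruct Hq' as (H1 & H2 & H3 & H4 & H5).
    set (m := (a + b) / 2). set (n := (c + d) / 2).
    assert (K : exists q', ok q' /\ child ((a, b), (c, d)) q').
    { destruct (Hstep a b c d) as [H|[H|[H|H]]]; auto;
      [exists ((a, m), (c, n))|exists ((m, b), (c, n))|exists ((a, m), (n, d))|exists ((m, b), (n, d))];
      simpl; unfold m, n; repeat split; try lra; auto. }
    destruct K as [q' [K1 K2]]. now exists (exist _ q' K1). }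
  apply choice in Hch. destruct Hch as [next Hnext].
  assert (ok0 : ok ((a0, b0), (c0, d0))) by (simpl; repeat split; auto; lra).
  set (s := fix s (n : nat) : {q | ok q} :=
    match n with O => exist _ _ ok0 | S k => next (s k) end).
  set (A := fun n => fst (fst (proj1_sig (s n)))). set (B := fun n => snd (fst (proj1_sig (s n)))).
  set (Cc := fun n => fst (snd (proj1_sig (s n)))). set (D := fun n => snd (snd (proj1_sig (s n)))).
  assert (Hok : forall n, a0 <= A n <= B n /\ B n <= b0 /\ c0 <= Cc n <= D n /\ D n <= d0 /\
      P (A n) (B n) (Cc n) (D n)).
  { intros n. unfold A, B, Cc, D. assert (T := proj2_sig (s n)).
    destruct (proj1_sig (s n)) as [[a b] [c d]]. exact T. }
  assert (Hc : forall n, A n <= A (S n) /\ B (S n) <= B n /\ Cc n <= Cc (S n) /\ D (S n) <= D n /\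
     B (S n) - A (S n) = (B n - A n) / 2 /\ D (S n) - Cc (S n) = (D n - Cc n) / 2).
  { intros n. unfold A, B, Cc, D. assert (T := Hnext (s n)).
    change (next (s n)) with (s (S n)) in T.
    destruct (proj1_sig (s n)) as [[a b] [c d]], (proj1_sig (s (S n))) as [[a' b'] [c' d']].
    exact T. }
  destruct (nested_intervals A B) as [x Hx]; try (intros n; apply Hc); try (intros n; apply Hok).
  destruct (nested_intervals Cc D) as [y Hy]; try (intros n; apply Hc); try (intros n; apply Hok).
  exists x, y.
  assert (Hx0 := Hx 0%nat). assert (Hy0 := Hy 0%nat).
  split; [exact Hx0|]. split; [exact Hy0|].
  intros delta Hd.
  assert (HW : forall n, B n - A n = (b0 - a0) * (/ 2) ^ n /\ D n - Cc n = (d0 - c0) * (/ 2) ^ n).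
  { induction n as [|n [I1 I2]]; [unfold A, B, Cc, D; simpl; lra|].
    destruct (Hc n) as (_ & _ & _ & _ & -> & ->). rewrite I1, I2. simpl. lra. }
  set (w := (b0 - a0) + (d0 - c0) + 1).
  assert (Hw : 0 < w) by (unfold w; lra).
  destruct (pow_lt_1_zero (/ 2)) with (y := delta / w) as [N HN].
  { rewrite Rabs_right; lra. }
  { now apply Rdiv_lt_0_compat. }
  specialize (HN N (Nat.le_refl _)).
  assert (Hp : 0 < (/ 2) ^ N) by (apply pow_lt; lra).
  rewrite Rabs_right in HN by lra.
  apply Rmult_lt_compat_r with (r := w) in HN; auto.
  unfold Rdiv in HN. rewrite (Rmult_assoc delta), Rinv_l, Rmult_1_r in HN by lra.
  destruct (HW N) as [W1 W2]. destruct (Hok N) as (K1 & K2 & K3 & K4 & K5).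
  destruct (Hx N), (Hy N).
  exists (A N), (B N), (Cc N), (D N).
  repeat split; auto; try lra; unfold w in HN; nra.
Qed.

(** If the integral is nonzero, some quarter keeps at least a quarter of its modulus while s, width
    plus height, is halved; so |integral| >= k s^2 survives bisection. Near the limit point [h] is
    affine up to (k/4) |w-p|. The affine part has a primitive and contributes 0, and the rest
    contributes at most 2 s (k/4) s = k s^2 / 2, a contradiction. *)
Lemma goursat (h : C -> C) a0 b0 c0 d0 : a0 <= b0 -> c0 <= d0 ->
  (forall x y, a0 <= x <= b0 -> c0 <= y <= d0 -> exists l, Cderiv h (x, y) l) ->
  rect_int h a0 b0 c0 d0 = 0.
Proof.
  intros Hab Hcd Hd. apply Cmod_eq_0.
  destruct (Rle_lt_or_eq_dec 0 (Cmod (rect_int h a0 b0 c0 d0)) (Cmod_ge_0 _)) as [HK|]; auto.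
  exfalso.
  assert (Hcont : rect_cont h a0 b0 c0 d0).
  { intros x y Hx Hy. destruct (Hd x y Hx Hy) as [l Hl]. eapply Cderiv_cont, Hl. }
  assert (Hsub : forall a b c d, a0 <= a <= b -> b <= b0 -> c0 <= c <= d -> d <= d0 ->
             rect_cont h a b c d).
  { intros a b c d ? ? ? ? x y ? ?. apply Hcont; lra. }
  set (K := Cmod (rect_int h a0 b0 c0 d0)) in *.
  (* A rectangle reduced to a point has integral 0, so [s0] is positive and may be divided by in
     [k]. *)
  assert (Hs0 : 0 < (b0 - a0) + (d0 - c0)).
  { apply Rnot_le_lt. intros Hle. assert (b0 = a0) by lra. assert (d0 = c0) by lra. subst b0 d0.
    unfold K, rect_int, CInt in HK. rewrite !RInt_point in HK.
    replace (_ + _)%C with (RtoC 0) in HK; [rewrite Cmod_0 in HK; lra|].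
    change (@zero C_R_CompleteNormedModule) with (RtoC 0). ring. }
  set (s0 := (b0 - a0) + (d0 - c0)) in *.
  set (k := K / (s0 * s0)).
  assert (Hk : 0 < k) by (apply Rdiv_lt_0_compat; nra).
  destruct (rect_bisection (fun a b c d => 0 < (b - a) + (d - c) /\
    k * (((b - a) + (d - c)) * ((b - a) + (d - c))) <= Cmod (rect_int h a b c d)) a0 b0 c0 d0)
    as (x & y & Hx & Hy & H); auto.
  - intros a b c d H1 H2 H3 H4 [H5 H6].
    set (m := (a + b) / 2). set (n := (c + d) / 2). set (s := (b - a) + (d - c)) in *.
    rewrite (rect_int_split h a m b c n d) in H6; try (unfold m, n; lra); [|now apply Hsub].
    replace ((m - a) + (n - c)) with (s / 2) by (unfold m, n, s; lra).
    replace ((b - m) + (n - c)) with (s / 2) by (unfold m, n, s; lra).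
    replace ((m - a) + (d - n)) with (s / 2) by (unfold m, n, s; lra).
    replace ((b - m) + (d - n)) with (s / 2) by (unfold m, n, s; lra).
    assert (T : Cmod (rect_int h a m c n + rect_int h m b c n + (rect_int h a m n d + rect_int h m b n d))%C
       <= Cmod (rect_int h a m c n) + Cmod (rect_int h m b c n) +
          (Cmod (rect_int h a m n d) + Cmod (rect_int h m b n d))).
    { eapply Rle_trans; [apply Cmod_triangle|]. apply Rplus_le_compat; apply Cmod_triangle. }
    set (q := k * (s / 2 * (s / 2))).
    assert (Hq : k * (s * s) = 4 * q) by (unfold q; field).
    destruct (Rle_dec q (Cmod (rect_int h a m c n))); [left; split; auto; lra|].
    destruct (Rle_dec q (Cmod (rect_int h m b c n))); [right; left; split; auto; lra|].
    destruct (Rle_dec q (Cmod (rect_int h a m n d))); [right; right; left; split; auto; lra|].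
    right; right; right; split; lra.
  - split; auto. fold s0. unfold k. fold K. right. field. lra.
  - destruct (Hd x y Hx Hy) as [l Hl].
    destruct (Hl (k / 4)) as [delta [Hdel Hl']]; [lra|].
    destruct (H (delta / 2)) as (a & b & c & d & H1 & H2 & H3 & H4 & H5 & H6 & H7 & H8); [lra|].
    set (p := (x, y) : C) in *.
    set (g := fun z : C => (h p + l * (z - p))%C).
    assert (Hgd : forall z, Cderiv g z l) by (intros; apply Cderiv_affine).
    assert (Hg : rect_int g a b c d = 0).
    { apply (rect_int_primitive (fun z => (h p * z + l * / 2 * ((z - p) * (z - p)))%C)); try lra.
      - intros z. unfold g. eapply Cderiv_eq.
        + apply Cderiv_plus.
          * apply Cderiv_mult; [apply Cderiv_const|apply Cderiv_id].
          * apply Cderiv_mult; [apply Cderiv_const|].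
            apply (Cderiv_mult (fun z => z - p)%C (fun z => z - p)%C); apply Cderiv_shift.
        + cbv beta. field.
      - intros z. apply Cderiv_cont with l, Hgd. }
    assert (Hgc : rect_cont g a b c d) by (intros u v _ _; apply Cderiv_cont with l, Hgd).
    assert (Hhc : rect_cont h a b c d) by (apply Hsub; lra).
    assert (E : rect_int h a b c d = rect_int (fun z => h z - g z)%C a b c d).
    { rewrite rect_int_minus, Hg; auto; try lra. ring. }
    rewrite E in H8.
    set (s := (b - a) + (d - c)) in *.
    assert (B : Cmod (rect_int (fun z => h z - g z)%C a b c d) <= 2 * s * (k / 4 * s)).
    { apply rect_int_bound; try lra.
      - intros u v Hu Hv.
        apply Ccont_minus; [apply Hhc|apply Hgc]; auto.
      - intros u v Hu Hv.
        assert (Hm : Cmod ((u, v) - p)%C <= s).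
        { unfold p, Cminus, Cplus, Copp; simpl. eapply Rle_trans; [apply Cmod_pair_le|].
          unfold s. apply Rplus_le_compat; apply Rabs_le; lra. }
        unfold g. replace (h (u, v) - (h p + l * ((u, v) - p)))%C with
          (h (u, v) - h p - l * ((u, v) - p))%C by ring.
        assert (s < delta) by (unfold s; lra).
        eapply Rle_trans; [apply Hl'; eapply Rle_lt_trans; [apply Hm|lra]|].
        apply Rmult_le_compat_l; [lra|exact Hm]. }
    assert (0 < k * (s * s)) by (apply Rmult_lt_0_compat; [lra|nra]). lra.
Qed.

(** * Cauchy's formula and estimates *)

Definition Cexp (z : C) : C := (exp (fst z) * cos (snd z), exp (fst z) * sin (snd z)).

Lemma Cexp_plus (z w : C) : Cexp (z + w)%C = (Cexp z * Cexp w)%C.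
Proof.
  unfold Cexp, Cmult; simpl. rewrite exp_plus, cos_plus, sin_plus. f_equal; ring.
Qed.

Lemma Cexp_0 : Cexp 0 = 1.
Proof. unfold Cexp; simpl. rewrite exp_0, cos_0, sin_0. unfold RtoC. f_equal; ring. Qed.

Lemma Cmod_Cexp (z : C) : Cmod (Cexp z) = exp (fst z).
Proof.
  unfold Cmod, Cexp; simpl.
  replace (_ + _) with (exp (fst z) * exp (fst z) * (Rsqr (sin (snd z)) + Rsqr (cos (snd z))))
    by (unfold Rsqr; ring).
  rewrite sin2_cos2, Rmult_1_r. apply sqrt_square. apply Rlt_le, exp_pos.
Qed.

Lemma Cexp_neq_0 (z : C) : Cexp z <> 0.
Proof. apply Cmod_gt_0. rewrite Cmod_Cexp. apply exp_pos. Qed.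

Lemma is_derive_eps (f : R -> R) (x l : R) : is_derive f x l ->
  forall eps, 0 < eps -> exists d, 0 < d /\ forall y, Rabs (y - x) < d ->
    Rabs (f y - f x - (y - x) * l) <= eps * Rabs (y - x).
Proof.
  intros [_ H] eps Heps.
  destruct (H x (fun P HP => HP) (mkposreal _ Heps)) as [d Hd].
  exists d. split; [apply cond_pos|]. intros y Hy. exact (Hd y Hy).
Qed.

Lemma Cderiv_Cexp_0 : Cderiv Cexp 0 1.
Proof.
  (* With m = |(x,y)| < e <= 1/10 one has exp x <= 2, and the two components of the error come to at
     most 3 e m and 4 e m; the total 7 e m is below 10 e m <= eps m. *)
  intros eps Heps. set (e := Rmin eps 1 / 10).
  assert (He : 0 < e <= 1 / 10).
  { unfold e. assert (T := Rmin_r eps 1). assert (T2 := Rmin_pos eps 1 Heps Rlt_0_1). lra. }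
  assert (He' : 10 * e <= eps). { unfold e. assert (T := Rmin_l eps 1). lra. }
  destruct (is_derive_eps exp 0 (exp 0) (is_derive_exp 0) e) as [d1 [P1 Q1]]; [lra|].
  destruct (is_derive_eps cos 0 (- sin 0) (is_derive_cos 0) e) as [d2 [P2 Q2]]; [lra|].
  destruct (is_derive_eps sin 0 (cos 0) (is_derive_sin 0) e) as [d3 [P3 Q3]]; [lra|].
  exists (Rmin e (Rmin d1 (Rmin d2 d3))).
  split; [repeat apply Rmin_pos; lra|].
  intros [x y] Hw.
  rewrite Cexp_0.
  replace ((x, y) - 0)%C with ((x, y) : C) in *
    by (unfold RtoC, Cminus, Cplus, Copp; simpl; f_equal; ring).
  assert (Hx : Rabs x <= Cmod (x, y)).
  { eapply Rle_trans; [|apply Rmax_Cmod]. apply Rmax_l. }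
  assert (Hy : Rabs y <= Cmod (x, y)).
  { eapply Rle_trans; [|apply Rmax_Cmod]. apply Rmax_r. }
  set (m := Cmod (x, y)) in *.
  assert (M1 := Rlt_le_trans _ _ _ Hw (Rmin_l _ _)).
  assert (M2 := Rlt_le_trans _ _ _ Hw (Rmin_r _ _)).
  assert (M3 := Rlt_le_trans _ _ _ M2 (Rmin_l _ _)).
  assert (M4 := Rlt_le_trans _ _ _ M2 (Rmin_r _ _)).
  assert (M5 := Rlt_le_trans _ _ _ M4 (Rmin_l _ _)).
  assert (M6 := Rlt_le_trans _ _ _ M4 (Rmin_r _ _)).
  specialize (Q1 x). specialize (Q2 y). specialize (Q3 y).
  rewrite exp_0, Rminus_0_r, Rmult_1_r in Q1.
  rewrite cos_0, sin_0, Rminus_0_r, Ropp_0, Rmult_0_r, Rminus_0_r in Q2.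
  rewrite sin_0, cos_0, !Rminus_0_r, Rmult_1_r in Q3.
  assert (Q1' := Q1 ltac:(lra)). assert (Q2' := Q2 ltac:(lra)). assert (Q3' := Q3 ltac:(lra)).
  clear Q1 Q2 Q3.
  assert (Hm : 0 <= m) by apply Cmod_ge_0.
  assert (B1 : e * Rabs x <= e * m) by (apply Rmult_le_compat_l; lra).
  assert (B2 : e * Rabs y <= e * m) by (apply Rmult_le_compat_l; lra).
  apply Rabs_le_between in Hx, Hy.
  set (r1 := exp x - 1 - x) in *. set (r2 := cos y - 1) in *. set (r3 := sin y - y) in *.
  replace (Cexp (x, y) - 1 - 1 * (x, y))%C with
    ((r1 + exp x * r2, exp x * r3 + y * (r1 + x)) : C).
  2:{ unfold Cexp, Cminus, Cplus, Copp, Cmult, RtoC, r1, r2, r3; simpl. f_equal; ring. }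
  eapply Rle_trans; [apply Cmod_pair_le|].
  assert (A1 : Rabs r1 <= e * m) by lra.
  assert (A2 : Rabs r2 <= e * m) by lra.
  assert (A3 : Rabs r3 <= e * m) by lra.
  assert (Hem : e * m <= m). { nra. }
  assert (Hex : 0 < exp x <= 2).
  { split; [apply exp_pos|]. apply Rabs_le_between in A1. unfold r1 in A1. lra. }
  assert (Hy' : Rabs y <= m) by (apply Rabs_le; lra).
  assert (Hxr : Rabs (r1 + x) <= 2 * e).
  { apply Rabs_le_between in A1. apply Rabs_le. nra. }
  assert (H1 : Rabs (r1 + exp x * r2) <= 3 * (e * m)).
  { eapply Rle_trans; [apply Rabs_triang|]. rewrite Rabs_mult, (Rabs_right (exp x)) by lra.
    assert (T := Rabs_pos r2). nra. }
  assert (H2 : Rabs (exp x * r3 + y * (r1 + x)) <= 4 * (e * m)).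
  { eapply Rle_trans; [apply Rabs_triang|]. rewrite !Rabs_mult, (Rabs_right (exp x)) by lra.
    assert (T := Rabs_pos r3). assert (T2 := Rabs_pos y). assert (T3 := Rabs_pos (r1 + x)).
    assert (Rabs y * Rabs (r1 + x) <= m * (2 * e)) by (apply Rmult_le_compat; auto). nra. }
  assert (10 * e * m <= eps * m) by (apply Rmult_le_compat_r; lra). nra.
Qed.

Lemma Cderiv_Cexp (z : C) : Cderiv Cexp z (Cexp z).
Proof.
  apply (Cderiv_ext_loc (fun w => Cexp z * Cexp (w - z))%C _ z _ 1); [lra| |].
  - intros w _. rewrite <- Cexp_plus. f_equal. ring.
  - eapply Cderiv_eq.
    + apply (Cderiv_mult (fun _ => Cexp z) (fun w => Cexp (w - z)%C)); [apply Cderiv_const|].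
      apply (Cderiv_comp Cexp (fun w => w - z)%C z 1); [|apply Cderiv_shift].
      replace (z - z)%C with (RtoC 0) by ring. apply Cderiv_Cexp_0.
    + cbv beta. ring.
Qed.

Definition circ (r theta : R) : C := (RtoC r * Cexp (0, theta))%C.

Lemma Cmod_circ r theta : 0 <= r -> Cmod (circ r theta) = r.
Proof. intros H. unfold circ. rewrite Cmod_mult, Cmod_R, Cmod_Cexp, Rabs_right by lra. simpl. rewrite exp_0. ring. Qed.

Lemma circ_exp s theta : Cexp (s, theta) = circ (exp s) theta.
Proof. unfold circ, Cexp, Cmult, RtoC; simpl. rewrite exp_0. f_equal; ring. Qed.

Lemma circ_lip r s t : 0 <= r -> Cmod (circ r s - circ r t)%C <= 2 * r * Rabs (s - t).
Proof.
  intros Hr. unfold circ.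
  replace (r * Cexp (0, s) - r * Cexp (0, t))%C with (r * (Cexp (0, s) - Cexp (0, t)))%C by ring.
  rewrite Cmod_mult, Cmod_R, Rabs_right by lra.
  assert (Cmod (Cexp (0, s) - Cexp (0, t))%C <= 2 * Rabs (s - t)).
  { unfold Cexp, Cminus, Cplus, Copp; simpl. rewrite exp_0.
    eapply Rle_trans; [apply Cmod_pair_le|].
    destruct (MVT_gen cos t s (fun x => - sin x)) as [c1 [_ E1]];
      [intros; apply is_derive_cos|intros; apply continuity_cos|].
    destruct (MVT_gen sin t s cos) as [c2 [_ E2]];
      [intros; apply is_derive_sin|intros; apply continuity_sin|].
    replace (1 * cos s + - (1 * cos t)) with (cos s - cos t) by ring.
    replace (1 * sin s + - (1 * sin t)) with (sin s - sin t) by ring.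
    rewrite E1, E2, !Rabs_mult.
    assert (Rabs (- sin c1) <= 1) by (apply Rabs_le; destruct (SIN_bound c1); lra).
    assert (Rabs (cos c2) <= 1) by (apply Rabs_le; destruct (COS_bound c2); lra).
    assert (T := Rabs_pos (s - t)). nra. }
  nra.
Qed.

(** The derivative is carried as a function, so that it can itself be integrated, estimated and
    differentiated without a choice at each use. *)
Definition holo (f f' : C -> C) (z0 : C) (rho : R) : Prop :=
  forall z, Cmod (z - z0)%C < rho -> Cderiv f z (f' z).

(** Since dz = i (z-z0) dtheta on the circle, the mean of this integrand is (1/(2 pi i)) times the
    contour integral of (f(z) - f(z0)) / (z-z0)^2, Cauchy's integral for f'(z0). Subtracting f(z0)
    makes the integrand tend to f'(z0) as the circle shrinks. *)
Definition circle_diff (f : C -> C) (z0 : C) (r : R) (theta : R) : C :=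
  ((f (z0 + circ r theta) - f z0) * / circ r theta)%C.

Definition circle_mean (f : C -> C) (z0 : C) (r : R) : C :=
  (RtoC (/ (2 * PI)) * CInt (circle_diff f z0 r) 0 (2 * PI))%C.

Lemma Ccont_mult f g z : Ccont f z -> Ccont g z -> Ccont (fun w => f w * g w)%C z.
Proof.
  intros Hf Hg eps Heps.
  assert (T1 := Cmod_ge_0 (f z)). assert (T2 := Cmod_ge_0 (g z)).
  set (A := Cmod (f z) + Cmod (g z) + 1).
  assert (HA : 0 < A) by (unfold A; lra).
  set (e := Rmin 1 (eps / (2 * A))).
  assert (He : 0 < e). { apply Rmin_pos; [lra|]. apply Rdiv_lt_0_compat; lra. }
  assert (He1 : e <= 1) by apply Rmin_l.
  assert (He2 : e * A <= eps / 2).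
  { assert (T := Rmin_r 1 (eps / (2 * A))). fold e in T.
    apply Rmult_le_compat_r with (r := A) in T; [|lra].
    replace (eps / (2 * A) * A) with (eps / 2) in T by (field; lra). exact T. }
  destruct (Hf e He) as [d1 [P1 Q1]]. destruct (Hg e He) as [d2 [P2 Q2]].
  exists (Rmin d1 d2). split; [now apply Rmin_pos|]. intros w Hw.
  specialize (Q1 w (Rlt_le_trans _ _ _ Hw (Rmin_l _ _))).
  specialize (Q2 w (Rlt_le_trans _ _ _ Hw (Rmin_r _ _))).
  replace (f w * g w - f z * g z)%C with
    ((f w - f z) * g z + (f z * (g w - g z) + (f w - f z) * (g w - g z)))%C by ring.
  eapply Rle_lt_trans; [apply Cmod_triangle|].
  eapply Rle_lt_trans; [apply Rplus_le_compat_l, Cmod_triangle|].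
  rewrite !Cmod_mult.
  assert (T3 := Cmod_ge_0 (f w - f z)%C). assert (T4 := Cmod_ge_0 (g w - g z)%C).
  assert (Cmod (f w - f z)%C * Cmod (g z) <= e * Cmod (g z)) by (apply Rmult_le_compat_r; lra).
  assert (Cmod (f z) * Cmod (g w - g z)%C <= Cmod (f z) * e) by (apply Rmult_le_compat_l; lra).
  assert (Cmod (f w - f z)%C * Cmod (g w - g z)%C <= e * 1) by (apply Rmult_le_compat; lra).
  unfold A in He2. lra.
Qed.

Lemma Ccont_const c z : Ccont (fun _ => c) z.
Proof. eapply Cderiv_cont, Cderiv_const. Qed.

Lemma circ_neq_0 r theta : 0 < r -> circ r theta <> 0.
Proof. intros Hr. apply Cmod_gt_0. rewrite Cmod_circ; lra. Qed.

Lemma contC_circle_diff (f : C -> C) z0 r theta : 0 < r -> Ccont f (z0 + circ r theta)%C ->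
  contC (circle_diff f z0 r) theta.
Proof.
  intros Hr Hf. unfold circle_diff.
  apply (contC_comp (fun w => (f (z0 + w) - f z0) * / w)%C (circ r) theta (2 * r)).
  - intros s. apply circ_lip. lra.
  - apply Ccont_mult.
    + apply Ccont_minus; [|apply Ccont_const].
      intros eps He. destruct (Hf eps He) as [d [Hd H]]. exists d. split; auto.
      intros w Hw. apply H. replace (z0 + w - (z0 + circ r theta))%C with (w - circ r theta)%C by ring. auto.
    + eapply Cderiv_cont, Cderiv_inv, circ_neq_0, Hr.
Qed.

(* The integrand is [h (s + i theta)] for [h w = (f (z0 + exp w) - f z0) / exp w], which is
   holomorphic and 2 pi i-periodic; by Goursat its integral over a period does not depend
   on [s], and as [s] tends to minus infinity the integrand tends to [f' z0]. *)
Lemma cauchy_formula f f' z0 rho r : holo f f' z0 rho -> 0 < r < rho -> f' z0 = circle_mean f z0 r.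
Proof.
  intros Hf Hr.
  set (h := fun w => ((f (z0 + Cexp w) - f z0) * / Cexp w)%C).
  assert (Hz0 : Cmod (z0 - z0)%C < rho).
  { replace (z0 - z0)%C with (RtoC 0) by ring. rewrite Cmod_0. lra. }
  assert (Hh : forall w : C, exp (fst w) < rho -> exists l, Cderiv h w l).
  { intros w Hw. eexists. apply Cderiv_mult.
    - apply Cderiv_plus; [|apply Cderiv_const].
      apply (Cderiv_comp f (fun w => z0 + Cexp w)%C).
      + apply Hf. replace (z0 + Cexp w - z0)%C with (Cexp w) by ring. now rewrite Cmod_Cexp.
      + apply Cderiv_plus; [apply Cderiv_const|apply Cderiv_Cexp].
    - apply (Cderiv_comp Cinv Cexp); [apply Cderiv_inv, Cexp_neq_0|apply Cderiv_Cexp]. }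
  assert (HPI := PI_RGT_0).
  set (Q := fun s => CInt (fun y => h (s, y)) 0 (2 * PI)).
  assert (HQ : forall s1 s2, s1 <= s2 -> exp s2 < rho -> Q s1 = Q s2).
  { intros s1 s2 Hs HR.
    assert (G := goursat h s1 s2 0 (2 * PI) Hs ltac:(lra)).
    assert (E : rect_int h s1 s2 0 (2 * PI) = 0).
    { apply G. intros x y Hx _. apply Hh. simpl.
      eapply Rle_lt_trans; [|apply HR]. destruct (Rle_lt_or_eq_dec x s2 (proj2 Hx)) as [H| ->]; [|lra].
      apply Rlt_le. now apply exp_increasing. }
    unfold rect_int in E. fold (Q s1) (Q s2) in E.
    rewrite (CInt_ext (fun x => h (x, 2 * PI)) (fun x => h (x, 0)) s1 s2) in E; auto.
    - assert (E2 : (Ci * (Q s2 - Q s1))%C = 0) by (rewrite <- E; ring).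
      assert (E3 : (Q s2 - Q s1)%C = 0).
      { replace (Q s2 - Q s1)%C with (/ Ci * (Ci * (Q s2 - Q s1)))%C by (field; apply Ci_nz).
        rewrite E2. ring. }
      symmetry. now apply Ceq_minus.
    - intros t _. unfold h. replace (Cexp (t, 2 * PI)) with (Cexp (t, 0)); auto.
      unfold Cexp; simpl. rewrite cos_0, sin_0, cos_2PI, sin_2PI. reflexivity. }
  assert (HQr : Q (ln r) = CInt (circle_diff f z0 r) 0 (2 * PI)).
  { unfold Q. apply CInt_ext; [lra|]. intros t _. unfold h, circle_diff.
    rewrite circ_exp, exp_ln by lra. reflexivity. }
  assert (HQl : Q (ln r) = (RtoC (2 * PI) * f' z0)%C).
  { apply Ceq_minus, Cmod_eq_0. apply Rle_antisym; [|apply Cmod_ge_0].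
    apply le_epsilon. intros eps Heps. rewrite Rplus_0_l.
    destruct (Hf z0 Hz0 (eps / (2 * PI))) as [d [Hd H]]; [apply Rdiv_lt_0_compat; lra|].
    set (r' := Rmin (d / 2) r).
    assert (Hr' : 0 < r') by (apply Rmin_pos; lra).
    assert (Hr'd : r' < d) by (unfold r'; assert (T := Rmin_l (d / 2) r); lra).
    assert (Hr'r : r' <= r) by apply Rmin_r.
    rewrite <- (HQ (ln r') (ln r)).
    2:{ destruct (Rle_lt_or_eq_dec r' r Hr'r) as [H1|H1]; [|rewrite H1; lra]. apply Rlt_le. now apply ln_increasing. }
    2:{ rewrite exp_ln; lra. }
    assert (Ec : CInt (fun _ => f' z0) 0 (2 * PI) = (RtoC (2 * PI) * f' z0)%C).
    { unfold CInt. rewrite RInt_const. rewrite Rminus_0_r. apply scal_C_R. }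
    assert (Hcont : forall t, contC (fun y => h (ln r', y)) t).
    { intros t. apply contC_vertical. destruct (Hh (ln r', t)) as [l Hl].
      - simpl. rewrite exp_ln; lra.
      - eapply Cderiv_cont, Hl. }
    rewrite <- Ec. unfold Q. rewrite <- CInt_minus; auto; try lra; try (intros; apply contC_const).
    replace eps with ((2 * PI - 0) * (eps / (2 * PI))) at 1 by (field; lra).
    apply CInt_bound; [lra| |].
    - intros t _. apply contC_minus; auto. apply contC_const.
    - intros t _. unfold h. rewrite circ_exp, exp_ln by lra.
      set (e := circ r' t). assert (He : e <> 0) by now apply circ_neq_0.
      replace ((f (z0 + e) - f z0) * / e - f' z0)%C with
        ((f (z0 + e) - f z0 - f' z0 * ((z0 + e) - z0)) * / e)%C by (field; auto).
      assert (Ee : Cmod e = r') by (apply Cmod_circ; lra).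
      rewrite Cmod_mult, Cmod_inv, Ee by auto.
      apply Rmult_le_reg_r with r'; auto. rewrite Rmult_assoc, Rinv_l, Rmult_1_r by lra.
      specialize (H (z0 + e)%C). replace (z0 + e - z0)%C with e in * by ring.
      rewrite Ee in H. now apply H. }
  unfold circle_mean. rewrite <- HQr, HQl, Cmult_assoc, <- RtoC_mult.
  rewrite Rinv_l by lra. ring.
Qed.

(** The multiplier [c] makes one rule serve several purposes: 1 gives the real part, -i the
    imaginary part, a conjugate the projection onto a direction. *)
Lemma Rderiv_Re (c : C) (g : R -> C) (t : R) (l : C) :
  Rderiv g t l -> is_derive (fun s => fst (c * g s)%C) t (fst (c * l)%C).
Proof.
  intros H. split; [apply is_linear_scal_l|].
  intros x Hx eps.
  assert (x = t).
  { symmetry. apply (is_filter_lim_locally_unique (K:=R_AbsRing) (V:=R_NormedModule) t x Hx). }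
  subst x.
  assert (Hc : 0 < Cmod c + 1) by (assert (T := Cmod_ge_0 c); lra).
  destruct (H (eps / (Cmod c + 1))) as [d [Hd H']].
  { apply Rdiv_lt_0_compat; [apply cond_pos|lra]. }
  exists (mkposreal d Hd). intros s Hs. specialize (H' s Hs).
  change (Rabs (fst (c * g s)%C - fst (c * g t)%C - (s - t) * fst (c * l)%C) <= eps * Rabs (s - t)).
  replace (_ - _) with (fst (c * (g s - g t - (s - t)%R * l))%C)
    by (unfold Cmult, Cminus, Cplus, Copp, RtoC; simpl; ring).
  eapply Rle_trans; [eapply Rle_trans; [apply Rmax_l|apply Rmax_Cmod]|].
  rewrite Cmod_mult. assert (T := Cmod_ge_0 c).
  apply Rle_trans with ((Cmod c + 1) * (eps / (Cmod c + 1) * Rabs (s - t))).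
  - apply Rmult_le_compat; try lra; apply Cmod_ge_0.
  - right. field. lra.
Qed.

Lemma disc_convex (z0 z w : C) (rho t : R) : Cmod (z - z0)%C < rho -> Cmod (w - z0)%C < rho -> 0 <= t <= 1 ->
  Cmod (z + t * (w - z) - z0)%C < rho.
Proof.
  intros Hz Hw Ht.
  replace (z + t * (w - z) - z0)%C with ((1 - t)%R * (z - z0) + t * (w - z0))%C
    by (rewrite RtoC_minus; ring).
  eapply Rle_lt_trans; [apply Cmod_triangle|].
  rewrite !Cmod_mult, !Cmod_R, !Rabs_right by lra.
  set (m := Rmax (Cmod (z - z0)%C) (Cmod (w - z0)%C)).
  assert (Cmod (z - z0)%C <= m) by apply Rmax_l. assert (Cmod (w - z0)%C <= m) by apply Rmax_r.
  assert (m < rho) by now apply Rmax_lub_lt. nra.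
Qed.

(** A complex function has no exact mean value theorem. Projecting onto the direction D = F(w) -
    F(z) through Re(conj(D) F) gives a real function with increment |D|^2 and derivative at most |D|
    L |w-z|; then |D| is cancelled. *)
Lemma mean_value (F F' : C -> C) (z w : C) (L : R) :
  (forall t, 0 <= t <= 1 -> Cderiv F (z + t * (w - z))%C (F' (z + t * (w - z))%C)) ->
  (forall t, 0 <= t <= 1 -> Cmod (F' (z + t * (w - z))%C) <= L) ->
  Cmod (F w - F z)%C <= L * Cmod (w - z)%C.
Proof.
  intros HF HL. set (D := (F w - F z)%C).
  destruct (Rle_lt_or_eq_dec 0 (Cmod D) (Cmod_ge_0 _)) as [HD|HD].
  2:{ rewrite <- HD. apply Rmult_le_pos; [|apply Cmod_ge_0].
      eapply Rle_trans; [apply Cmod_ge_0|apply (HL 0)]; lra. }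
  set (g := fun s : R => fst (Cconj D * F (z + s * (w - z)))%C).
  set (dg := fun s : R => fst (Cconj D * ((w - z) * F' (z + s * (w - z))))%C).
  assert (Hg : forall s, 0 <= s <= 1 -> is_derive g s (dg s)).
  { intros s Hs. apply Rderiv_Re. apply (Cderiv_line F z (w - z) s). now apply HF. }
  destruct (MVT_gen g 0 1 dg) as [c [Hc E]].
  - intros s Hs. rewrite Rmin_left, Rmax_right in Hs by lra. apply Hg; lra.
  - intros s Hs. rewrite Rmin_left, Rmax_right in Hs by lra.
    apply continuity_pt_filterlim. apply (ex_derive_continuous g). eexists. apply Hg; lra.
  - rewrite Rmin_left, Rmax_right in Hc by lra.
    assert (E1 : g 1 - g 0 = Cmod D * Cmod D).
    { unfold g. replace (z + 1 * (w - z))%C with w by ring. replace (z + 0 * (w - z))%C with z by ring.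
      transitivity (fst (Cconj D * D)%C).
      - unfold D, Cmult, Cconj, Cminus, Cplus, Copp; simpl. ring.
      - rewrite Cmult_comm, <- Cmod2_conj. simpl. ring. }
    rewrite E1, Rminus_0_r, Rmult_1_r in E.
    assert (E2 : dg c <= Cmod D * (L * Cmod (w - z)%C)).
    { unfold dg. eapply Rle_trans; [apply Rle_abs|].
      eapply Rle_trans; [eapply Rle_trans; [apply Rmax_l|apply Rmax_Cmod]|].
      rewrite !Cmod_mult, Cmod_conj. apply Rmult_le_compat_l; [lra|].
      rewrite Rmult_comm. apply Rmult_le_compat_r; [apply Cmod_ge_0|]. now apply HL. }
    nra.
Qed.

Lemma circle_mean_bound (f : C -> C) z0 r M : 0 < r ->
  (forall t, Ccont f (z0 + circ r t)%C) ->
  (forall t, Cmod (f (z0 + circ r t) - f z0)%C <= M) ->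
  Cmod (circle_mean f z0 r) <= M / r.
Proof.
  intros Hr Hc HM. unfold circle_mean. assert (HPI := PI_RGT_0).
  rewrite Cmod_mult, Cmod_R, Rabs_right by (apply Rle_ge, Rlt_le, Rinv_0_lt_compat; lra).
  apply Rmult_le_reg_l with (2 * PI); [lra|].
  rewrite <- Rmult_assoc, Rinv_r, Rmult_1_l by lra.
  replace (2 * PI) with (2 * PI - 0) at 2 by ring.
  apply CInt_bound; [lra| |]; intros t _.
  - now apply contC_circle_diff.
  - unfold circle_diff. rewrite Cmod_mult, Cmod_inv by now apply circ_neq_0.
    rewrite Cmod_circ by lra. apply Rmult_le_compat_r; [apply Rlt_le, Rinv_0_lt_compat; lra|apply HM].
Qed.

Lemma circ_in_disc z0 r rho t : 0 <= r < rho -> Cmod (z0 + circ r t - z0)%C < rho.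
Proof.
  intros H. replace (z0 + circ r t - z0)%C with (circ r t) by ring. rewrite Cmod_circ; lra.
Qed.

Lemma center_in_disc (z : C) (rho : R) : 0 < rho -> Cmod (z - z)%C < rho.
Proof. intros H. replace (z - z)%C with (RtoC 0) by ring. now rewrite Cmod_0. Qed.

Lemma holo_cont f f' z0 rho z : holo f f' z0 rho -> Cmod (z - z0)%C < rho -> Ccont f z.
Proof. intros H Hz. eapply Cderiv_cont, H, Hz. Qed.

(** Cauchy's formula on the circle of radius rho/2, where |f - f(z0)| <= 2M, yields 2M / (rho/2). *)
Lemma cauchy_estimate f f' z0 rho M : 0 < rho -> holo f f' z0 rho ->
  (forall z, Cmod (z - z0)%C < rho -> Cmod (f z) <= M) -> Cmod (f' z0) <= 4 * M / rho.
Proof.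
  intros HR Hf HM. rewrite (cauchy_formula f f' z0 rho (rho / 2)) by (auto; lra).
  replace (4 * M / rho) with ((2 * M) / (rho / 2)) by (field; lra).
  apply circle_mean_bound; [lra| |]; intros t.
  - eapply holo_cont; [apply Hf|]. apply circ_in_disc; lra.
  - unfold Cminus. eapply Rle_trans; [apply Cmod_triangle|]. rewrite Cmod_opp.
    assert (T1 := HM (z0 + circ (rho / 2) t)%C ltac:(apply circ_in_disc; lra)).
    assert (T2 := HM z0 (center_in_disc z0 rho HR)). lra.
Qed.

(** * Uniform estimates for bounded holomorphic functions *)

Lemma disc_sub (z0 z1 z : C) (rho r : R) : Cmod (z1 - z0)%C <= rho - r -> Cmod (z - z1)%C < r ->
  Cmod (z - z0)%C < rho.
Proof.
  intros H1 H2. replace (z - z0)%C with ((z - z1) + (z1 - z0))%C by ring.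
  eapply Rle_lt_trans; [apply Cmod_triangle|lra].
Qed.

Lemma holo_sub f f' z0 z1 rho r : holo f f' z0 rho -> Cmod (z1 - z0)%C <= rho - r -> holo f f' z1 r.
Proof. intros H H1 z Hz. apply H. eapply disc_sub; eauto. Qed.

Lemma Cderiv_opp f z l : Cderiv f z l -> Cderiv (fun p => - f p)%C z (- l)%C.
Proof.
  intros H eps Heps. destruct (H eps Heps) as [d [Hd H']]. exists d. split; auto.
  intros w Hw. rewrite <- Cmod_opp.
  replace (- (- f w - - f z - - l * (w - z)))%C with (f w - f z - l * (w - z))%C by ring. auto.
Qed.

Lemma Cderiv_minus f g z a b : Cderiv f z a -> Cderiv g z b ->
  Cderiv (fun p => f p - g p)%C z (a - b)%C.
Proof. intros Hf Hg. apply Cderiv_plus; [auto|now apply Cderiv_opp]. Qed.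

Lemma Cderiv_translate f h z l : Cderiv f (z + h)%C l -> Cderiv (fun p => f (p + h)%C) z l.
Proof.
  intros H. eapply Cderiv_eq.
  - apply (Cderiv_comp f (fun p => p + h)%C z l (1 + 0)%C); auto.
    apply Cderiv_plus; [apply Cderiv_id|apply Cderiv_const].
  - ring.
Qed.

Lemma bounded_deriv f f' z0 rho M r z : 0 < r -> holo f f' z0 rho ->
  (forall z, Cmod (z - z0)%C < rho -> Cmod (f z) <= M) ->
  Cmod (z - z0)%C <= rho - r -> Cmod (f' z) <= 4 * M / r.
Proof.
  intros Hr Hf HM Hz. apply (cauchy_estimate f f' z r M Hr).
  - eapply holo_sub; eauto.
  - intros w Hw. apply HM. eapply disc_sub; eauto.
Qed.

Lemma bounded_lip f f' z0 rho M r z w : 0 < r -> holo f f' z0 rho ->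
  (forall z, Cmod (z - z0)%C < rho -> Cmod (f z) <= M) ->
  Cmod (z - z0)%C < rho - r -> Cmod (w - z0)%C < rho - r ->
  Cmod (f w - f z)%C <= 4 * M / r * Cmod (w - z)%C.
Proof.
  intros Hr Hf HM Hz Hw. apply mean_value with f'; intros t Ht.
  - apply Hf. assert (T := disc_convex z0 z w (rho - r) t Hz Hw Ht). lra.
  - apply (bounded_deriv f f' z0 rho M r _ Hr Hf HM). apply Rlt_le. now apply disc_convex.
Qed.

(** Differentiability of [f'] is still to be proved, so the mean value inequality cannot be applied
    to it. Instead Cauchy's estimate is applied to p -> f(p+h) - f(p), which is bounded by the
    Lipschitz estimate for [f]. *)
Lemma bounded_deriv_lip f f' z0 rho M r z w : 0 < r -> holo f f' z0 rho ->
  (forall z, Cmod (z - z0)%C < rho -> Cmod (f z) <= M) ->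
  Cmod (z - z0)%C < rho - 2 * r -> Cmod (w - z0)%C < rho - 2 * r ->
  Cmod (f' w - f' z)%C <= 16 * M / (r * r) * Cmod (w - z)%C.
Proof.
  intros Hr Hf HM Hz Hw. set (h := (w - z)%C).
  replace (16 * M / (r * r) * Cmod h) with (4 * (4 * M / r * Cmod h) / r) by (field; lra).
  replace (f' w) with (f' (z + h)%C) by (f_equal; unfold h; ring).
  apply (cauchy_estimate (fun p => f (p + h) - f p)%C (fun p => f' (p + h) - f' p)%C z r); auto.
  - intros p Hp. apply Cderiv_minus.
    + apply Cderiv_translate, Hf.
      replace (p + h - z0)%C with ((p - z) + (w - z0))%C by (unfold h; ring).
      eapply Rle_lt_trans; [apply Cmod_triangle|lra].
    + apply Hf. apply (disc_sub z0 z p rho r); [lra|auto].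
  - intros p Hp. cbv beta.
    replace h with (p + h - p)%C at 2 by ring. apply (bounded_lip f f' z0 rho M r _ _ Hr Hf HM).
    + replace (p - z0)%C with ((p - z) + (z - z0))%C by ring.
      eapply Rle_lt_trans; [apply Cmod_triangle|lra].
    + replace (p + h - z0)%C with ((p - z) + (w - z0))%C by (unfold h; ring).
      eapply Rle_lt_trans; [apply Cmod_triangle|lra].
Qed.

(** Mean value inequality for p -> f(p) - f'(z) p, whose derivative f' - f'(z) is small by
    [bounded_deriv_lip]. The constant depends on [M] and [r] only, so the inequality survives limits
    of sequences. *)
Lemma bounded_taylor f f' z0 rho M r z w : 0 < r -> holo f f' z0 rho ->
  (forall z, Cmod (z - z0)%C < rho -> Cmod (f z) <= M) ->
  Cmod (z - z0)%C < rho - 2 * r -> Cmod (w - z0)%C < rho - 2 * r ->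
  Cmod (f w - f z - f' z * (w - z))%C <= 16 * M / (r * r) * (Cmod (w - z)%C * Cmod (w - z)%C).
Proof.
  intros Hr Hf HM Hz Hw.
  assert (HM0 : 0 <= M).
  { eapply Rle_trans; [apply (Cmod_ge_0 (f z))|apply HM]. lra. }
  assert (HC : 0 <= 16 * M / (r * r)) by (apply Rdiv_le_0_compat; nra).
  replace (f w - f z - f' z * (w - z))%C with
    (f w + - f' z * w - (f z + - f' z * z))%C by ring.
  rewrite <- Rmult_assoc.
  apply (mean_value (fun p => f p + - f' z * p)%C (fun p => f' p + (0 * p + - f' z * 1))%C);
  intros t Ht; assert (T := disc_convex z0 z w (rho - 2 * r) t Hz Hw Ht).
  - apply Cderiv_plus; [apply Hf; lra|].
    apply (Cderiv_mult (fun _ => - f' z)%C (fun p => p)); [apply Cderiv_const|apply Cderiv_id].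
  - replace (f' (z + t * (w - z)) + (0 * (z + t * (w - z)) + - f' z * 1))%C with
      (f' (z + t * (w - z)) - f' z)%C by ring.
    eapply Rle_trans; [apply (bounded_deriv_lip f f' z0 rho M r _ _ Hr Hf HM); auto|].
    apply Rmult_le_compat_l; auto.
    replace (z + t * (w - z) - z)%C with (t * (w - z))%C by ring.
    rewrite Cmod_mult, Cmod_R, Rabs_right by lra.
    assert (T2 := Cmod_ge_0 (w - z)%C). nra.
Qed.

Lemma circle_mean_minus f g z r : 0 < r ->
  (forall t, Ccont f (z + circ r t)%C) -> (forall t, Ccont g (z + circ r t)%C) ->
  circle_mean (fun p => f p - g p)%C z r = (circle_mean f z r - circle_mean g z r)%C.
Proof.
  intros Hr Hf Hg. unfold circle_mean. assert (HPI := PI_RGT_0).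
  set (k := RtoC (/ (2 * PI))).
  transitivity (k * (CInt (circle_diff f z r) 0 (2 * PI) - CInt (circle_diff g z r) 0 (2 * PI)))%C; [|ring].
  rewrite <- (CInt_minus (circle_diff f z r) (circle_diff g z r));
    [|lra|intros; now apply contC_circle_diff..].
  apply (f_equal (fun x => k * x)%C). apply CInt_ext; [lra|]. intros t _. unfold circle_diff. ring.
Qed.

(** For h = w - z0 the difference quotient q(p) = (f(p+h) - f(p))/h is holomorphic, and q'(z0) =
    (f'(w) - f'(z0))/h is its Cauchy integral over a circle. By [bounded_taylor], q is within K |h|
    of f' on that circle, so these quotients converge to the Cauchy integral of f'. *)
Lemma holo_deriv f f' z0 rho : 0 < rho -> holo f f' z0 rho -> exists l, Cderiv f' z0 l.
Proof.
  intros HR0 Hf0.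
  destruct (holo_cont f f' z0 rho z0 Hf0 (center_in_disc z0 rho HR0) 1 Rlt_0_1) as [d [Hd Hcd]].
  set (R1 := Rmin d rho). assert (HR : 0 < R1) by now apply Rmin_pos.
  set (M := Cmod (f z0) + 1).
  assert (Hf : holo f f' z0 R1).
  { intros z Hz. apply Hf0. eapply Rlt_le_trans; [apply Hz|apply Rmin_r]. }
  assert (HM : forall z, Cmod (z - z0)%C < R1 -> Cmod (f z) <= M).
  { intros z Hz. replace (f z) with ((f z - f z0) + f z0)%C by ring.
    eapply Rle_trans; [apply Cmod_triangle|]. unfold M.
    assert (T := Hcd z (Rlt_le_trans _ _ _ Hz (Rmin_l _ _))). lra. }
  clearbody R1 M. clear rho HR0 Hf0 d Hd Hcd.
  set (r := R1 / 4). assert (Hr : 0 < r) by (unfold r; lra).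
  set (K := 16 * M / (r * r)).
  assert (HM0 : 0 <= M).
  { eapply Rle_trans; [apply (Cmod_ge_0 (f z0))|apply HM]. apply center_in_disc; lra. }
  assert (HK : 0 <= K) by (apply Rdiv_le_0_compat; nra).
  set (s := r / 2). assert (Hs : 0 < s) by (unfold s; lra).
  exists (circle_mean f' z0 s).
  intros eps Heps.
  exists (Rmin s (eps * s / (2 * K + 1))). split.
  { apply Rmin_pos; auto. apply Rdiv_lt_0_compat; [|lra]. now apply Rmult_lt_0_compat. }
  intros w Hw.
  assert (H1 := Rlt_le_trans _ _ _ Hw (Rmin_l _ _)).
  assert (H2 := Rlt_le_trans _ _ _ Hw (Rmin_r _ _)).
  destruct (Ceq_dec w z0) as [->|Hne].
  { replace (f' z0 - f' z0 - circle_mean f' z0 s * (z0 - z0))%C with (RtoC 0) by ring.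
    replace (z0 - z0)%C with (RtoC 0) by ring. rewrite Cmod_0. lra. }
  set (h := (w - z0)%C) in *.
  assert (Hh : h <> 0) by (apply Cminus_eq_contra; auto).
  assert (Hh' : 0 < Cmod h) by now apply Cmod_gt_0.
  set (q := fun p => ((f (p + h) - f p) * / h)%C).
  set (q' := fun p => ((f' (p + h) - f' p) * / h)%C).
  assert (Hq : holo q q' z0 r).
  { intros p Hp. unfold q, q'. eapply Cderiv_eq.
    - apply Cderiv_mult; [|apply Cderiv_const]. apply Cderiv_minus.
      + apply Cderiv_translate, Hf.
        replace (p + h - z0)%C with ((p - z0) + h)%C by ring.
        eapply Rle_lt_trans; [apply Cmod_triangle|]. unfold s, r in *. lra.
      + apply Hf. unfold r in *; lra.
    - cbv beta. ring. }
  assert (Hfc : forall p, Cmod (p - z0)%C < 2 * r -> Ccont f' p).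
  { intros p Hp e He. exists (Rmin (2 * r - Cmod (p - z0)%C) (e / (K + 1))). split.
    { apply Rmin_pos; [lra|]. apply Rdiv_lt_0_compat; lra. }
    intros p' Hp'.
    assert (T1 := Rlt_le_trans _ _ _ Hp' (Rmin_l _ _)).
    assert (T2 := Rlt_le_trans _ _ _ Hp' (Rmin_r _ _)).
    eapply Rle_lt_trans.
    - apply (bounded_deriv_lip f f' z0 R1 M r _ _ Hr Hf HM); [unfold r in *; lra|].
      replace (p' - z0)%C with ((p' - p) + (p - z0))%C by ring.
      eapply Rle_lt_trans; [apply Cmod_triangle|]. unfold r in *; lra.
    - fold K. apply Rmult_lt_compat_r with (r := K + 1) in T2; [|lra].
      unfold Rdiv in T2. rewrite Rmult_assoc, Rinv_l in T2 by lra.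
      assert (T3 := Cmod_ge_0 (p' - p)%C). nra. }
  assert (E : ((f' w - f' z0) * / h)%C = circle_mean q z0 s).
  { rewrite <- (cauchy_formula q q' z0 r s Hq) by (unfold s; lra).
    unfold q', h. replace (z0 + (w - z0))%C with w by ring. reflexivity. }
  replace (f' w - f' z0 - circle_mean f' z0 s * h)%C with
    (((f' w - f' z0) * / h - circle_mean f' z0 s) * h)%C by (field; auto).
  rewrite E, Cmod_mult. apply Rmult_le_compat_r; [apply Cmod_ge_0|].
  assert (Hin : forall t, Cmod (z0 + circ s t - z0)%C < r) by (intros; apply circ_in_disc; unfold s; lra).
  assert (Hin0 : forall t, Cmod (z0 + circ s t - z0)%C <= s).
  { intros t. replace (z0 + circ s t - z0)%C with (circ s t) by ring. rewrite Cmod_circ; lra. }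
  assert (Hcq : forall t, Ccont q (z0 + circ s t)%C).
  { intros t. eapply holo_cont; [apply Hq|apply Hin]. }
  assert (Hcf : forall t, Ccont f' (z0 + circ s t)%C).
  { intros t. apply Hfc. assert (T := Hin t). lra. }
  rewrite <- circle_mean_minus; auto.
  assert (B : forall p, Cmod (p - z0)%C <= s -> Cmod (q p - f' p)%C <= K * Cmod h).
  { intros p Hp. unfold q.
    replace ((f (p + h) - f p) * / h - f' p)%C with ((f (p + h) - f p - f' p * ((p + h) - p)) * / h)%C
      by (field; auto).
    rewrite Cmod_mult, Cmod_inv by auto.
    apply Rmult_le_reg_r with (Cmod h); auto. rewrite Rmult_assoc, Rinv_l, Rmult_1_r by lra.
    assert (T := bounded_taylor f f' z0 R1 M r p (p + h)%C Hr Hf HM).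
    fold K in T. replace (p + h - p)%C with h in * by ring.
    rewrite Rmult_assoc. apply T; [unfold s, r in *; lra|].
    replace (p + h - z0)%C with ((p - z0) + h)%C by ring.
    eapply Rle_lt_trans; [apply Cmod_triangle|]. unfold s, r in *. lra. }
  eapply Rle_trans.
  - apply (circle_mean_bound _ z0 s (2 * (K * Cmod h))); auto.
    + intros t. now apply Ccont_minus.
    + intros t. unfold Cminus at 1. eapply Rle_trans; [apply Cmod_triangle|]. rewrite Cmod_opp.
      assert (T1 := B _ (Hin0 t)). assert (T2 := B z0 (Rlt_le _ _ (center_in_disc z0 s Hs))). lra.
  - apply Rmult_le_reg_r with s; auto. unfold Rdiv. rewrite Rmult_assoc, Rinv_l, Rmult_1_r by lra.
    apply Rmult_lt_compat_r with (r := 2 * K + 1) in H2; [|lra].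
    unfold Rdiv in H2. rewrite Rmult_assoc, Rinv_l in H2 by lra. nra.
Qed.

(** * Compactness of bounded families *)

(** Subsequences are handled as infinite index sets: successive selections then compose by
    inclusion, and an increasing enumeration is extracted only once, at the end. *)
Definition inf_set (I : nat -> Prop) : Prop := forall N, exists n, (N <= n)%nat /\ I n.

Lemma inf_set_split (I A B : nat -> Prop) : inf_set I -> (forall n, I n -> A n \/ B n) ->
  inf_set (fun n => I n /\ A n) \/ inf_set (fun n => I n /\ B n).
Proof.
  intros HS HAB. apply NNPP. intros H. apply not_or_and in H. destruct H as [H1 H2].
  apply not_all_ex_not in H1. destruct H1 as [N1 H1].
  apply not_all_ex_not in H2. destruct H2 as [N2 H2].
  destruct (HS (N1 + N2)%nat) as [n [Hn Sn]].
  destruct (HAB n Sn) as [K|K]; [apply H1|apply H2]; exists n; repeat split; auto; lia.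
Qed.

Lemma pigeonhole_interval (x : nat -> R) k : forall (I : nat -> Prop) a b, inf_set I ->
  (forall n, I n -> a <= x n <= b) ->
  exists I' : nat -> Prop, inf_set I' /\ (forall n, I' n -> I n) /\
    forall n m, I' n -> I' m -> Rabs (x n - x m) <= (b - a) * (/ 2) ^ k.
Proof.
  induction k as [|k IH]; intros I a b HS Hx.
  - exists I. repeat split; auto. intros n m Hn Hm.
    assert (T1 := Hx n Hn). assert (T2 := Hx m Hm). apply Rabs_le. simpl. lra.
  - destruct (inf_set_split I (fun n => x n <= (a + b) / 2) (fun n => (a + b) / 2 <= x n) HS) as [H|H].
    { intros n _. lra. }
    + destruct (IH _ a ((a + b) / 2) H) as (I' & H1 & H2 & H3).
      { intros n [Hn Hn']. assert (T := Hx n Hn). lra. }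
      exists I'. split; [auto|split]; [intros n Hn; apply (H2 n Hn)|].
      intros n m Hn Hm. eapply Rle_trans; [apply H3; auto|]. simpl. right. field.
    + destruct (IH _ ((a + b) / 2) b H) as (I' & H1 & H2 & H3).
      { intros n [Hn Hn']. assert (T := Hx n Hn). lra. }
      exists I'. split; [auto|split]; [intros n Hn; apply (H2 n Hn)|].
      intros n m Hn Hm. eapply Rle_trans; [apply H3; auto|]. simpl. right. field.
Qed.

Lemma pigeonhole_real (x : nat -> R) (I : nat -> Prop) (M eps : R) : inf_set I -> 0 < eps ->
  (forall n, I n -> Rabs (x n) <= M) ->
  exists I' : nat -> Prop, inf_set I' /\ (forall n, I' n -> I n) /\
    forall n m, I' n -> I' m -> Rabs (x n - x m) <= eps.
Proof.
  intros HS He Hx.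
  assert (HM : 0 < 2 * Rabs M + 1) by (assert (T := Rabs_pos M); lra).
  destruct (pow_lt_1_zero (/ 2)) with (y := eps / (2 * Rabs M + 1)) as [k Hk].
  { rewrite Rabs_right; lra. }
  { now apply Rdiv_lt_0_compat. }
  specialize (Hk k (Nat.le_refl _)).
  assert (Hp : 0 < (/ 2) ^ k) by (apply pow_lt; lra).
  rewrite Rabs_right in Hk by lra.
  apply Rmult_lt_compat_r with (r := 2 * Rabs M + 1) in Hk; auto.
  unfold Rdiv in Hk. rewrite (Rmult_assoc eps), Rinv_l, Rmult_1_r in Hk by lra.
  destruct (pigeonhole_interval x k I (- Rabs M) (Rabs M) HS) as (I' & H1 & H2 & H3).
  { intros n Hn. assert (T := Hx n Hn). assert (T2 := Rle_abs M). apply Rabs_le_between. lra. }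
  exists I'. repeat split; auto. intros n m Hn Hm. eapply Rle_trans; [apply H3; auto|]. nra.
Qed.

Lemma pigeonhole_C (x : nat -> C) (I : nat -> Prop) (M eps : R) : inf_set I -> 0 < eps ->
  (forall n, I n -> Cmod (x n) <= M) ->
  exists I' : nat -> Prop, inf_set I' /\ (forall n, I' n -> I n) /\
    forall n m, I' n -> I' m -> Cmod (x n - x m)%C <= eps.
Proof.
  intros HS He Hx.
  destruct (pigeonhole_real (fun n => fst (x n)) I M (eps / 2) HS) as (S1 & A1 & A2 & A3); [lra| |].
  { intros n Hn. eapply Rle_trans; [|apply (Hx n Hn)]. eapply Rle_trans; [|apply Rmax_Cmod]. apply Rmax_l. }
  destruct (pigeonhole_real (fun n => snd (x n)) S1 M (eps / 2) A1) as (S2 & B1 & B2 & B3); [lra| |].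
  { intros n Hn. eapply Rle_trans; [|apply (Hx n (A2 n Hn))]. eapply Rle_trans; [|apply Rmax_Cmod]. apply Rmax_r. }
  exists S2. repeat split; auto. intros n m Hn Hm.
  eapply Rle_trans; [apply Cmod_pair_le|].
  assert (T1 := A3 n m (B2 n Hn) (B2 m Hm)). assert (T2 := B3 n m Hn Hm). unfold Copp, Rminus in *; simpl in *. lra.
Qed.

(** Boundedness is assumed point by point, because the square grid of [disc_grid] also contains
    points outside the disc where the functions are controlled. *)
Lemma pigeonhole_list (x : nat -> C -> C) (M eps : R) (l : list C) : 0 < eps ->
  forall I : nat -> Prop, inf_set I ->
  exists I' : nat -> Prop, inf_set I' /\ (forall n, I' n -> I n) /\
    forall p, In p l -> (forall n, I n -> Cmod (x n p) <= M) ->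
    forall n m, I' n -> I' m -> Cmod (x n p - x m p)%C <= eps.
Proof.
  intros He. induction l as [|p l IH]; intros I HS.
  - exists I. repeat split; auto. intros p [].
  - assert (H : exists S1 : nat -> Prop, inf_set S1 /\ (forall n, S1 n -> I n) /\
      ((forall n, I n -> Cmod (x n p) <= M) ->
       forall n m, S1 n -> S1 m -> Cmod (x n p - x m p)%C <= eps)).
    { destruct (classic (forall n, I n -> Cmod (x n p) <= M)) as [K|K].
      - destruct (pigeonhole_C (fun n => x n p) I M eps HS He K) as (S1 & A1 & A2 & A3).
        exists S1. auto.
      - exists I. repeat split; auto. intros; contradiction. }
    destruct H as (S1 & A1 & A2 & A3).
    destruct (IH S1 A1) as (S2 & B1 & B2 & B3).
    exists S2. repeat split; auto. intros q [<-|Hq] Hb n m Hn Hm.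
    + apply A3; auto.
    + apply B3; auto.
Qed.

Lemma grid_interval (eps : R) (N : nat) : 0 < eps -> exists l : list R,
  forall x, 0 <= x <= INR N * eps -> exists y, In y l /\ Rabs (x - y) <= eps.
Proof.
  intros He. induction N as [|N [l Hl]].
  - exists (0 :: nil). intros x Hx. simpl in Hx. exists 0. split; [now left|]. apply Rabs_le. lra.
  - exists (INR N * eps :: l). intros x Hx. rewrite S_INR in Hx.
    destruct (Rle_dec x (INR N * eps)) as [H|H].
    + destruct (Hl x) as [y [Hy1 Hy2]]; [lra|]. exists y. split; [now right|auto].
    + exists (INR N * eps). split; [now left|]. apply Rabs_le. lra.
Qed.

Lemma disc_grid (w : C) (rho eps : R) : 0 < eps -> exists l : list C,
  forall z, Cmod (z - w)%C <= rho -> exists p, In p l /\ Cmod (z - p)%C <= eps.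
Proof.
  intros He.
  destruct (INR_unbounded (4 * rho / eps)) as [N HN].
  destruct (grid_interval (eps / 2) N) as [l Hl]; [lra|].
  exists (map (fun q : R * R => Cplus w (fst q - rho, snd q - rho)) (list_prod l l)).
  intros z Hz.
  assert (Hx : Rabs (fst (z - w)%C) <= rho).
  { eapply Rle_trans; [|apply Hz]. eapply Rle_trans; [|apply Rmax_Cmod]. apply Rmax_l. }
  assert (Hy : Rabs (snd (z - w)%C) <= rho).
  { eapply Rle_trans; [|apply Hz]. eapply Rle_trans; [|apply Rmax_Cmod]. apply Rmax_r. }
  apply Rabs_le_between in Hx, Hy.
  assert (HN' : 2 * rho <= INR N * (eps / 2)).
  { apply Rlt_le. apply Rmult_lt_compat_r with (r := eps / 2) in HN; [|lra].
    replace (4 * rho / eps * (eps / 2)) with (2 * rho) in HN by (field; lra). lra. }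
  destruct (Hl (fst (z - w)%C + rho)) as [a [Ha1 Ha2]]; [lra|].
  destruct (Hl (snd (z - w)%C + rho)) as [b [Hb1 Hb2]]; [lra|].
  exists (Cplus w (a - rho, b - rho)). split.
  - apply in_map_iff. exists (a, b). split; auto. now apply in_prod.
  - replace (z - Cplus w (a - rho, b - rho)%R)%C with
      ((fst (z - w)%C + rho - a, snd (z - w)%C + rho - b) : C).
    + eapply Rle_trans; [apply Cmod_pair_le|]. lra.
    + destruct z, w. unfold Cminus, Cplus, Copp; simpl. f_equal; ring.
Qed.

(** One Arzela-Ascoli step: Cauchy's estimate gives a common Lipschitz constant, so agreement within
    eps/2 on a finite grid spreads to the disc at a cost of eps/4 for each of the two functions. *)
Lemma uniform_pigeonhole (u u' : nat -> C -> C) (w : C) (rho M eps : R) (I : nat -> Prop) :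
  0 < rho -> 0 < eps -> inf_set I ->
  (forall n, I n -> holo (u n) (u' n) w rho) ->
  (forall n z, I n -> Cmod (z - w)%C < rho -> Cmod (u n z) <= M) ->
  exists I' : nat -> Prop, inf_set I' /\ (forall n, I' n -> I n) /\
    forall n m z, I' n -> I' m -> Cmod (z - w)%C < rho / 4 -> Cmod (u n z - u m z)%C <= eps.
Proof.
  intros Hrho He HS Hu HM.
  assert (HM0 : 0 <= M).
  { destruct (HS 0%nat) as [n [_ Hn]]. eapply Rle_trans; [apply Cmod_ge_0|].
    apply (HM n w Hn). apply center_in_disc; lra. }
  set (L := 4 * M / (rho / 2)).
  assert (HL : 0 <= L) by (apply Rdiv_le_0_compat; lra).
  (* The first bound keeps the grid point next to z within rho/2 of the centre, where the Lipschitz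
     constant holds; the second makes L d <= eps/4. *)
  set (d := Rmin (rho / 8) (eps / (4 * (L + 1)))).
  assert (Hd : 0 < d) by (apply Rmin_pos; [lra|apply Rdiv_lt_0_compat; lra]).
  assert (HLd : L * d <= eps / 4).
  { assert (T : d <= eps / (4 * (L + 1))) by apply Rmin_r.
    apply Rmult_le_compat_l with (r := L + 1) in T; [|lra].
    replace ((L + 1) * (eps / (4 * (L + 1)))) with (eps / 4) in T by (field; lra). lra. }
  destruct (disc_grid w (rho / 4) d Hd) as [l Hl].
  destruct (pigeonhole_list u M (eps / 2) l) with (I := I) as (I' & A1 & A2 & A3); [lra|auto|].
  exists I'. repeat split; auto. intros n m z Hn Hm Hz.
  destruct (Hl z) as [p [Hp1 Hp2]]; [lra|].
  assert (d <= rho / 8) by apply Rmin_l.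
  assert (Hp : Cmod (p - w)%C < rho / 2).
  { replace (p - w)%C with (- (z - p) + (z - w))%C by ring.
    eapply Rle_lt_trans; [apply Cmod_triangle|]. rewrite Cmod_opp. lra. }
  assert (B : forall k, I k -> Cmod (u k z - u k p)%C <= eps / 4).
  { intros k Hk. eapply Rle_trans.
    - apply (bounded_lip (u k) (u' k) w rho M (rho / 2)); [lra|auto|intros; now apply HM|lra|lra].
    - fold L. eapply Rle_trans; [|apply HLd]. now apply Rmult_le_compat_l. }
  replace (u n z - u m z)%C with ((u n z - u n p) + ((u n p - u m p) + - (u m z - u m p)))%C by ring.
  eapply Rle_trans; [apply Cmod_triangle|].
  eapply Rle_trans; [apply Rplus_le_compat_l, Cmod_triangle|]. rewrite Cmod_opp.
  assert (B1 := B n (A2 n Hn)). assert (B2 := B m (A2 m Hm)).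
  assert (B3 : Cmod (u n p - u m p)%C <= eps / 2).
  { apply A3; auto. intros k Hk. apply HM; auto. lra. }
  lra.
Qed.

(** The n-th index is picked in the n-th of a decreasing chain of infinite sets, beyond the previous
    pick; from position k on, all picks lie in the k-th set. *)
Lemma diagonal_subsequence (Q : nat -> (nat -> Prop) -> Prop) (I : nat -> Prop) : inf_set I ->
  (forall k (S1 : nat -> Prop), inf_set S1 -> (forall n, S1 n -> I n) ->
     exists S2 : nat -> Prop, inf_set S2 /\ (forall n, S2 n -> S1 n) /\ Q k S2) ->
  exists phi : nat -> nat, (forall n, (phi n < phi (S n))%nat) /\ (forall n, I (phi n)) /\
    forall k, exists S2 : nat -> Prop, Q k S2 /\ forall n, (k <= n)%nat -> S2 (phi n).
Proof.
  intros HS HQ.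
  set (T := {S1 : nat -> Prop | inf_set S1 /\ forall n, S1 n -> I n}).
  assert (Hn : forall kS : nat * T, exists S2 : T,
    (forall n, proj1_sig S2 n -> proj1_sig (snd kS) n) /\ Q (fst kS) (proj1_sig S2)).
  { intros [k [S1 [H1 H2]]]. destruct (HQ k S1 H1 H2) as (S2 & A1 & A2 & A3).
    assert (K : inf_set S2 /\ forall n, S2 n -> I n) by auto.
    exists (exist _ S2 K). simpl. auto. }
  apply choice in Hn. destruct Hn as [next Hnext].
  set (s0 := exist _ I (conj HS (fun n H => H)) : T).
  (* Entry k is the set after the k-th selection, [s0] standing before all of them, so [Q 0] already
     holds at entry 0. *)
  set (s := fix s (k : nat) : T := next (k, match k with O => s0 | S j => s j end)).
  assert (Hs : forall k, Q k (proj1_sig (s k))).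
  { intros [|k]; [exact (proj2 (Hnext (O, s0)))|exact (proj2 (Hnext (S k, s k)))]. }
  assert (Hdec : forall k n, proj1_sig (s (S k)) n -> proj1_sig (s k) n).
  { intros k n. exact (proj1 (Hnext (S k, s k)) n). }
  assert (Hdec' : forall j k n, (j <= k)%nat -> proj1_sig (s k) n -> proj1_sig (s j) n).
  { intros j k n H. induction H; auto. }
  assert (Hpick : forall kN : nat * nat, exists n, (snd kN < n)%nat /\ proj1_sig (s (fst kN)) n).
  { intros [k N]. destruct (proj2_sig (s k)) as [K _]. destruct (K (S N)) as [n [H1 H2]].
    exists n. split; auto. }
  apply choice in Hpick. destruct Hpick as [pick Hp].
  set (phi := fix phi (n : nat) : nat := pick (n, match n with O => O | S j => phi j end)).
  assert (Hphi : forall n, proj1_sig (s n) (phi n)).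
  { intros [|n]; [exact (proj2 (Hp (O, O)))|exact (proj2 (Hp (S n, phi n)))]. }
  exists phi. split; [|split].
  - intros n. exact (proj1 (Hp (S n, phi n))).
  - intros n. apply (proj2_sig (s n)), Hphi.
  - intros k. exists (proj1_sig (s k)). split; auto.
    intros n Hkn. apply (Hdec' k n); auto.
Qed.

Lemma C_complete (v : nat -> C) :
  (forall eps, 0 < eps -> exists N, forall n m, (N <= n)%nat -> (N <= m)%nat -> Cmod (v n - v m)%C <= eps) ->
  exists l : C, forall eps, 0 < eps -> exists N, forall n, (N <= n)%nat -> Cmod (v n - l)%C <= eps.
Proof.
  intros H.
  assert (Hf : Cauchy_crit (fun n => fst (v n))).
  { intros eps He. destruct (H (eps / 2)) as [N HN]; [lra|]. exists N. intros n m Hn Hm.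
    unfold Rdist. eapply Rle_lt_trans; [|apply (Rle_lt_trans _ _ eps (HN n m Hn Hm)); lra].
    eapply Rle_trans; [|apply Rmax_Cmod]. apply Rmax_l. }
  assert (Hs : Cauchy_crit (fun n => snd (v n))).
  { intros eps He. destruct (H (eps / 2)) as [N HN]; [lra|]. exists N. intros n m Hn Hm.
    unfold Rdist. eapply Rle_lt_trans; [|apply (Rle_lt_trans _ _ eps (HN n m Hn Hm)); lra].
    eapply Rle_trans; [|apply Rmax_Cmod]. apply Rmax_r. }
  destruct (Rcomplete.R_complete _ Hf) as [a Ha]. destruct (Rcomplete.R_complete _ Hs) as [b Hb].
  exists (a, b). intros eps He.
  destruct (Ha (eps / 2)) as [N1 H1]; [lra|]. destruct (Hb (eps / 2)) as [N2 H2]; [lra|].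
  exists (N1 + N2)%nat. intros n Hn.
  eapply Rle_trans; [apply Cmod_pair_le|].
  specialize (H1 n ltac:(lia)). specialize (H2 n ltac:(lia)).
  unfold Rdist, Rminus, Copp in *; simpl. lra.
Qed.

(** The diagonal subsequence is uniformly Cauchy on radius rho/4. Halving the radius leaves room for
    Cauchy's estimate on differences, so the derivatives converge as well, and the quadratic Taylor
    inequality with its common constant [K] passes to the limit, which makes [g] differentiable. *)
Lemma small_montel (u u' : nat -> C -> C) (w : C) (rho M : R) (I : nat -> Prop) :
  0 < rho -> inf_set I ->
  (forall n, I n -> holo (u n) (u' n) w rho) ->
  (forall n z, I n -> Cmod (z - w)%C < rho -> Cmod (u n z) <= M) ->
  exists (phi : nat -> nat) (g : C -> C), (forall n, (phi n < phi (S n))%nat) /\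
    (forall z, Cmod (z - w)%C < rho / 8 -> exists l, Cderiv g z l) /\
    forall eps, 0 < eps -> exists N, forall n z, (N <= n)%nat -> Cmod (z - w)%C < rho / 8 ->
      Cmod (u (phi n) z - g z)%C <= eps.
Proof.
  intros Hrho HS Hu HM.
  destruct (diagonal_subsequence (fun k S2 => forall n m z, S2 n -> S2 m -> Cmod (z - w)%C < rho / 4 ->
     Cmod (u n z - u m z)%C <= / (INR k + 1)) I HS) as (phi & Hphi & HphiS & HQ).
  { intros k S1 H1 H2. apply (uniform_pigeonhole u u' w rho M); auto.
    apply Rinv_0_lt_compat. assert (T := pos_INR k). lra. }
  assert (HC : forall eps, 0 < eps -> exists N, forall n m z, (N <= n)%nat -> (N <= m)%nat ->
     Cmod (z - w)%C < rho / 4 -> Cmod (u (phi n) z - u (phi m) z)%C <= eps).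
  { intros eps He. destruct (INR_unbounded (/ eps)) as [k Hk].
    destruct (HQ k) as [S2 [Q1 Q2]]. exists k. intros n m z Hn Hm Hz.
    eapply Rle_trans; [apply Q1; auto|].
    rewrite <- (Rinv_inv eps). apply Rinv_le_contravar; [apply Rinv_0_lt_compat; lra|lra]. }
  assert (HL : forall z, exists l : C, Cmod (z - w)%C < rho / 4 ->
     forall eps, 0 < eps -> exists N, forall n, (N <= n)%nat -> Cmod (u (phi n) z - l)%C <= eps).
  { intros z. destruct (Rlt_dec (Cmod (z - w)%C) (rho / 4)) as [Hz|Hz].
    - destruct (C_complete (fun n => u (phi n) z)) as [l Hl].
      + intros eps He. destruct (HC eps He) as [N HN]. exists N. intros; apply HN; auto.
      + exists l. auto.
    - exists 0. intros; contradiction. }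
  apply choice in HL. destruct HL as [g Hg].
  assert (Hlim : forall eps, 0 < eps -> exists N, forall n z, (N <= n)%nat -> Cmod (z - w)%C < rho / 4 ->
      Cmod (u (phi n) z - g z)%C <= eps).
  { intros eps He. destruct (HC (eps / 2)) as [N HN]; [lra|]. exists N. intros n z Hn Hz.
    destruct (Hg z Hz (eps / 2)) as [N2 HN2]; [lra|].
    replace (u (phi n) z - g z)%C with
      ((u (phi n) z - u (phi (N + N2)%nat) z) + (u (phi (N + N2)%nat) z - g z))%C by ring.
    eapply Rle_trans; [apply Cmod_triangle|].
    assert (T1 := HN n (N + N2)%nat z Hn ltac:(lia) Hz). assert (T2 := HN2 (N + N2)%nat ltac:(lia)). lra. }
  exists phi, g. split; auto. split.
  2:{ intros eps He. destruct (Hlim eps He) as [N HN]. exists N. intros n z Hn Hz. apply HN; auto. lra. }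
  intros z Hz.
  destruct (C_complete (fun n => u' (phi n) z)) as [l Hl].
  (* Cauchy's estimate on radius rho/8 turns a bound [e] for the difference of two functions into 4
     e / (rho/8) = eps for their derivatives. *)
  { intros eps He. set (e := eps * (rho / 8) / 4).
    assert (0 < e) by (unfold e; assert (0 < eps * (rho / 8)) by (apply Rmult_lt_0_compat; lra); lra).
    destruct (HC e) as [N HN]; auto. exists N. intros n m Hn Hm.
    replace eps with (4 * e / (rho / 8)) by (unfold e; field; lra).
    apply (cauchy_estimate (fun p => u (phi n) p - u (phi m) p)%C
       (fun p => u' (phi n) p - u' (phi m) p)%C); [lra| |].
    - intros p Hp. assert (Cmod (p - w)%C < rho) by (apply (disc_sub w z p rho (rho / 8)); lra).
      apply Cderiv_minus; apply Hu; auto.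
    - intros p Hp. apply HN; auto. apply (disc_sub w z p (rho / 4) (rho / 8)); lra. }
  exists l.
  set (K := 16 * M / (rho / 4 * (rho / 4))).
  assert (HM0 : 0 <= M).
  { destruct (HS 0%nat) as [n [_ Hn]]. eapply Rle_trans; [apply Cmod_ge_0|].
    apply (HM n w Hn). apply center_in_disc; lra. }
  assert (HK : 0 <= K) by (apply Rdiv_le_0_compat; nra).
  assert (HT : forall p, Cmod (p - w)%C < rho / 4 ->
     Cmod (g p - g z - l * (p - z))%C <= K * (Cmod (p - z)%C * Cmod (p - z)%C)).
  { intros p Hp. apply le_epsilon. intros eps He.
    (* The errors at p, at z and in the derivative enter with weights 1, 1 and |p-z|, so together
       they amount to eps. *)
    set (e := eps / (2 + Cmod (p - z)%C)).
    assert (Hpz := Cmod_ge_0 (p - z)%C).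
    assert (He' : 0 < e) by (apply Rdiv_lt_0_compat; lra).
    destruct (Hlim e He') as [N1 HN1]. destruct (Hl e He') as [N2 HN2].
    set (n := (N1 + N2)%nat).
    assert (T1 := HN1 n p ltac:(unfold n; lia) Hp). assert (T2 := HN1 n z ltac:(unfold n; lia) ltac:(lra)).
    assert (T3 := HN2 n ltac:(unfold n; lia)).
    assert (T4 : Cmod (u (phi n) p - u (phi n) z - u' (phi n) z * (p - z))%C <=
       K * (Cmod (p - z)%C * Cmod (p - z)%C)).
    { apply (bounded_taylor _ _ w rho M (rho / 4)); [lra|auto|intros; now apply HM|lra|lra]. }
    replace (g p - g z - l * (p - z))%C with
      ((u (phi n) p - u (phi n) z - u' (phi n) z * (p - z)) +
       (- (u (phi n) p - g p) + ((u (phi n) z - g z) + (u' (phi n) z - l) * (p - z))))%C by ring.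
    eapply Rle_trans; [apply Cmod_triangle|]. apply Rplus_le_compat; auto.
    eapply Rle_trans; [apply Cmod_triangle|]. rewrite Cmod_opp.
    eapply Rle_trans; [apply Rplus_le_compat_l, Cmod_triangle|]. rewrite Cmod_mult.
    assert (Cmod (u' (phi n) z - l)%C * Cmod (p - z)%C <= e * Cmod (p - z)%C)
      by (apply Rmult_le_compat_r; auto).
    replace eps with (e * (2 + Cmod (p - z)%C)) by (unfold e; field; lra). lra. }
  intros eps He.
  exists (Rmin (rho / 8) (eps / (K + 1))). split.
  { apply Rmin_pos; [lra|]. apply Rdiv_lt_0_compat; lra. }
  intros p Hp.
  assert (H1 := Rlt_le_trans _ _ _ Hp (Rmin_l _ _)).
  assert (H2 := Rlt_le_trans _ _ _ Hp (Rmin_r _ _)).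
  eapply Rle_trans; [apply HT; apply (disc_sub w z p (rho / 4) (rho / 8)); lra|].
  apply Rmult_lt_compat_r with (r := K + 1) in H2; [|lra].
  unfold Rdiv in H2. rewrite Rmult_assoc, Rinv_l in H2 by lra.
  assert (T := Cmod_ge_0 (p - z)%C). rewrite <- Rmult_assoc. apply Rmult_le_compat_r; auto. nra.
Qed.

(** * The Laplacian and the maximum principle *)

(** Upper semicontinuity suffices. Bisection keeps a rectangle in which every value of [g] on the
    disc is matched or exceeded: if all four quarters failed, the largest of the four unmatched
    values would be unmatched in the whole. At the limit point semicontinuity gives the maximum. *)
Lemma disc_attains_max (g : C -> R) (z0 : C) (rho : R) : 0 <= rho ->
  (forall z, Cmod (z - z0)%C <= rho -> forall eps, 0 < eps -> exists d, 0 < d /\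
     forall w, Cmod (w - z0)%C <= rho -> Cmod (w - z)%C < d -> g w < g z + eps) ->
  exists z, Cmod (z - z0)%C <= rho /\ forall w, Cmod (w - z0)%C <= rho -> g w <= g z.
Proof.
  intros Hrho Hg. set (K := fun z : C => Cmod (z - z0)%C <= rho).
  set (P := fun a b c d : R => forall z, K z -> exists x y, a <= x <= b /\ c <= y <= d /\
     K (x, y) /\ g z <= g (x, y)).
  destruct z0 as [p q].
  destruct (rect_bisection P (p - rho) (p + rho) (q - rho) (q + rho)) as (x & y & Hx & Hy & H).
  - intros a b c d _ _ _ _ HP. apply NNPP. intros HN.
    apply not_or_and in HN as [N1 HN]. apply not_or_and in HN as [N2 HN].
    apply not_or_and in HN as [N3 N4].
    apply not_all_ex_not in N1 as [z1 N1]. apply not_all_ex_not in N2 as [z2 N2].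
    apply not_all_ex_not in N3 as [z3 N3]. apply not_all_ex_not in N4 as [z4 N4].
    apply imply_to_and in N1 as [K1 N1]. apply imply_to_and in N2 as [K2 N2].
    apply imply_to_and in N3 as [K3 N3]. apply imply_to_and in N4 as [K4 N4].
    assert (Hm : forall u v, K u -> K v -> exists w, K w /\ g u <= g w /\ g v <= g w).
    { intros u v Hu Hv. destruct (Rle_dec (g u) (g v)); [exists v|exists u]; repeat split; auto; lra. }
    destruct (Hm z1 z2 K1 K2) as (u & Ku & U1 & U2).
    destruct (Hm z3 z4 K3 K4) as (v & Kv & V1 & V2).
    destruct (Hm u v Ku Kv) as (w & Kw & W1 & W2).
    destruct (HP w Kw) as (x & y & Hx & Hy & Kxy & Hgw).
    destruct (Rle_dec x ((a + b) / 2)), (Rle_dec y ((c + d) / 2));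
    [apply N1|apply N3|apply N2|apply N4]; exists x, y; repeat split; auto; lra.
  - lra.
  - lra.
  - intros [x y] Hz. exists x, y.
    assert (H1 : Rabs (fst ((x, y) - (p, q))%C) <= rho).
    { eapply Rle_trans; [|apply Hz]. eapply Rle_trans; [|apply Rmax_Cmod]. apply Rmax_l. }
    assert (H2 : Rabs (snd ((x, y) - (p, q))%C) <= rho).
    { eapply Rle_trans; [|apply Hz]. eapply Rle_trans; [|apply Rmax_Cmod]. apply Rmax_r. }
    apply Rabs_le_between in H1, H2. simpl in H1, H2. repeat split; try lra; auto.
  - assert (Hnear : forall d, 0 < d -> forall z, K z -> exists w, K w /\ Cmod (w - (x, y))%C < d /\ g z <= g w).
    { intros e He z Hz. destruct (H (e / 2)) as (a & b & c & d & H1 & H2 & H3 & H4 & H5 & H6 & HP); [lra|].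
      destruct (HP z Hz) as (x' & y' & Hx' & Hy' & Kx & Hgx). exists (x', y'). repeat split; auto.
      eapply Rle_lt_trans; [apply Cmod_pair_le|]. unfold Copp; simpl.
      assert (Rabs (x' + - x) <= b - a) by (apply Rabs_le; lra).
      assert (Rabs (y' + - y) <= d - c) by (apply Rabs_le; lra). lra. }
    (* Disc points come arbitrarily close to the limit point, and the closed disc contains its limit
       points. *)
    assert (HKxy : K (x, y)).
    { apply Rnot_lt_le. intros Hlt.
      destruct (Hnear (Cmod ((x, y) - (p, q))%C - rho)) with (z := (p, q) : C) as (w & Kw & Hw & _); [lra| |].
      - unfold K. replace ((p, q) - (p, q))%C with (RtoC 0); [rewrite Cmod_0; auto|].
        unfold RtoC, Cminus, Cplus, Copp; simpl. f_equal; ring.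
      - unfold K in Kw. set (z := (x, y) : C) in *. set (o := (p, q) : C) in *.
        replace (z - o)%C with (- (w - z) + (w - o))%C in Hw by ring.
        assert (T := Cmod_triangle (- (w - z))%C (w - o)%C). rewrite Cmod_opp in T. lra. }
    exists (x, y). split; auto. intros w Hw.
    apply le_epsilon. intros eps He.
    destruct (Hg (x, y) HKxy eps He) as [d [Hd Hd']].
    destruct (Hnear d Hd w Hw) as (w' & Kw & H1 & H2). specialize (Hd' w' Kw H1). lra.
Qed.

Definition D2 (g : R -> R) (a b : R) : Prop :=
  exists g' : R -> R, (exists d, 0 < d /\ forall t, Rabs t < d -> is_derive g t (g' t)) /\
    g' 0 = a /\ is_derive g' 0 b.

(** The first derivative vanishes by Fermat's argument. A positive second derivative would then make
    [g'] positive just to the right of 0, and by the mean value theorem [g] would exceed g(0)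
    there. *)
Lemma D2_max g a b : D2 g a b -> (exists d, 0 < d /\ forall t, Rabs t < d -> g t <= g 0) -> b <= 0.
Proof.
  intros (g' & [d1 [Hd1 H1]] & Ha & Hb) [d2 [Hd2 Hmax]].
  apply Rnot_lt_le. intros Hpos.
  assert (Ha0 : a = 0).
  { destruct (Req_dec a 0) as [|Hne]; auto. exfalso.
    assert (Hab : 0 < Rabs a) by now apply Rabs_pos_lt.
    assert (H0 : is_derive g 0 a) by (rewrite <- Ha; apply H1; rewrite Rabs_R0; auto).
    destruct (is_derive_eps g 0 a H0 (Rabs a / 2)) as [d [Hd H]]; [lra|].
    set (s := Rmin d d2 / 2).
    assert (Hs : 0 < s /\ s < d /\ s < d2).
    { assert (T := Rmin_pos d d2 Hd Hd2). assert (T1 := Rmin_l d d2). assert (T2 := Rmin_r d d2).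
      unfold s. lra. }
    destruct (Rlt_le_dec 0 a) as [Hp|Hp].
    - rewrite (Rabs_right a) in H by lra.
      specialize (H s). rewrite Rminus_0_r, (Rabs_right s) in H by lra.
      specialize (H ltac:(lra)). specialize (Hmax s). rewrite Rabs_right in Hmax by lra.
      specialize (Hmax ltac:(lra)). apply Rabs_le_between in H. nra.
    - rewrite (Rabs_left a) in H by lra.
      specialize (H (- s)). rewrite Rminus_0_r, Rabs_Ropp, (Rabs_right s) in H by lra.
      specialize (H ltac:(lra)). specialize (Hmax (- s)). rewrite Rabs_Ropp, Rabs_right in Hmax by lra.
      specialize (Hmax ltac:(lra)). apply Rabs_le_between in H. nra. }
  destruct (is_derive_eps g' 0 b Hb (b / 2)) as [d [Hd H]]; [lra|].
  set (s := Rmin d (Rmin d1 d2) / 2).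
  assert (Hs : 0 < s /\ s < d /\ s < d1 /\ s < d2).
  { assert (T0 := Rmin_pos d1 d2 Hd1 Hd2). assert (T := Rmin_pos d _ Hd T0).
    assert (T1 := Rmin_l d (Rmin d1 d2)). assert (T2 := Rmin_r d (Rmin d1 d2)).
    assert (T3 := Rmin_l d1 d2). assert (T4 := Rmin_r d1 d2). unfold s. lra. }
  destruct (MVT_cor2 g g' 0 s) as [c [E Hc]]; [lra| |].
  { intros c Hc. apply is_derive_Reals. apply H1. rewrite Rabs_right; lra. }
  specialize (Hmax s). rewrite Rabs_right in Hmax by lra. specialize (Hmax ltac:(lra)).
  specialize (H c). rewrite Rminus_0_r, Rabs_right in H by lra. specialize (H ltac:(lra)).
  rewrite Ha, Ha0 in H. apply Rabs_le_between in H.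
  assert (0 < c * b) by (apply Rmult_lt_0_compat; lra).
  assert (0 < g' c * (s - 0)) by (apply Rmult_lt_0_compat; lra). lra.
Qed.

Lemma D2_plus f g a b a' b' : D2 f a b -> D2 g a' b' -> D2 (fun t => f t + g t) (a + a') (b + b').
Proof.
  intros (f' & [d1 [Hd1 H1]] & Ha & Hb) (g' & [d2 [Hd2 H2]] & Ha' & Hb').
  exists (fun t => f' t + g' t). split; [|split].
  - exists (Rmin d1 d2). split; [now apply Rmin_pos|]. intros t Ht.
    apply (is_derive_plus (K := R_AbsRing) (V := R_NormedModule)); [apply H1|apply H2];
    (eapply Rlt_le_trans; [apply Ht|]); [apply Rmin_l|apply Rmin_r].
  - now rewrite Ha, Ha'.
  - now apply (is_derive_plus (K := R_AbsRing) (V := R_NormedModule)).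
Qed.

Lemma D2_scal f a b k : D2 f a b -> D2 (fun t => k * f t) (k * a) (k * b).
Proof.
  intros (f' & [d1 [Hd1 H1]] & Ha & Hb).
  exists (fun t => k * f' t). split; [|split].
  - exists d1. split; auto. intros t Ht. apply (is_derive_scal f t k), H1, Ht.
  - now rewrite Ha.
  - now apply (is_derive_scal f' 0 k).
Qed.

Lemma is_derive_continuous_eps (f : R -> R) x l : is_derive f x l ->
  forall eps, 0 < eps -> exists d, 0 < d /\ forall y, Rabs (y - x) < d -> Rabs (f y - f x) < eps.
Proof.
  intros H eps He.
  assert (Hc : continuous f x) by (apply (ex_derive_continuous f); eexists; apply H).
  destruct (proj1 (filterlim_locally f (f x)) Hc (mkposreal _ He)) as [d Hd]. exists d. split; [apply cond_pos|].
  intros y Hy. apply (Hd y Hy).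
Qed.

Lemma D2_comp f psi psi' c a b : D2 f a b ->
  (exists d, 0 < d /\ forall s, Rabs (s - f 0) < d -> is_derive psi s (psi' s)) ->
  is_derive psi' (f 0) c ->
  D2 (fun t => psi (f t)) (psi' (f 0) * a) (c * (a * a) + psi' (f 0) * b).
Proof.
  intros (f' & [d1 [Hd1 H1]] & Ha & Hb) [d2 [Hd2 H2]] Hc.
  assert (Hf0 : is_derive f 0 (f' 0)) by (apply H1; rewrite Rabs_R0; auto).
  exists (fun t => psi' (f t) * f' t). split; [|split].
  - destruct (is_derive_continuous_eps f 0 _ Hf0 d2 Hd2) as [d3 [Hd3 H3]].
    exists (Rmin d1 d3). split; [now apply Rmin_pos|]. intros t Ht.
    rewrite Rmult_comm. apply (is_derive_comp psi f).
    + apply H2, H3. rewrite Rminus_0_r. eapply Rlt_le_trans; [apply Ht|apply Rmin_r].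
    + apply H1. eapply Rlt_le_trans; [apply Ht|apply Rmin_l].
  - now rewrite Ha.
  - replace (c * (a * a) + psi' (f 0) * b) with (a * c * f' 0 + psi' (f 0) * b) by (rewrite Ha; ring).
    apply (is_derive_mult (fun t => psi' (f t)) f'); [|auto|intros; apply Rmult_comm].
    apply (is_derive_comp psi' f); auto. now rewrite <- Ha.
Qed.

(* [lap phi z gx gy l]: [phi] has gradient [(gx, gy)] and Laplacian [l] at [z]. *)
Definition lap (phi : C -> R) (z : C) (gx gy l : R) : Prop :=
  exists b1 b2, D2 (fun t : R => phi (z + t * 1)%C) gx b1 /\
    D2 (fun t : R => phi (z + t * Ci)%C) gy b2 /\ l = b1 + b2.

Lemma lap_max phi z gx gy l : lap phi z gx gy l ->
  (exists d, 0 < d /\ forall w, Cmod (w - z)%C < d -> phi w <= phi z) -> l <= 0.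
Proof.
  intros (b1 & b2 & H1 & H2 & ->) [d [Hd H]].
  assert (b1 <= 0).
  { apply (D2_max _ _ _ H1). exists d. split; auto. intros t Ht.
    replace (z + 0 * 1)%C with z by ring. apply H.
    replace (z + t * 1 - z)%C with (RtoC t) by ring. now rewrite Cmod_R. }
  assert (b2 <= 0).
  { apply (D2_max _ _ _ H2). exists d. split; auto. intros t Ht.
    replace (z + 0 * Ci)%C with z by ring. apply H.
    replace (z + t * Ci - z)%C with (t * Ci)%C by ring.
    now rewrite Cmod_mult, Cmod_R, Cmod_Ci, Rmult_1_r. }
  lra.
Qed.

Lemma lap_plus phi chi z gx gy l gx' gy' l' : lap phi z gx gy l -> lap chi z gx' gy' l' ->
  lap (fun w => phi w + chi w) z (gx + gx') (gy + gy') (l + l').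
Proof.
  intros (b1 & b2 & H1 & H2 & ->) (b1' & b2' & H1' & H2' & ->).
  exists (b1 + b1'), (b2 + b2'). split; [|split; [|ring]]; now apply (D2_plus (fun t : R => phi _)).
Qed.

Lemma lap_scal phi z gx gy l k : lap phi z gx gy l ->
  lap (fun w => k * phi w) z (k * gx) (k * gy) (k * l).
Proof.
  intros (b1 & b2 & H1 & H2 & ->).
  exists (k * b1), (k * b2). split; [|split; [|ring]]; now apply (D2_scal (fun t : R => phi _)).
Qed.

(** The squared gradient in this rule is the reason why [lap] records the gradient next to the
    Laplacian. *)
Lemma lap_comp phi psi psi' c z gx gy l : lap phi z gx gy l ->
  (exists d, 0 < d /\ forall s, Rabs (s - phi z) < d -> is_derive psi s (psi' s)) ->
  is_derive psi' (phi z) c ->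
  lap (fun w => psi (phi w)) z (psi' (phi z) * gx) (psi' (phi z) * gy)
    (c * (gx * gx + gy * gy) + psi' (phi z) * l).
Proof.
  intros (b1 & b2 & H1 & H2 & ->) Hd Hc.
  exists (c * (gx * gx) + psi' (phi z) * b1), (c * (gy * gy) + psi' (phi z) * b2).
  assert (E1 : (z + 0 * 1)%C = z) by ring. assert (E2 : (z + 0 * Ci)%C = z) by ring.
  split; [|split; [|ring]].
  - assert (T := D2_comp (fun t : R => phi (z + t * 1)%C) psi psi' c gx b1 H1).
    cbv beta in T. rewrite E1 in T. auto.
  - assert (T := D2_comp (fun t : R => phi (z + t * Ci)%C) psi psi' c gy b2 H2).
    cbv beta in T. rewrite E2 in T. auto.
Qed.

Lemma Rderiv_fst g t l : Rderiv g t l -> is_derive (fun s => fst (g s)) t (fst l).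
Proof.
  intros H. apply (Rderiv_Re 1) in H. rewrite Cmult_1_l in H.
  apply (is_derive_ext (fun s => fst (1 * g s)%C)); auto. intros; now rewrite Cmult_1_l.
Qed.

Lemma Rderiv_snd g t l : Rderiv g t l -> is_derive (fun s => snd (g s)) t (snd l).
Proof.
  intros H. apply (Rderiv_Re (- Ci)%C) in H.
  assert (E : forall w : C, fst (- Ci * w)%C = snd w).
  { intros w. unfold Cmult, Copp, Ci; simpl. ring. }
  rewrite E in H. apply (is_derive_ext (fun s => fst (- Ci * g s)%C)); auto.
Qed.

Lemma is_derive_ln_hypot (p q : R -> R) (t p' q' : R) : is_derive p t p' -> is_derive q t q' ->
  0 < p t * p t + q t * q t ->
  is_derive (fun s => ln (sqrt (p s * p s + q s * q s))) t
    ((p' * p t + q' * q t) / (p t * p t + q t * q t)).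
Proof.
  intros Hp Hq Hpos. auto_derive.
  - repeat split; try (eexists; eassumption); auto. now apply sqrt_lt_R0.
  - replace (Derive (fun x : R => p x) t) with p' by (symmetry; now apply is_derive_unique).
    replace (Derive (fun x : R => q x) t) with q' by (symmetry; now apply is_derive_unique).
    set (Q := p t * p t + q t * q t) in *.
    assert (Hs : sqrt Q * sqrt Q = Q) by (apply sqrt_sqrt; lra).
    assert (Hs0 : 0 < sqrt Q) by (now apply sqrt_lt_R0).
    transitivity ((p' * p t + q' * q t) / (sqrt Q * sqrt Q)); [field; lra|now rewrite Hs].
Qed.

Lemma is_derive_ln_Cmod g t l : Rderiv g t l -> g t <> 0 ->
  is_derive (fun s => ln (Cmod (g s))) t (fst (l / g t)%C).
Proof.
  intros H Hne.
  assert (Hm : 0 < Cmod (g t)) by now apply Cmod_gt_0.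
  assert (Hq : 0 < fst (g t) * fst (g t) + snd (g t) * snd (g t)).
  { apply Rnot_le_lt. intros Hle. unfold Cmod in Hm. rewrite sqrt_neg_0 in Hm; simpl in *; lra. }
  apply (is_derive_ext (fun s => ln (sqrt (fst (g s) * fst (g s) + snd (g s) * snd (g s))))).
  { intros s. unfold Cmod. do 2 f_equal. simpl. ring. }
  replace (fst (l / g t)%C) with
    ((fst l * fst (g t) + snd l * snd (g t)) / (fst (g t) * fst (g t) + snd (g t) * snd (g t))).
  - apply (is_derive_ln_hypot (fun s => fst (g s)) (fun s => snd (g s))); auto;
    [now apply Rderiv_fst|now apply Rderiv_snd].
  - unfold Cdiv, Cinv, Cmult; simpl. field. lra.
Qed.

Lemma Cderiv_div f g z a b : Cderiv f z a -> Cderiv g z b -> g z <> 0 ->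
  Cderiv (fun w => f w / g w)%C z (a / g z - f z * b / (g z * g z))%C.
Proof.
  intros Hf Hg Hne. eapply Cderiv_eq.
  - apply (Cderiv_mult f (fun w => / g w)%C); [apply Hf|].
    apply (Cderiv_comp Cinv g); [apply Cderiv_inv, Hne|apply Hg].
  - field. auto.
Qed.

Lemma D2_ln_Cmod f f' l (z e : C) r : 0 < r -> holo f f' z r -> Cderiv f' z l -> f z <> 0 ->
  Cmod e = 1 ->
  D2 (fun t : R => ln (Cmod (f (z + t * e)%C))) (fst (e * (f' z / f z))%C)
     (fst (e * e * (l / f z - f' z * f' z / (f z * f z)))%C).
Proof.
  intros Hr Hf Hl Hne He.
  assert (E : (z + 0 * e)%C = z) by ring.
  assert (Hc := holo_cont f f' z r z Hf (center_in_disc z r Hr)).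
  assert (Hm : 0 < Cmod (f z)) by now apply Cmod_gt_0.
  destruct (Hc (Cmod (f z)) Hm) as [d [Hd H]].
  exists (fun t : R => fst (e * (f' (z + t * e) / f (z + t * e)))%C). split; [|split].
  - exists (Rmin d r). split; [now apply Rmin_pos|]. intros t Ht.
    assert (Et : Cmod (z + t * e - z)%C = Rabs t).
    { replace (z + t * e - z)%C with (t * e)%C by ring. rewrite Cmod_mult, Cmod_R, He. ring. }
    assert (H1 := Rlt_le_trans _ _ _ Ht (Rmin_l _ _)).
    assert (H2 := Rlt_le_trans _ _ _ Ht (Rmin_r _ _)).
    replace (e * (f' (z + t * e) / f (z + t * e)))%C with (e * f' (z + t * e) / f (z + t * e))%C
      by (unfold Cdiv; ring).
    apply (is_derive_ln_Cmod (fun t : R => f (z + t * e)%C)).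
    + apply Cderiv_line, Hf. lra.
    + cbv beta. specialize (H (z + t * e)%C ltac:(lra)). intros E0. rewrite E0 in H.
      replace (0 - f z)%C with (- f z)%C in H by ring. rewrite Cmod_opp in H. lra.
  - now rewrite E.
  - assert (Hq : Cderiv (fun w => f' w / f w)%C z (l / f z - f' z * f' z / (f z * f z))%C).
    { apply Cderiv_div; auto. apply Hf. apply center_in_disc; auto. }
    rewrite <- E in Hq at 1. apply Cderiv_line in Hq. apply (Rderiv_Re e) in Hq.
    replace (e * e * (l / f z - f' z * f' z / (f z * f z)))%C with
      (e * (e * (l / f z - f' z * f' z / (f z * f z))))%C by ring. exact Hq.
Qed.

(** With B = (f'/f)' the second derivatives along 1 and i are Re B and Re(i^2 B), which cancel:
    log|f| is harmonic. The existence of B rests on [holo_deriv]. *)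
Lemma lap_ln_Cmod f f' z r : 0 < r -> holo f f' z r -> f z <> 0 ->
  lap (fun w => ln (Cmod (f w))) z (fst (f' z / f z)%C) (- snd (f' z / f z)%C) 0.
Proof.
  intros Hr Hf Hne. destruct (holo_deriv f f' z r Hr Hf) as [l Hl].
  set (B := (l / f z - f' z * f' z / (f z * f z))%C).
  exists (fst (1 * 1 * B)%C), (fst (Ci * Ci * B)%C). split; [|split].
  - replace (fst (f' z / f z)%C) with (fst (1 * (f' z / f z))%C) by (now rewrite Cmult_1_l).
    apply (D2_ln_Cmod f f' l z 1 r); auto. apply Cmod_1.
  - replace (- snd (f' z / f z)%C) with (fst (Ci * (f' z / f z))%C)
      by (unfold Cmult at 1, Ci; simpl; ring).
    apply (D2_ln_Cmod f f' l z Ci r); auto. apply Cmod_Ci.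
  - unfold Cmult, Ci, RtoC; simpl. ring.
Qed.

(** Used with two signs of [B]: A = 1, B > 0 small gives the strictly subharmonic perturbation in
    the maximum principle, and A = rho^2, B = -1 the weight of the hyperbolic metric of a disc in
    Ahlfors' lemma. *)
Lemma lap_ln_quadratic (c z : C) (A B : R) : 0 < A + B * (Cmod (z - c)%C * Cmod (z - c)%C) ->
  exists gx gy, lap (fun w => ln (A + B * (Cmod (w - c)%C * Cmod (w - c)%C))) z gx gy
    (4 * A * B / ((A + B * (Cmod (z - c)%C * Cmod (z - c)%C)) * (A + B * (Cmod (z - c)%C * Cmod (z - c)%C)))).
Proof.
  assert (Hsq : forall w, Cmod w * Cmod w = fst w * fst w + snd w * snd w).
  { intros w. replace (Cmod w * Cmod w) with (Cmod w ^ 2) by ring. rewrite Cmod2_alt. unfold Re, Im. ring. }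
  rewrite !Hsq. set (x := fst (z - c)%C). set (y := snd (z - c)%C). intros Hpos.
  assert (HD : forall e : C, D2 (fun t : R => ln (A + B * (Cmod (z + t * e - c)%C * Cmod (z + t * e - c)%C)))
     (2 * B * (x * fst e + y * snd e) / (A + B * (x * x + y * y)))
     (2 * B * (fst e * fst e + snd e * snd e) / (A + B * (x * x + y * y)) -
       (2 * B * (x * fst e + y * snd e)) * (2 * B * (x * fst e + y * snd e)) /
       ((A + B * (x * x + y * y)) * (A + B * (x * x + y * y))))).
  { intros e. set (e1 := fst e). set (e2 := snd e).
    set (q := fun t => A + B * ((x + t * e1) * (x + t * e1) + (y + t * e2) * (y + t * e2))).
    set (q' := fun t => 2 * B * ((x + t * e1) * e1 + (y + t * e2) * e2)).
    assert (Hq : forall t, is_derive q t (q' t)).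
    { intros t. unfold q, q'. auto_derive; auto. ring. }
    assert (Hq0 : q 0 = A + B * (x * x + y * y)) by (unfold q; ring).
    destruct (is_derive_continuous_eps q 0 _ (Hq 0) (q 0)) as [d [Hd H]]; [lra|].
    exists (fun t => q' t / q t). split; [|split].
    - exists d. split; auto. intros t Ht.
      apply (is_derive_ext (fun t => ln (q t))).
      { intros s. unfold q. f_equal. rewrite Hsq.
        replace (fst (z + s * e - c)%C) with (x + s * e1) by (unfold x, e1, Cminus, Cplus, Cmult, Copp, RtoC; simpl; ring).
        replace (snd (z + s * e - c)%C) with (y + s * e2) by (unfold y, e2, Cminus, Cplus, Cmult, Copp, RtoC; simpl; ring).
        reflexivity. }
      specialize (H t). rewrite Rminus_0_r in H. specialize (H Ht).
      apply Rabs_lt_between in H.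
      apply (is_derive_comp ln q t (/ q t) (q' t)); auto.
      apply is_derive_Reals. apply derivable_pt_lim_ln. lra.
    - rewrite Hq0. unfold q'. f_equal. ring.
    - replace (_ - _) with ((2 * B * (e1 * e1 + e2 * e2) * q 0 - q' 0 * q' 0) / (q 0 ^ 2)).
      + apply is_derive_div; auto; [|lra]. unfold q'. auto_derive; auto. ring.
      + rewrite Hq0. unfold q'. field. lra. }
  eexists. eexists. eexists. eexists.
  split; [apply (HD 1)|]. split; [apply (HD Ci)|]. unfold Ci, RtoC; simpl. field. lra.
Qed.

(** * Continuous real functions on the plane, and the maximum principle *)

Lemma Ccont_Cmod f z : Ccont f z -> forall eps, 0 < eps -> exists d, 0 < d /\
  forall w, Cmod (w - z)%C < d -> Rabs (Cmod (f w) - Cmod (f z)) < eps.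
Proof.
  intros H eps He. destruct (H eps He) as [d [Hd H']]. exists d. split; auto. intros w Hw.
  specialize (H' w Hw).
  assert (T1 := Cmod_triangle (f w - f z)%C (f z)). replace (f w - f z + f z)%C with (f w) in T1 by ring.
  assert (T2 := Cmod_triangle (f z - f w)%C (f w)). replace (f z - f w + f w)%C with (f z) in T2 by ring.
  rewrite (Cmod_sym (f z)) in T2. apply Rabs_lt_between. lra.
Qed.

Definition contR (phi : C -> R) (z : C) : Prop :=
  continuous (T := C_UniformSpace) (U := R_UniformSpace) phi z.

Lemma contR_eps phi z : contR phi z -> forall eps, 0 < eps -> exists d, 0 < d /\
  forall w, Cmod (w - z)%C < d -> Rabs (phi w - phi z) < eps.
Proof.
  intros H eps He.
  destruct (proj1 (filterlim_locally phi (phi z)) H (mkposreal _ He)) as [d Hd].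
  exists d. split; [apply cond_pos|]. intros w Hw.
  apply (Hd w). now apply C_NormedModule_mixin_compat1.
Qed.

Lemma contR_Cmod f z : Ccont f z -> contR (fun w => Cmod (f w)) z.
Proof.
  intros H. apply filterlim_locally. intros eps.
  destruct (Ccont_Cmod f z H eps (cond_pos eps)) as [d [Hd H']].
  assert (Hd2 : 0 < d / 2) by lra.
  exists (mkposreal _ Hd2). intros w Hw. apply H'.
  assert (T := C_NormedModule_mixin_compat2 z w _ Hw). simpl in T.
  change (Cmod (w - z)%C < sqrt 2 * (d / 2)) in T.
  assert (sqrt 2 <= 2).
  { rewrite <- (sqrt_square 2) at 2 by lra. apply sqrt_le_1; lra. }
  nra.
Qed.

Lemma contR_const c z : contR (fun _ => c) z.
Proof. apply continuous_const. Qed.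

Lemma contR_mult phi chi z : contR phi z -> contR chi z -> contR (fun w => phi w * chi w) z.
Proof. intros H1 H2. apply (continuous_mult (K := R_AbsRing) phi chi z H1 H2). Qed.

Lemma contR_plus phi chi z : contR phi z -> contR chi z -> contR (fun w => phi w + chi w) z.
Proof. intros H1 H2. apply (continuous_plus (V := R_NormedModule) phi chi z H1 H2). Qed.

Lemma contR_comp phi (psi : R -> R) z : contR phi z -> ex_derive psi (phi z) ->
  contR (fun w => psi (phi w)) z.
Proof.
  intros H1 H2. apply (continuous_comp phi psi z H1). now apply (ex_derive_continuous psi).
Qed.

Lemma contR_dist_sq (A B : R) (c z : C) : contR (fun w => A + B * (Cmod (w - c)%C * Cmod (w - c)%C)) z.
Proof.
  assert (H : contR (fun w => Cmod (w - c)%C) z).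
  { apply contR_Cmod. eapply Cderiv_cont, Cderiv_shift. }
  apply contR_plus; [apply contR_const|]. apply contR_mult; [apply contR_const|now apply contR_mult].
Qed.

Lemma contR_attains_max (g : C -> R) (z0 : C) (rho : R) : 0 <= rho ->
  (forall z, Cmod (z - z0)%C <= rho -> contR g z) ->
  exists z, Cmod (z - z0)%C <= rho /\ forall w, Cmod (w - z0)%C <= rho -> g w <= g z.
Proof.
  intros Hrho Hg. apply disc_attains_max; auto. intros z Hz eps He.
  destruct (contR_eps g z (Hg z Hz) eps He) as [d [Hd H]]. exists d. split; auto.
  intros w _ Hw. specialize (H w Hw). apply Rabs_lt_between in H. lra.
Qed.

(** Multiplying |f|^2 by s = 1 + eps |p-w|^2 gives the logarithm 2 log|f| + log s a strictly
    positive Laplacian wherever f is nonzero, so the product has no positive interior maximum. On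
    the circle it is at most (1 + eps rho^2) M^2, and eps tends to 0. *)
Lemma maximum_principle f f' w rho rho' M : 0 < rho < rho' -> holo f f' w rho' ->
  (forall z, Cmod (z - w)%C = rho -> Cmod (f z) <= M) ->
  forall z, Cmod (z - w)%C <= rho -> Cmod (f z) <= M.
Proof.
  intros Hrho Hf HM z Hz.
  assert (HM0 : 0 <= M).
  { eapply Rle_trans; [apply Cmod_ge_0|]. apply (HM (w + rho)%C).
    replace (w + rho - w)%C with (RtoC rho) by ring. rewrite Cmod_R, Rabs_right; lra. }
  apply Rsqr_incr_0_var; auto. apply le_epsilon. intros eta Heta.
  (* Chosen so that eps rho^2 M^2 <= eta; adding 1 to M^2 covers M = 0. *)
  set (eps := eta / ((M * M + 1) * (rho * rho))).
  assert (Hrr : 0 < rho * rho) by nra.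
  assert (Heps : 0 < eps) by (apply Rdiv_lt_0_compat; [auto|nra]).
  set (s := fun p => 1 + eps * (Cmod (p - w)%C * Cmod (p - w)%C)).
  assert (Hs : forall p, 1 <= s p).
  { intros p. unfold s. assert (T := Cmod_ge_0 (p - w)%C).
    assert (0 <= Cmod (p - w)%C * Cmod (p - w)%C) by nra. nra. }
  set (G := fun p => s p * (Cmod (f p) * Cmod (f p))).
  assert (Hcont : forall p, Cmod (p - w)%C <= rho -> contR G p).
  { intros p Hp. apply contR_mult; [apply contR_dist_sq|].
    assert (contR (fun p => Cmod (f p)) p).
    { apply contR_Cmod. eapply holo_cont; [apply Hf|lra]. }
    now apply contR_mult. }
  destruct (contR_attains_max G w rho) as [p [Hp Hmax]]; auto; [lra|].
  assert (HGz : Rsqr (Cmod (f z)) <= G p).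
  { eapply Rle_trans; [|apply (Hmax z Hz)]. unfold G, Rsqr. assert (T := Hs z).
    assert (0 <= Cmod (f z) * Cmod (f z)) by (assert (T2 := Cmod_ge_0 (f z)); nra). nra. }
  eapply Rle_trans; [apply HGz|].
  destruct (Rle_lt_or_eq_dec _ _ Hp) as [Hin|Hb].
  - destruct (Ceq_dec (f p) 0) as [H0|Hne].
    + unfold G. rewrite H0, Cmod_0. unfold Rsqr. nra.
    + exfalso.
      assert (Hfp : 0 < Cmod (f p)) by now apply Cmod_gt_0.
      assert (Hholo : holo f f' p (rho' - rho)) by (eapply holo_sub; [apply Hf|lra]).
      assert (L1 := lap_ln_Cmod f f' p (rho' - rho) ltac:(lra) Hholo Hne).
      destruct (lap_ln_quadratic w p 1 eps) as (gx & gy & L2); [assert (T := Hs p); unfold s in T; lra|].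
      assert (L3 := lap_plus _ _ _ _ _ _ _ _ _ (lap_scal _ _ _ _ _ 2 L1) L2).
      apply lap_max in L3.
      * assert (T := Hs p). fold (s p) in L3.
        assert (0 < 4 * 1 * eps / (s p * s p)) by (apply Rdiv_lt_0_compat; nra). lra.
      (* With tolerance G(p) continuity keeps [G] positive near p; so |f| is positive there and ln G
         splits into the sum whose Laplacian was computed. *)
      * destruct (contR_eps G p (Hcont p Hp) (G p)) as [d [Hd H]].
        { unfold G. assert (T := Hs p). assert (0 < Cmod (f p) * Cmod (f p)) by nra. nra. }
        exists (Rmin d (rho - Cmod (p - w)%C)). split; [apply Rmin_pos; lra|].
        intros q Hq.
        assert (H1 := Rlt_le_trans _ _ _ Hq (Rmin_l _ _)).
        assert (H2 := Rlt_le_trans _ _ _ Hq (Rmin_r _ _)).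
        assert (Hqw : Cmod (q - w)%C <= rho).
        { apply Rlt_le, (disc_sub w p q rho (rho - Cmod (p - w)%C)); lra. }
        assert (HGq := Hmax q Hqw). specialize (H q H1). apply Rabs_lt_between in H.
        assert (Hfq : 0 < Cmod (f q)).
        { destruct (Rle_lt_or_eq_dec 0 _ (Cmod_ge_0 (f q))) as [|E]; auto.
          unfold G at 2 in H. rewrite <- E in H. lra. }
        assert (HlnG : forall a, 0 < Cmod (f a) -> 2 * ln (Cmod (f a)) + ln (s a) = ln (G a)).
        { intros a Ha. unfold G. assert (T := Hs a). rewrite ln_mult, ln_mult; try lra. nra. }
        fold (s q) (s p). rewrite !HlnG by auto. apply ln_le; lra.
  - unfold G, s. rewrite Hb. specialize (HM p Hb). assert (T := Cmod_ge_0 (f p)).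
    assert (Cmod (f p) * Cmod (f p) <= M * M) by (apply Rmult_le_compat; lra).
    assert (E : eps * (rho * rho) * (M * M + 1) = eta) by (unfold eps; field; split; nra).
    assert (0 < eps * (rho * rho)) by (apply Rmult_lt_0_compat; auto).
    unfold Rsqr. nra.
Qed.

(** * A negatively curved metric on the twice punctured plane *)

Lemma ln_le_sub (x : R) : 0 <= x -> ln (1 + x) <= x.
Proof.
  intros Hx. rewrite <- (ln_exp x) at 2. apply ln_le; [lra|]. apply exp_ineq1_le.
Qed.

Lemma ln_ge_frac (x : R) : 0 <= x -> x / (1 + x) <= ln (1 + x).
Proof.
  intros Hx. assert (T := ln_le_sub (- (x / (1 + x)))).
  assert (E : ln (/ (1 + x)) <= - (x / (1 + x))).
  { rewrite <- (ln_exp (- (x / (1 + x)))). apply ln_le; [apply Rinv_0_lt_compat; lra|].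
    replace (/ (1 + x)) with (1 + - (x / (1 + x))) by (field; lra). apply exp_ineq1_le. }
  rewrite ln_Rinv in E by lra. lra.
Qed.

(** The difference of the two sides vanishes at 0 and has derivative x^2 / (2 (1+x)^2). It bounds
    the numerator of [curv] from below. *)
Lemma ln_gap (x : R) : 0 <= x -> x * x / (2 * (1 + x)) <= x - ln (1 + x).
Proof.
  intros Hx. destruct (Rle_lt_or_eq_dec 0 x Hx) as [Hp| <-].
  2:{ rewrite Rplus_0_r, ln_1. right. field. }
  set (g := fun x => x - ln (1 + x) - x * x / (2 * (1 + x))).
  set (g' := fun x => x * x / (2 * ((1 + x) * (1 + x)))).
  destruct (MVT_cor2 g g' 0 x Hp) as [c [E Hc]].
  { intros c Hc. apply is_derive_Reals. unfold g, g'. auto_derive; [repeat split; lra|]. field. lra. }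
  assert (0 <= g' c). { unfold g'. apply Rdiv_le_0_compat; nra. }
  assert (g 0 = 0). { unfold g. rewrite Rplus_0_r, ln_1. field. }
  assert (0 <= g' c * (x - 0)) by (apply Rmult_le_pos; lra).
  unfold g in *. lra.
Qed.

Definition logS (a : R) : R := ln (1 + sqrt a).

Lemma logS_pos a : 0 < a -> 0 < logS a.
Proof.
  intros Ha. unfold logS. rewrite <- ln_1. assert (T := sqrt_lt_R0 a Ha). apply ln_increasing; lra.
Qed.

(* [rho2 w |dw|^2] is the negatively curved metric on the plane without 0 and 1. *)
Definition rho2 (w : C) : R :=
  / (Cmod w * Cmod (w - 1)%C * logS (Cmod w) * logS (Cmod (w - 1)%C)).

(* Up to sign the Laplacian of [log log (1 + sqrt |z|)], in terms of [x = sqrt |z|];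
   [log |z|] being harmonic, [curv (sqrt |z|) + curv (sqrt |z - 1|)] is the Laplacian of [log rho2]. *)
Definition curv (x : R) : R :=
  (x - ln (1 + x)) / (4 * (x * x * x) * ((1 + x) * (1 + x)) * (ln (1 + x) * ln (1 + x))).

Lemma ln_pos_of_pos x : 0 < x -> 0 < ln (1 + x).
Proof. intros H. rewrite <- ln_1. apply ln_increasing; lra. Qed.

Lemma curv_lower x : 0 < x ->
  / (8 * x * ((1 + x) * (1 + x) * (1 + x)) * (ln (1 + x) * ln (1 + x))) <= curv x.
Proof.
  intros Hx. unfold curv. assert (HS := ln_pos_of_pos x Hx). assert (Hg := ln_gap x (Rlt_le _ _ Hx)).
  set (S := ln (1 + x)) in *.
  set (P := 4 * (x * x * x) * ((1 + x) * (1 + x)) * (S * S)).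
  assert (HP : 0 < P).
  { unfold P. repeat apply Rmult_lt_0_compat; lra. }
  replace (/ _) with (x * x / (2 * (1 + x)) / P) by (unfold P; field; lra).
  apply Rmult_le_compat_r; auto. apply Rlt_le, Rinv_0_lt_compat, HP.
Qed.

Lemma curv_pos x : 0 < x -> 0 < curv x.
Proof.
  intros Hx. eapply Rlt_le_trans; [|apply curv_lower; auto].
  assert (HS := ln_pos_of_pos x Hx).
  apply Rinv_0_lt_compat. repeat apply Rmult_lt_0_compat; lra.
Qed.

(** Here 1 + x <= 3x, so (1+x)^3 <= 27 x^3 and 216 = 8 * 27. The bound is shaped as a square so that
    two of them combine by the arithmetic-geometric inequality. *)
Lemma curv_ge_sq x : / 2 <= x ->
  / (216 * (x * x * ln (1 + x) * (x * x * ln (1 + x)))) <= curv x.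
Proof.
  intros Hx. eapply Rle_trans; [|apply curv_lower; lra].
  assert (HS := ln_pos_of_pos x ltac:(lra)). set (S := ln (1 + x)) in *.
  apply Rinv_le_contravar.
  - repeat apply Rmult_lt_0_compat; lra.
  - assert (H : (1 + x) * (1 + x) * (1 + x) <= 27 * (x * x * x)).
    { assert (A : (1 + x) * (1 + x) <= 9 * (x * x)) by nra.
      assert ((1 + x) * (1 + x) * (1 + x) <= 9 * (x * x) * (3 * x)) by (apply Rmult_le_compat; nra). lra. }
    assert (0 <= x * (S * S)) by nra.
    replace (8 * x * ((1 + x) * (1 + x) * (1 + x)) * (S * S)) with
      (8 * ((1 + x) * (1 + x) * (1 + x)) * (x * (S * S))) by ring.
    replace (216 * (x * x * S * (x * x * S))) with (8 * (27 * (x * x * x)) * (x * (S * S))) by ring.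
    apply Rmult_le_compat_r; lra.
Qed.

(** Here (1+y)^3 <= 27/8, and one of the two logarithms is replaced by its bound y; the other stays,
    to match the factor y^2 ln(1+y) of the metric. *)
Lemma curv_ge_small y : 0 < y <= / 2 -> / (27 * (y * y * ln (1 + y))) <= curv y.
Proof.
  intros Hy. eapply Rle_trans; [|apply curv_lower; lra].
  assert (HS := ln_pos_of_pos y ltac:(lra)). assert (HS2 := ln_le_sub y ltac:(lra)).
  set (S := ln (1 + y)) in *.
  apply Rinv_le_contravar.
  - repeat apply Rmult_lt_0_compat; lra.
  - assert (H : (1 + y) * (1 + y) * (1 + y) <= 27 / 8).
    { assert (A : (1 + y) * (1 + y) <= 9 / 4) by nra.
      assert ((1 + y) * (1 + y) * (1 + y) <= 9 / 4 * (3 / 2)) by (apply Rmult_le_compat; nra). lra. }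
    assert (0 <= y * S) by nra.
    replace (8 * y * ((1 + y) * (1 + y) * (1 + y)) * (S * S)) with
      (8 * ((1 + y) * (1 + y) * (1 + y)) * S * (y * S)) by ring.
    replace (27 * (y * y * S)) with (27 * y * (y * S)) by ring.
    apply Rmult_le_compat_r; auto.
    assert (8 * ((1 + y) * (1 + y) * (1 + y)) * S <= 27 * y) by (apply Rmult_le_compat; nra). lra.
Qed.

(** Let p = x^2 ln(1+x) and q = y^2 ln(1+y). If both variables are at least 1/2, then (1/p^2 +
    1/q^2)/216 >= 1/(108 p q). If y is smaller, then curv y >= 1/(27 q), while x >= 1/2 gives p >=
    (1/4)(1/3) = 1/12; hence 324 = 27 * 12. *)
Lemma metric_curvature_aux x y : 0 < y <= x -> 1 <= x * x + y * y ->
  / (324 * (x * x * ln (1 + x) * (y * y * ln (1 + y)))) <= curv x + curv y.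
Proof.
  intros Hy H1.
  assert (Hx : / 2 <= x) by nra.
  assert (HSx := ln_pos_of_pos x ltac:(lra)). assert (HSy := ln_pos_of_pos y ltac:(lra)).
  assert (Cx := curv_ge_sq x Hx). assert (Px := curv_pos x ltac:(lra)).
  assert (Bx : 0 < x * x * ln (1 + x)) by (repeat apply Rmult_lt_0_compat; lra).
  assert (By : 0 < y * y * ln (1 + y)) by (repeat apply Rmult_lt_0_compat; lra).
  destruct (Rle_dec (/ 2) y) as [Hy2|Hy2].
  - assert (Cy := curv_ge_sq y Hy2).
    set (p := x * x * ln (1 + x)) in *. set (q := y * y * ln (1 + y)) in *.
    rewrite Rinv_mult in Cx, Cy |- *. rewrite Rinv_mult in Cx, Cy |- *.
    assert (Hp : 0 < / p) by now apply Rinv_0_lt_compat. assert (Hq : 0 < / q) by now apply Rinv_0_lt_compat.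
    set (P := / p) in *. set (Q := / q) in *.
    assert (T := Rle_0_sqr (P - Q)). unfold Rsqr in T.
    assert (0 < P * Q) by now apply Rmult_lt_0_compat. lra.
  - assert (Cy := curv_ge_small y ltac:(lra)).
    assert (Hp : / 12 <= x * x * ln (1 + x)).
    { assert (T := ln_ge_frac x ltac:(lra)).
      assert (/ 3 <= x / (1 + x)).
      { apply Rmult_le_reg_r with (1 + x); [lra|]. unfold Rdiv. rewrite Rmult_assoc, Rinv_l; lra. }
      assert (/ 4 <= x * x) by nra.
      assert (/ 4 * / 3 <= x * x * ln (1 + x)) by (apply Rmult_le_compat; lra). lra. }
    set (p := x * x * ln (1 + x)) in *. set (q := y * y * ln (1 + y)) in *.
    assert (/ (324 * (p * q)) <= / (27 * q)).
    { apply Rinv_le_contravar; nra. }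
    lra.
Qed.

Lemma metric_curvature x y : 0 < x -> 0 < y -> 1 <= x * x + y * y ->
  / (324 * (x * x * ln (1 + x) * (y * y * ln (1 + y)))) <= curv x + curv y.
Proof.
  intros Hx Hy H. destruct (Rle_dec y x).
  - apply metric_curvature_aux; lra.
  - rewrite (Rplus_comm (curv x)), (Rmult_comm (x * x * ln (1 + x))). apply metric_curvature_aux; lra.
Qed.

(** The variable t stands for log|z|: as a function of a harmonic quantity, log [logS] has a
    Laplacian consisting of the second-derivative term of [lap_comp] alone. *)
Definition loglog (t : R) : R := ln (ln (1 + exp (t / 2))).
Definition loglog' (t : R) : R :=
  exp (t / 2) / 2 / ((1 + exp (t / 2)) * ln (1 + exp (t / 2))).

Lemma is_derive_loglog t : is_derive loglog t (loglog' t).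
Proof.
  assert (He := exp_pos (t / 2)). assert (HS := ln_pos_of_pos _ He).
  unfold loglog, loglog'. auto_derive; [repeat split; try lra; auto|].
  set (x := exp (t / 2)) in *. replace (exp (t * / 2)) with x in * by auto. field. lra.
Qed.

Lemma is_derive_loglog' t : is_derive loglog' t (- exp (t / 2) ^ 4 * curv (exp (t / 2))).
Proof.
  assert (He := exp_pos (t / 2)). assert (HS := ln_pos_of_pos _ He).
  unfold loglog', curv. auto_derive.
  - repeat split; try lra. apply Rgt_not_eq, Rmult_lt_0_compat; unfold Rdiv in *; lra.
  - set (x := exp (t / 2)) in *. replace (exp (t * / 2)) with x in * by auto. field. lra.
Qed.

Lemma exp_half_ln a : 0 < a -> exp (ln a / 2) = sqrt a.
Proof.
  intros Ha. rewrite <- (sqrt_square (exp (ln a / 2))) by apply Rlt_le, exp_pos.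
  rewrite <- exp_plus. f_equal. replace (ln a / 2 + ln a / 2) with (ln a) by field. now apply exp_ln.
Qed.

Lemma loglog_ln a : 0 < a -> loglog (ln a) = ln (logS a).
Proof. intros Ha. unfold loglog, logS. now rewrite exp_half_ln. Qed.

Lemma holo_deriv_ex f f' z0 rho : holo f f' z0 rho -> exists f'', holo f' f'' z0 rho.
Proof.
  intros Hf.
  assert (H : forall z, exists l, Cmod (z - z0)%C < rho -> Cderiv f' z l).
  { intros z. destruct (Rlt_dec (Cmod (z - z0)%C) rho) as [Hz|Hz].
    - destruct (holo_deriv f f' z (rho - Cmod (z - z0)%C)) as [l Hl]; [lra| |now exists l].
      eapply holo_sub; [apply Hf|lra].
    - exists 0. intros; contradiction. }
  apply choice in H. destruct H as [f'' H]. exists f''. exact H.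
Qed.

Lemma Cmod_div_sq (a b : C) : b <> 0 ->
  fst (a / b)%C * fst (a / b)%C + - snd (a / b)%C * - snd (a / b)%C = Cmod a * Cmod a / (Cmod b * Cmod b).
Proof.
  intros Hb. assert (H : 0 < Cmod b) by now apply Cmod_gt_0.
  transitivity (Cmod (a / b)%C ^ 2).
  - rewrite Cmod2_alt. unfold Re, Im. ring.
  - rewrite Cmod_div by auto. field. lra.
Qed.

(** This is half of log [rho2](f), the other half being the same with f - 1. The squared gradient of
    log|f| is |f'|^2 / |f|^2, and its denominator cancels against the fourth power of sqrt|f| in the
    second derivative of [loglog]. *)
Lemma lap_loglog f f' z r : 0 < r -> holo f f' z r -> f z <> 0 ->
  exists gx gy, lap (fun w => - (1) * ln (Cmod (f w)) + - (1) * loglog (ln (Cmod (f w)))) z gx gy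
    (Cmod (f' z) * Cmod (f' z) * curv (sqrt (Cmod (f z)))).
Proof.
  intros Hr Hf Hne. assert (Hm : 0 < Cmod (f z)) by now apply Cmod_gt_0.
  assert (L := lap_ln_Cmod f f' z r Hr Hf Hne).
  assert (L2 := lap_comp _ loglog loglog' _ _ _ _ _ L
    (ex_intro _ 1 (conj Rlt_0_1 (fun s _ => is_derive_loglog s))) (is_derive_loglog' _)).
  assert (L3 := lap_plus _ _ _ _ _ _ _ _ _ (lap_scal _ _ _ _ _ (- (1)) L) (lap_scal _ _ _ _ _ (- (1)) L2)).
  eexists. eexists.
  match type of L3 with lap _ _ _ _ ?l => replace (Cmod (f' z) * Cmod (f' z) * curv (sqrt (Cmod (f z)))) with l end;
  [exact L3|].
  rewrite Cmod_div_sq by auto. rewrite exp_half_ln by auto.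
  replace (sqrt (Cmod (f z)) ^ 4) with
    (sqrt (Cmod (f z)) * sqrt (Cmod (f z)) * (sqrt (Cmod (f z)) * sqrt (Cmod (f z)))) by ring.
  rewrite sqrt_sqrt by lra. field. lra.
Qed.

Lemma contR_logS phi z : contR phi z -> 0 < phi z -> contR (fun w => logS (phi w)) z.
Proof.
  intros H Hp. apply (contR_comp phi logS); auto.
  assert (T := sqrt_lt_R0 _ Hp). unfold logS. auto_derive. repeat split; auto; lra.
Qed.

(* Ahlfors' lemma for the metric [rho2]: where [rho2(f)|f'|^2 (rho^2 - |z - z0|^2)^2] is maximal
   the Laplacian of its logarithm is nonpositive, which bounds the maximum. *)
Lemma ahlfors f f' z0 rho rho' : 0 < rho < rho' -> holo f f' z0 rho' ->
  (forall z, Cmod (z - z0)%C < rho' -> f z <> 0 /\ f z <> 1) ->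
  rho2 (f z0) * (Cmod (f' z0) * Cmod (f' z0)) * (rho * rho) <= 2592.
Proof.
  intros HR Hf Homit.
  destruct (holo_deriv_ex f f' z0 rho' Hf) as [f'' Hf'].
  set (Q := fun z => rho * rho + - (1) * (Cmod (z - z0)%C * Cmod (z - z0)%C)).
  set (G := fun z => rho2 (f z) * (Cmod (f' z) * Cmod (f' z)) * (Q z * Q z)).
  assert (Ha : forall z, Cmod (z - z0)%C < rho' -> 0 < Cmod (f z)).
  { intros z Hz. apply Cmod_gt_0. now apply Homit. }
  assert (Hb : forall z, Cmod (z - z0)%C < rho' -> 0 < Cmod (f z - 1)%C).
  { intros z Hz. apply Cmod_gt_0, Cminus_eq_contra. now apply Homit. }
  assert (Hf1 : holo (fun z => f z - 1)%C f' z0 rho').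
  { intros z Hz. apply Cderiv_eq with (f' z - 0)%C; [|ring].
    apply Cderiv_minus; [now apply Hf|apply Cderiv_const]. }
  assert (HQ0 : forall z, Cmod (z - z0)%C <= rho -> 0 <= Q z).
  { intros z Hz. unfold Q. assert (T := Cmod_ge_0 (z - z0)%C). nra. }
  assert (Hrho : forall z, Cmod (z - z0)%C < rho' -> 0 < rho2 (f z)).
  { intros z Hz. unfold rho2. apply Rinv_0_lt_compat.
    assert (T1 := Ha z Hz). assert (T2 := Hb z Hz).
    repeat apply Rmult_lt_0_compat; auto; now apply logS_pos. }
  assert (HG : forall z, Cmod (z - z0)%C <= rho -> contR G z).
  { intros z Hz. assert (Hz' : Cmod (z - z0)%C < rho') by lra.
    assert (C0 : contR (fun z => Cmod (f z)) z) by (apply contR_Cmod; eapply holo_cont; eauto).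
    assert (C1 : contR (fun z => Cmod (f z - 1)%C) z).
    { apply (contR_Cmod (fun z => f z - 1)%C). eapply holo_cont; eauto. }
    assert (C2 : contR (fun z => Cmod (f' z)) z) by (apply contR_Cmod; eapply holo_cont; eauto).
    assert (T1 := Ha z Hz'). assert (T2 := Hb z Hz').
    assert (CQ : contR Q z) by apply contR_dist_sq.
    unfold G. apply contR_mult; [|now apply contR_mult].
    apply contR_mult; [|now apply contR_mult].
    apply (contR_comp (fun z => Cmod (f z) * Cmod (f z - 1)%C * logS (Cmod (f z)) * logS (Cmod (f z - 1)%C)) Rinv).
    - apply contR_mult; [apply contR_mult; [apply contR_mult|]|]; auto; apply contR_logS; auto.
    - auto_derive. apply Rgt_not_eq.
      repeat apply Rmult_lt_0_compat; auto; now apply logS_pos. }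
  destruct (contR_attains_max G z0 rho) as [z [Hz Hmax]]; auto; [lra|].
  assert (Hz' : Cmod (z - z0)%C < rho') by lra.
  (* At the maximum |f'|^2 times the two curvature terms is at most 8 rho^2 / Q^2, from the weight
     Q^2. By [metric_curvature] those terms are at least [rho2]/324, and 2592 = 8 * 324. *)
  assert (HGz : G z <= 2592 * (rho * rho)).
  { apply Rnot_lt_le. intros Hlt.
    assert (HGpos : 0 < G z) by nra.
    assert (HQz : 0 < Q z).
    { destruct (Rle_lt_or_eq_dec _ _ (HQ0 z Hz)) as [|E]; auto. unfold G in HGpos. rewrite <- E in HGpos. lra. }
    assert (HzR : Cmod (z - z0)%C < rho).
    { destruct (Rle_lt_or_eq_dec _ _ Hz) as [|E]; auto. unfold Q in HQz. rewrite E in HQz. lra. }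
    assert (Hc : forall w, 0 < G w -> 0 < Cmod (f' w)).
    { intros w Hw. destruct (Rle_lt_or_eq_dec _ _ (Cmod_ge_0 (f' w))) as [|E]; auto.
      unfold G in Hw. rewrite <- E in Hw. lra. }
    assert (HQw : forall w, Cmod (w - z0)%C <= rho -> 0 < G w -> 0 < Q w).
    { intros w Hw Hw'. destruct (Rle_lt_or_eq_dec _ _ (HQ0 w Hw)) as [|E]; auto.
      unfold G in Hw'. rewrite <- E in Hw'. lra. }
    set (r := rho' - rho). assert (Hr : 0 < r) by (unfold r; lra).
    assert (H1 : holo f f' z r) by (eapply holo_sub; [apply Hf|unfold r; lra]).
    assert (H2 : holo (fun z => f z - 1)%C f' z r) by (eapply holo_sub; [apply Hf1|unfold r; lra]).
    assert (H3 : holo f' f'' z r) by (eapply holo_sub; [apply Hf'|unfold r; lra]).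
    destruct (lap_loglog f f' z r Hr H1) as (gx1 & gy1 & L1); [now apply Homit|].
    destruct (lap_loglog (fun z => f z - 1)%C f' z r Hr H2) as (gx2 & gy2 & L2).
    { apply Cminus_eq_contra. now apply Homit. }
    assert (L3 := lap_ln_Cmod f' f'' z r Hr H3 ltac:(apply Cmod_gt_0; now apply Hc)).
    destruct (lap_ln_quadratic z0 z (rho * rho) (- (1)) HQz) as (gx4 & gy4 & L4).
    fold (Q z) in L4.
    assert (L := lap_plus _ _ _ _ _ _ _ _ _ (lap_plus _ _ _ _ _ _ _ _ _ L1 L2)
      (lap_scal _ _ _ _ _ 2 (lap_plus _ _ _ _ _ _ _ _ _ L3 L4))).
    cbv beta in L. apply lap_max in L.
    - set (a := Cmod (f z)) in *. set (b := Cmod (f z - 1)%C) in *. set (c := Cmod (f' z)) in *.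
      assert (Ha' : 0 < a) by now apply Ha. assert (Hb' : 0 < b) by now apply Hb.
      assert (Hab : 1 <= a + b).
      { unfold a, b. rewrite <- Cmod_opp.
        assert (T := Cmod_triangle (- f z)%C (f z - 1)%C).
        replace (- f z + (f z - 1))%C with (- (1))%C in T by ring. rewrite Cmod_m1 in T. lra. }
      assert (K := metric_curvature (sqrt a) (sqrt b) (sqrt_lt_R0 _ Ha') (sqrt_lt_R0 _ Hb')).
      rewrite !sqrt_sqrt in K by lra. specialize (K Hab).
      fold (logS a) (logS b) in K.
      assert (HSa := logS_pos a Ha'). assert (HSb := logS_pos b Hb').
      assert (Er : / (324 * (a * logS a * (b * logS b))) = rho2 (f z) / 324).
      { unfold rho2. fold a b. field. repeat split; lra. }
      rewrite Er in K.
      assert (Hcz : 0 < c * c) by (assert (T := Hc z HGpos); fold c in T; nra).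
      apply Rmult_le_compat_l with (r := c * c) in K; [|lra].
      assert (HQQ : 0 < Q z * Q z) by nra.
      assert (E4 : 4 * (rho * rho) * - (1) / (Q z * Q z) * (Q z * Q z) = - 4 * (rho * rho)) by (field; lra).
      set (X := 4 * (rho * rho) * - (1) / (Q z * Q z)) in *.
      assert (HGE : G z = c * c * rho2 (f z) * (Q z * Q z)) by (unfold G; fold c; ring).
      assert (Hineq : c * c * (rho2 (f z) / 324) <= - 2 * X) by lra.
      apply Rmult_le_compat_r with (r := Q z * Q z) in Hineq; [|lra].
      rewrite HGE in Hlt. lra.
    - destruct (contR_eps G z (HG z Hz) (G z) HGpos) as [d [Hd H]].
      exists (Rmin d (rho - Cmod (z - z0)%C)). split; [apply Rmin_pos; lra|].
      intros w Hw.
      assert (W1 := Rlt_le_trans _ _ _ Hw (Rmin_l _ _)).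
      assert (W2 := Rlt_le_trans _ _ _ Hw (Rmin_r _ _)).
      assert (HwR : Cmod (w - z0)%C <= rho).
      { apply Rlt_le, (disc_sub z0 z w rho (rho - Cmod (z - z0)%C)); lra. }
      assert (HGw := Hmax w HwR). specialize (H w W1). apply Rabs_lt_between in H.
      assert (HlnG : forall p, Cmod (p - z0)%C <= rho -> 0 < G p ->
        - (1) * ln (Cmod (f p)) + - (1) * loglog (ln (Cmod (f p))) +
        (- (1) * ln (Cmod (f p - 1)%C) + - (1) * loglog (ln (Cmod (f p - 1)%C))) +
        2 * (ln (Cmod (f' p)) + ln (Q p)) = ln (G p)).
      { intros p Hp Hpos. assert (Hp' : Cmod (p - z0)%C < rho') by lra.
        assert (P1 := Ha p Hp'). assert (P2 := Hb p Hp'). assert (P3 := Hc p Hpos). assert (P4 := HQw p Hp Hpos).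
        assert (P5 := Hrho p Hp').
        rewrite !loglog_ln by auto. assert (P6 := logS_pos _ P1). assert (P7 := logS_pos _ P2).
        unfold G. rewrite !ln_mult; try (repeat apply Rmult_lt_0_compat; auto; fail).
        unfold rho2. rewrite ln_Rinv by (repeat apply Rmult_lt_0_compat; auto).
        rewrite !ln_mult; try (repeat apply Rmult_lt_0_compat; auto; fail). ring. }
      unfold Q in HlnG at 1. rewrite !HlnG; auto; [|lra]. apply ln_le; lra. }
  assert (HG0 : G z0 <= 2592 * (rho * rho)).
  { eapply Rle_trans; [apply Hmax|apply HGz]. apply Rlt_le, center_in_disc; lra. }
  unfold G, Q in HG0. replace (z0 - z0)%C with (RtoC 0) in HG0 by ring. rewrite Cmod_0 in HG0.
  apply Rmult_le_reg_r with (rho * rho); [nra|]. lra.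
Qed.

(** * Families omitting two values *)

(** Again t = log|z|. The 1 inside the outer logarithm keeps the function bounded as z tends to 0,
    in contrast to [loglog]; only large values have to be measured. *)
Definition tower (t : R) : R := ln (1 + ln (1 + exp (t / 2))).
Definition tower' (t : R) : R :=
  exp (t / 2) / 2 / ((1 + exp (t / 2)) * (1 + ln (1 + exp (t / 2)))).

Lemma is_derive_tower t : is_derive tower t (tower' t).
Proof.
  assert (He := exp_pos (t / 2)). assert (HS := ln_pos_of_pos _ He).
  unfold tower, tower'. auto_derive; [repeat split; try lra; unfold Rdiv in *; lra|].
  set (x := exp (t / 2)) in *. replace (exp (t * / 2)) with x in * by auto. field. lra.
Qed.

(* Completeness of the metric at infinity: [log (1 + log (1 + sqrt |z|))] is Lipschitz for it. *)
Lemma tower_gradient (w : C) : w <> 0 -> w <> 1 ->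
  tower' (ln (Cmod w)) * tower' (ln (Cmod w)) / (Cmod w * Cmod w) <= rho2 w / 4.
Proof.
  intros H0 H1. unfold tower', rho2.
  assert (Ha : 0 < Cmod w) by now apply Cmod_gt_0.
  assert (Hb : 0 < Cmod (w - 1)%C) by now apply Cmod_gt_0, Cminus_eq_contra.
  assert (Hab : Cmod (w - 1)%C <= Cmod w + 1).
  { unfold Cminus. eapply Rle_trans; [apply Cmod_triangle|]. rewrite Cmod_opp, Cmod_1. lra. }
  rewrite exp_half_ln by auto.
  assert (HSa := logS_pos _ Ha). assert (HSb := logS_pos _ Hb).
  set (a := Cmod w) in *. set (b := Cmod (w - 1)%C) in *.
  assert (Hx := sqrt_lt_R0 a Ha). assert (Hy := sqrt_lt_R0 b Hb).
  assert (Ex := sqrt_sqrt a (Rlt_le _ _ Ha)). assert (Ey := sqrt_sqrt b (Rlt_le _ _ Hb)).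
  fold (logS a). set (S := logS a) in *. set (x := sqrt a) in *.
  (* Because b <= 1 + a <= (1+x)^2. *)
  assert (Hyx : sqrt b <= 1 + x).
  { apply Rnot_lt_le. intros Hlt. nra. }
  (* Because 1 + sqrt b <= 2 (1+x), and ln 2 <= 1. *)
  assert (HSbS : logS b <= 1 + S).
  { unfold logS at 1. apply Rle_trans with (ln (2 * (1 + x))).
    - apply ln_le; lra.
    - rewrite ln_mult by lra. assert (T := ln_le_sub 1 ltac:(lra)). replace (1 + 1) with 2 in T by ring.
      unfold S, logS. fold x. lra. }
  set (y := sqrt b) in *.
  replace (x / 2 / ((1 + x) * (1 + S)) * (x / 2 / ((1 + x) * (1 + S))) / (a * a)) with
    (/ (a * ((1 + x) * (1 + x)) * ((1 + S) * (1 + S))) / 4).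
  2:{ rewrite <- Ex. field. lra. }
  apply Rmult_le_compat_r; [lra|]. apply Rinv_le_contravar.
  - repeat apply Rmult_lt_0_compat; auto.
  - assert (K1 : b <= (1 + x) * (1 + x)) by (rewrite <- Ey; apply Rmult_le_compat; lra).
    assert (K2 : S * logS b <= (1 + S) * (1 + S)) by (apply Rmult_le_compat; lra).
    assert (K3 : b * (S * logS b) <= (1 + x) * (1 + x) * ((1 + S) * (1 + S))).
    { apply Rmult_le_compat; auto; [lra|]. apply Rlt_le, Rmult_lt_0_compat; auto. }
    apply Rmult_le_compat_l with (r := a) in K3; lra.
Qed.

Lemma exp_monotone x y : x <= y -> exp x <= exp y.
Proof. intros [H| ->]; [left; now apply exp_increasing|lra]. Qed.

Lemma polar (z : C) (r : R) : Cmod z = r -> exists theta, - PI <= theta <= PI /\ z = circ r theta.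
Proof.
  intros Hz. destruct (Req_dec r 0) as [H0|H0].
  { exists 0. split; [assert (T := PI_RGT_0); lra|]. rewrite H0 in *.
    rewrite (Cmod_eq_0 z Hz). unfold circ. ring. }
  assert (Hr : 0 < r) by (assert (T := Cmod_ge_0 z); lra).
  destruct z as [x y].
  assert (Hsq : x * x + y * y = r * r).
  { replace (r * r) with (r ^ 2) by ring. rewrite <- Hz, Cmod2_alt. simpl. ring. }
  set (c := x / r).
  assert (Hc : x = r * c) by (unfold c; field; auto).
  assert (Hc1 : c * c <= 1).
  { apply Rmult_le_reg_l with (r * r); [nra|]. rewrite Hc in Hsq. nra. }
  assert (Hc2 : -1 <= c <= 1) by nra.
  assert (Hs : r * sqrt (1 - Rsqr c) = Rabs y).
  { rewrite <- (Rabs_right r), <- sqrt_Rsqr_abs, <- sqrt_mult_alt by (try apply Rle_0_sqr; lra).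
    rewrite <- sqrt_Rsqr_abs. f_equal. unfold Rsqr. rewrite Hc in Hsq. lra. }
  assert (B := acos_bound c).
  assert (E : forall theta, cos theta = c -> r * sin theta = y -> (x, y) = circ r theta).
  { intros t E1 E2. unfold circ, Cexp, Cmult, RtoC; simpl. rewrite exp_0, E1, Hc.
    f_equal; lra. }
  destruct (Rle_dec 0 y) as [Hy|Hy].
  - exists (acos c). split; [lra|]. apply E; [now apply cos_acos|].
    rewrite sin_acos, Hs by auto. apply Rabs_right; lra.
  - exists (- acos c). split; [lra|]. apply E; [rewrite cos_neg; now apply cos_acos|].
    rewrite sin_neg, sin_acos by auto. rewrite Rabs_left in Hs; lra.
Qed.

Definition omits_punctured (f : C -> C) (w : C) (rho : R) (a b : C) : Prop :=
  forall z, 0 < Cmod (z - w)%C < rho -> f z <> a /\ f z <> b.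

(** The disc of radius r about a point of the circle misses w and stays within 3r of it, so Ahlfors'
    lemma with radius r/2 bounds [rho2](f) |f'|^2 r^2 / 4 by 2592. The factor 1/4 is exactly the one
    in [tower_gradient], and r is the speed along the circle; thus the squared derivative in the
    angle is at most 2592 < 51^2. *)
Lemma circle_oscillation f f' w r : 0 < r -> holo f f' w (3 * r) ->
  omits_punctured f w (3 * r) 0 1 ->
  forall s t, Rabs (tower (ln (Cmod (f (w + circ r s)%C))) - tower (ln (Cmod (f (w + circ r t)%C))))
    <= 51 * Rabs (s - t).
Proof.
  intros Hr Hf Ho s t.
  set (g := fun s => f (w + circ r s)%C).
  set (v := fun s => (Ci * (circ r s * f' (w + circ r s)))%C).
  assert (Hcirc : forall s, Cmod (w + circ r s - w)%C = r).
  { intros p. replace (w + circ r p - w)%C with (circ r p) by ring. apply Cmod_circ; lra. }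
  assert (Hg : forall s, Rderiv g s (v s)).
  { intros p.
    assert (H : Cderiv (fun z => f (w + r * Cexp z))%C ((0, 0) + p * Ci)%C (circ r p * f' (w + circ r p))%C).
    { eapply Cderiv_eq.
      - apply (Cderiv_comp f (fun z => w + r * Cexp z)%C).
        + apply Hf. rewrite <- pair_vertical. fold (circ r p). rewrite Hcirc. lra.
        + apply Cderiv_plus; [apply Cderiv_const|]. apply Cderiv_mult; [apply Cderiv_const|apply Cderiv_Cexp].
      - cbv beta. rewrite <- pair_vertical. fold (circ r p). unfold circ. ring. }
    apply Cderiv_line in H.
    intros eps Heps. destruct (H eps Heps) as [d [Hd H']]. exists d. split; auto.
    intros q Hq. specialize (H' q Hq). cbv beta in H'. rewrite <- !pair_vertical in H'. exact H'. }
  assert (Hne : forall s, g s <> 0 /\ g s <> 1).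
  { intros p. apply Ho. rewrite Hcirc. lra. }
  set (T := fun s => tower (ln (Cmod (g s)))).
  set (dT := fun s => fst (v s / g s)%C * tower' (ln (Cmod (g s)))).
  assert (HT : forall s, is_derive T s (dT s)).
  { intros p. apply (is_derive_comp tower (fun s => ln (Cmod (g s)))); [apply is_derive_tower|].
    apply is_derive_ln_Cmod; [apply Hg|apply Hne]. }
  assert (HdT : forall s, Rabs (dT s) <= 51).
  { intros p. unfold dT. set (z := (w + circ r p)%C).
    assert (A : rho2 (f z) * (Cmod (f' z) * Cmod (f' z)) * (r / 2 * (r / 2)) <= 2592).
    { apply (ahlfors f f' z (r / 2) r); [lra| |].
      - eapply holo_sub; [apply Hf|]. unfold z. rewrite Hcirc. lra.
      - intros q Hq. apply Ho. split.
        + apply Rnot_le_lt. intros Hle.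
          assert (Tr := Cmod_triangle (z - q)%C (q - w)%C). replace (z - q + (q - w))%C with (z - w)%C in Tr by ring.
          unfold z in Tr at 1. rewrite Hcirc, Cmod_sym in Tr. lra.
        + apply (disc_sub w z q (3 * r) r); auto. unfold z. rewrite Hcirc. lra. }
    assert (B := tower_gradient (g p) (proj1 (Hne p)) (proj2 (Hne p))).
    assert (Ha : 0 < Cmod (g p)) by apply Cmod_gt_0, Hne.
    change (f z) with (g p) in A. set (a := Cmod (g p)) in *. set (th := tower' (ln a)) in *.
    set (c := Cmod (f' z)) in *.
    assert (Hv : Rabs (fst (v p / g p)%C) <= r * c / a).
    { eapply Rle_trans; [eapply Rle_trans; [apply Rmax_l|apply Rmax_Cmod]|].
      rewrite Cmod_div by apply Hne. unfold v. rewrite !Cmod_mult, Cmod_Ci, Cmod_circ by lra.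
      fold z c a. right. field. lra. }
    apply Rsqr_incr_0_var; [|lra]. rewrite <- Rsqr_abs, Rsqr_mult.
    assert (Hv2 : Rsqr (fst (v p / g p)%C) <= r * c / a * (r * c / a)).
    { rewrite Rsqr_abs. unfold Rsqr. apply Rmult_le_compat; auto; apply Rabs_pos. }
    assert (Hth : 0 <= Rsqr th) by apply Rle_0_sqr.
    apply Rle_trans with (r * c / a * (r * c / a) * Rsqr th); [now apply Rmult_le_compat_r|].
    replace (r * c / a * (r * c / a) * Rsqr th) with (th * th / (a * a) * (c * c) * (r * r))
      by (unfold Rsqr; field; lra).
    apply Rle_trans with (rho2 (g p) / 4 * (c * c) * (r * r)).
    - apply Rmult_le_compat_r; [nra|]. apply Rmult_le_compat_r; [|exact B].
      assert (Tc := Rle_0_sqr c). exact Tc.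
    - unfold Rsqr. lra. }
  destruct (MVT_gen T t s dT) as [c [_ E]].
  - intros; apply HT.
  - intros p _. apply continuity_pt_filterlim. apply (ex_derive_continuous T). eexists. apply HT.
  - fold (g s) (g t). change (Rabs (T s - T t) <= 51 * Rabs (s - t)). rewrite E, Rabs_mult.
    apply Rmult_le_compat_r; [apply Rabs_pos|apply HdT].
Qed.

(** A Schottky-type theorem: [M'] is uniform in the function, the centre and the radius. Two angles
    differ by at most 2 pi, whence [B], and inverting [tower] turns the bound [B] into exp(exp
    B)^2. *)
Lemma circle_schottky (M : R) : exists M', forall f f' w r, 0 < r -> holo f f' w (3 * r) ->
  omits_punctured f w (3 * r) 0 1 ->
  forall z z', Cmod (z - w)%C = r -> Cmod (z' - w)%C = r -> Cmod (f z) <= M -> Cmod (f z') <= M'.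
Proof.
  set (B := ln (1 + logS M) + 51 * (2 * PI)).
  exists (exp (exp B) * exp (exp B)). intros f f' w r Hr Hf Ho z z' Hz Hz' HM.
  destruct (polar (z - w)%C r Hz) as [t [Ht Et]]. destruct (polar (z' - w)%C r Hz') as [s [Hs Es]].
  assert (O := circle_oscillation f f' w r Hr Hf Ho s t).
  rewrite <- Et, <- Es in O. replace (w + (z - w))%C with z in O by ring.
  replace (w + (z' - w))%C with z' in O by ring.
  assert (Hst : Rabs (s - t) <= 2 * PI) by (apply Rabs_le; lra).
  assert (H1 : 0 < Cmod (f z)) by (apply Cmod_gt_0, Ho; lra).
  assert (H2 : 0 < Cmod (f z')) by (apply Cmod_gt_0, Ho; lra).
  unfold tower in O. rewrite !exp_half_ln in O by auto. fold (logS (Cmod (f z))) (logS (Cmod (f z'))) in O.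
  apply Rabs_le_between in O.
  assert (HB : ln (1 + logS (Cmod (f z'))) <= B).
  { assert (ln (1 + logS (Cmod (f z))) <= ln (1 + logS M)).
    { assert (T := logS_pos _ H1). apply ln_le; [lra|]. apply Rplus_le_compat_l.
      unfold logS. assert (T2 := sqrt_lt_R0 _ H1). apply ln_le; [lra|].
      apply Rplus_le_compat_l. apply sqrt_le_1; lra. }
    unfold B. lra. }
  assert (T := logS_pos _ H2).
  assert (H3 : 1 + logS (Cmod (f z')) <= exp B).
  { rewrite <- (exp_ln (1 + logS (Cmod (f z')))) by lra. now apply exp_monotone. }
  assert (T2 := sqrt_lt_R0 _ H2).
  assert (H4 : 1 + sqrt (Cmod (f z')) <= exp (exp B)).
  { rewrite <- (exp_ln (1 + sqrt (Cmod (f z')))) by lra. apply exp_monotone. fold (logS (Cmod (f z'))). lra. }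
  rewrite <- (sqrt_sqrt (Cmod (f z'))) by lra. apply Rmult_le_compat; lra.
Qed.

Lemma holo_affine f f' w rho (a k : C) : holo f f' w rho ->
  holo (fun z => (f z - a) * k)%C (fun z => f' z * k)%C w rho.
Proof.
  intros Hf z Hz. eapply Cderiv_eq.
  - apply Cderiv_mult; [|apply Cderiv_const]. apply Cderiv_minus; [now apply Hf|apply Cderiv_const].
  - cbv beta. ring.
Qed.

Lemma minimum_principle f f' w r rho (c : C) K : 0 < r < rho -> 0 < K -> holo f f' w rho ->
  (forall z, Cmod (z - w)%C < rho -> f z <> c) ->
  (forall z, Cmod (z - w)%C = r -> K <= Cmod (f z - c)%C) ->
  forall z, Cmod (z - w)%C <= r -> K <= Cmod (f z - c)%C.
Proof.
  intros Hr HK Hf Hc Hcirc z Hz.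
  assert (Hpos : forall p, Cmod (p - w)%C < rho -> 0 < Cmod (f p - c)%C).
  { intros p Hp. apply Cmod_gt_0, Cminus_eq_contra. auto. }
  assert (H : Cmod (/ (f z - c))%C <= / K).
  { apply (maximum_principle (fun p => / (f p - c))%C (fun p => (f' p - 0) * - / ((f p - c) * (f p - c)))%C
      w r rho); auto.
    - intros p Hp. apply (Cderiv_comp Cinv (fun p => f p - c)%C).
      + apply Cderiv_inv, Cminus_eq_contra. auto.
      + apply Cderiv_minus; [now apply Hf|apply Cderiv_const].
    - intros p Hp. rewrite Cmod_inv by (apply Cminus_eq_contra, Hc; lra).
      apply Rinv_le_contravar; auto. }
  rewrite Cmod_inv in H by (apply Cminus_eq_contra, Hc; lra).
  rewrite <- (Rinv_inv K), <- (Rinv_inv (Cmod (f z - c)%C)).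
  apply Rinv_le_contravar; auto. apply Rinv_0_lt_compat, Hpos. lra.
Qed.

Lemma punctured_montel (u u' : nat -> C -> C) (w a b : C) (r : R) : 0 < r -> a <> b ->
  (forall n, holo (u n) (u' n) w (3 * r)) ->
  (forall n, omits_punctured (u n) w (3 * r) a b) ->
  exists phi : nat -> nat, (forall n, (phi n < phi (S n))%nat) /\
    ((exists g, (forall z, Cmod (z - w)%C < r / 8 -> exists l, Cderiv g z l) /\
       forall eps, 0 < eps -> exists N, forall n z, (N <= n)%nat -> Cmod (z - w)%C < r / 8 ->
         Cmod (u (phi n) z - g z)%C <= eps) \/
     forall M, exists N, forall n z, (N <= n)%nat -> Cmod (z - w)%C < r / 8 -> M < Cmod (u (phi n) z)).
Proof.
  intros Hr Hab Hu Ho.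
  set (k := (/ (b - a))%C). assert (Hba : (b - a)%C <> 0) by now apply Cminus_eq_contra, not_eq_sym.
  set (v := fun n z => ((u n z - a) * k)%C). set (v' := fun n z => (u' n z * k)%C).
  assert (Huv : forall n z, u n z = (a + (b - a) * v n z)%C).
  { intros n z. unfold v, k. field. auto. }
  assert (Hv : forall n, holo (v n) (v' n) w (3 * r)) by (intros n; now apply holo_affine).
  assert (Hvo : forall n, omits_punctured (v n) w (3 * r) 0 1).
  { intros n z Hz. destruct (Ho n z Hz) as [H1 H2]. rewrite Huv in H1, H2.
    split; intros E; rewrite E in H1, H2; [apply H1|apply H2]; ring. }
  (* The single point w + r decides: [circle_schottky] carries boundedness from it to the circle
     and, by contraposition, divergence as well. *)
  destruct (classic (exists M, inf_set (fun n => Cmod (v n (w + r)%C) <= M))) as [[M HM]|HM].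
  - destruct (circle_schottky M) as [M' HM'].
    destruct (small_montel u u' w r (Cmod a + Cmod (b - a)%C * M') (fun n => Cmod (v n (w + r)%C) <= M))
      as (phi & g & H1 & H2 & H3); auto.
    + intros n _ z Hz. apply Hu. lra.
    + intros n z Hn Hz. rewrite Huv. eapply Rle_trans; [apply Cmod_triangle|]. apply Rplus_le_compat_l.
      rewrite Cmod_mult. apply Rmult_le_compat_l; [apply Cmod_ge_0|].
      apply (maximum_principle (v n) (v' n) w r (3 * r)); auto; try lra.
      intros p Hp. apply (HM' (v n) (v' n) w r Hr (Hv n) (Hvo n) (w + r)%C p); auto.
      replace (w + r - w)%C with (RtoC r) by ring. rewrite Cmod_R, Rabs_right; lra.
    + exists phi. split; auto. left. now exists g.
  - assert (Hinf : forall M, exists N, forall n z, (N <= n)%nat -> Cmod (z - w)%C = r -> M < Cmod (v n z)).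
    { intros M. destruct (circle_schottky M) as [M' HM'].
      apply not_ex_all_not with (n := M') in HM. apply not_all_ex_not in HM. destruct HM as [N HN].
      exists N. intros n z Hn Hz. apply Rnot_le_lt. intros Hle. apply HN. exists n. split; auto.
      apply (HM' (v n) (v' n) w r Hr (Hv n) (Hvo n) z (w + r)%C); auto.
      replace (w + r - w)%C with (RtoC r) by ring. rewrite Cmod_R, Rabs_right; lra. }
    assert (Hc : exists (c : C) (T : nat -> Prop), inf_set T /\ Cmod c <= 1 /\
      forall n z, T n -> Cmod (z - w)%C < 3 * r -> v n z <> c).
    { assert (Hoff : forall n (z : C), Cmod (z - w)%C < 3 * r -> z = w \/ (v n z <> 0 /\ v n z <> 1)).
      { intros n z Hz. destruct (Ceq_dec z w) as [|Hne]; [now left|right]. apply Hvo.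
        split; auto. apply Cmod_gt_0. now apply Cminus_eq_contra. }
      destruct (inf_set_split (fun _ => True) (fun n => v n w <> 0) (fun n => v n w <> 1)) as [H|H].
      - intros N. exists N. auto.
      - intros n _. destruct (Ceq_dec (v n w) 0) as [E|E]; [right|now left]. rewrite E. intros E'. now apply C1_nz.
      - exists 0. eexists. split; [apply H|]. split; [rewrite Cmod_0; lra|].
        intros n z [_ Hn] Hz. destruct (Hoff n z Hz) as [->|K]; [auto|apply K].
      - exists 1. eexists. split; [apply H|]. split; [rewrite Cmod_1; lra|].
        intros n z [_ Hn] Hz. destruct (Hoff n z Hz) as [->|K]; [auto|apply K]. }
    destruct Hc as (c & T & HT & Hc1 & Hc).
    destruct (diagonal_subsequence (fun _ _ => True) T HT) as (phi & Hphi & HphiT & _).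
    { intros j S1 HS1 _. exists S1. auto. }
    exists phi. split; auto. right. intros M.
    assert (Hge : forall n, (n <= phi n)%nat).
    { induction n as [|n IH]; [lia|]. specialize (Hphi n). lia. }
    assert (Hd : 0 < Cmod (b - a)%C) by now apply Cmod_gt_0.
    set (A := Cmod (a + (b - a) * c)%C). assert (HA : 0 <= A) by apply Cmod_ge_0.
    (* From |v - c| >= K and u - (a + (b-a) c) = (b-a)(v-c) follows |u| >= |M| + 1. On the circle
       |v| > K + 1 is requested, since |c| <= 1. *)
    set (K := (Rabs M + A + 1) / Cmod (b - a)%C).
    assert (HK : 0 < K). { apply Rdiv_lt_0_compat; auto. assert (T1 := Rabs_pos M). lra. }
    destruct (Hinf (K + 1)) as [N HN]. exists N. intros n z Hn Hz.
    assert (B : K <= Cmod (v (phi n) z - c)%C).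
    { apply (minimum_principle (v (phi n)) (v' (phi n)) w r (3 * r) c K); auto; try lra.
      intros p Hp. assert (H1 := HN (phi n) p ltac:(specialize (Hge n); lia) Hp).
      assert (T1 := Cmod_triangle (v (phi n) p - c)%C c).
      replace (v (phi n) p - c + c)%C with (v (phi n) p) in T1 by ring. lra. }
    apply Rmult_le_compat_l with (r := Cmod (b - a)%C) in B; [|lra].
    rewrite <- Cmod_mult in B.
    replace ((b - a) * (v (phi n) z - c))%C with (u (phi n) z + - (a + (b - a) * c))%C in B
      by (rewrite Huv; ring).
    assert (T1 := Cmod_triangle (u (phi n) z) (- (a + (b - a) * c))%C). rewrite Cmod_opp in T1. fold A in T1.
    replace (Cmod (b - a)%C * K) with (Rabs M + A + 1) in B by (unfold K; field; lra).
    assert (T2 := Rle_abs M). lra.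
Qed.

(** * From sequences on discs to normality, and the two statements on Julia sets *)

Lemma locally_disc (z : C) (d : R) : 0 < d -> locally z (fun w => Cmod (w - z)%C < d).
Proof.
  (* Balls of the uniform structure on C are coordinate squares; the one of half-side d/2 lies in
     the disc because sqrt 2 <= 2. *)
  intros Hd. assert (Hd2 : 0 < d / 2) by lra.
  exists (mkposreal _ Hd2). intros w Hw.
  assert (T := C_NormedModule_mixin_compat2 z w _ Hw). simpl in T.
  change (Cmod (w - z)%C < sqrt 2 * (d / 2)) in T.
  assert (sqrt 2 <= 2).
  { rewrite <- (sqrt_square 2) at 2 by lra. apply sqrt_le_1; lra. }
  nra.
Qed.

Lemma open_disc (z : C) (d : R) : open (fun w : C => Cmod (w - z)%C < d).
Proof.
  intros w Hw. apply filter_imp with (fun p => Cmod (p - w)%C < d - Cmod (w - z)%C).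
  - intros p Hp. apply (disc_sub z w p d (d - Cmod (w - z)%C)); lra.
  - apply locally_disc. lra.
Qed.

Lemma open_disc_inside (D : C -> Prop) (z : C) : open D -> D z ->
  exists d, 0 < d /\ forall w, Cmod (w - z)%C < d -> D w.
Proof.
  intros HD Hz. destruct (HD z Hz) as [d Hd]. exists d. split; [apply cond_pos|].
  intros w Hw. apply Hd. now apply C_NormedModule_mixin_compat1.
Qed.

Lemma normal_at_omitting (D : C -> Prop) (F : (C -> C) -> Prop) (w a b : C) (d : R) :
  open D -> (forall f, F f -> holomorphic_on D f) -> D w -> a <> b -> 0 < d ->
  (forall f z, F f -> D z -> 0 < Cmod (z - w)%C < d -> f z <> a /\ f z <> b) ->
  normal_at D F w.
Proof.
  intros HD HF Hw Hab Hd Homit.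
  destruct (open_disc_inside D w HD Hw) as [d' [Hd' HD']].
  set (r := Rmin d d' / 3).
  assert (Hr : 0 < r) by (assert (T := Rmin_pos d d' Hd Hd'); unfold r; lra).
  assert (Hrd : 3 * r <= d /\ 3 * r <= d').
  { assert (T1 := Rmin_l d d'). assert (T2 := Rmin_r d d'). unfold r. lra. }
  exists (fun z => Cmod (z - w)%C < r / 8). split; [apply open_disc|].
  split; [apply center_in_disc; lra|]. split; [intros z Hz; apply HD'; lra|].
  intros u Hu.
  (* The derivatives of the whole sequence are chosen at once, over pairs of index and point, with 0
     as a filler off the disc. *)
  assert (Hu' : forall nz : nat * C, exists l, Cmod (snd nz - w)%C < 3 * r -> Cderiv (u (fst nz)) (snd nz) l).
  { intros [n z]. simpl. destruct (Rlt_dec (Cmod (z - w)%C) (3 * r)) as [Hz|Hz].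
    - destruct (HF (u n) (Hu n) z) as [l Hl]; [apply HD'; lra|]. exists l. intros _. now apply is_derive_Cderiv.
    - exists 0. intros; contradiction. }
  apply choice in Hu'. destruct Hu' as [u' Hu'].
  destruct (punctured_montel u (fun n z => u' (n, z)) w a b r Hr Hab) as (phi & Hphi & H).
  - intros n z Hz. now apply (Hu' (n, z)).
  - intros n z Hz. apply Homit; [apply Hu| |lra]. apply HD'. lra.
  - exists phi. split; auto. destruct H as [(g & H1 & H2)|H]; [left|right].
    + exists g. split.
      * intros z Hz. destruct (H1 z Hz) as [l Hl]. exists l. now apply is_derive_Cderiv.
      (* Convergence is uniform on the whole small disc, so the full plane serves as neighbourhood;
         eps/2 turns the weak inequality into the strict one required. *)
      * intros z Hz. exists (fun _ => True). split; [apply Hierarchy.filter_true|].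
        intros eps. destruct (H2 (eps / 2)) as [N HN]; [assert (T := cond_pos eps); lra|].
        exists N. intros n Hn p _ Hp. assert (T := cond_pos eps).
        specialize (HN n p Hn Hp). lra.
    + intros z Hz. exists (fun _ => True). split; [apply Hierarchy.filter_true|].
      intros M. destruct (H M) as [N HN]. exists N. intros n Hn p _ Hp. now apply HN.
Qed.

(** The centre is left out because [w] may belong to [A]; this is what forces punctured discs
    throughout. *)
Lemma finite_isolated (A : Ensemble C) (w : C) : Finite_sets.Finite C A ->
  exists d, 0 < d /\ forall z, 0 < Cmod (z - w)%C < d -> ~ A z.
Proof.
  intros HA. induction HA as [|A HA IH x Hx].
  - exists 1. split; [lra|]. intros z _ [].
  - destruct IH as [d [Hd H]]. destruct (Ceq_dec x w) as [->|Hne].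
    + exists d. split; auto. intros z Hz HAz. destruct HAz as [z HAz|z HAz].
      * now apply (H z).
      * destruct HAz. replace (w - w)%C with (RtoC 0) in Hz by ring. rewrite Cmod_0 in Hz. lra.
    + assert (Hxw : 0 < Cmod (x - w)%C) by now apply Cmod_gt_0, Cminus_eq_contra.
      exists (Rmin d (Cmod (x - w)%C)). split; [now apply Rmin_pos|].
      intros z Hz HAz. assert (T1 := Rmin_l d (Cmod (x - w)%C)). assert (T2 := Rmin_r d (Cmod (x - w)%C)).
      destruct HAz as [z HAz|z HAz].
      * apply (H z); auto. lra.
      * destruct HAz. lra.
Qed.

Theorem theorem1p9 (D : C -> Prop) (F : (C -> C) -> Prop)
    (hD : domain D) (hF : forall f, F f -> holomorphic_on D f) :
  (Inhabited C (exceptional D F) ->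
     forall z : C, ~ exceptional D F z ->
       Included C (Julia D F) (closure (back_orbit D F z))) /\
  (Inhabited C (Julia D F) ->
     exists n : nat, cardinal C (exceptional D F) n /\ (n <= 1)%nat).
Proof.
  destruct hD as (_ & HDo & _).
  split.
  (* If [U] misses the backward orbit of z, then near [w] the family omits z, and off [w] it omits
     the exceptional value [a] too; [a] differs from z, so the family is normal at [w]. *)
  - intros [a Ha] z Hz w [Hw HJ] U HU HUw. apply NNPP. intros Hno. apply HJ. split; auto.
    destruct (finite_isolated _ w Ha) as [d [Hd H]].
    destruct (open_disc_inside U w HU HUw) as [d' [Hd' H']].
    apply (normal_at_omitting D F w a z (Rmin d d')); auto.
    + intros ->. contradiction.
    + now apply Rmin_pos.
    + intros f p Hf Hp Hpw. assert (T1 := Rmin_l d d'). assert (T2 := Rmin_r d d'). split; intros E.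
      * apply (H p); [lra|]. split; auto. now exists f.
      * apply Hno. exists p. split; [apply H'; lra|]. split; auto. now exists f.
  - intros [w [Hw HJ]].
    (* Two distinct exceptional values would both be omitted on a punctured disc about a Julia
       point, making the family normal there. *)
    assert (Huniq : forall a b, exceptional D F a -> exceptional D F b -> a = b).
    { intros a b Ha Hb. apply NNPP. intros Hab. apply HJ. split; auto.
      destruct (finite_isolated _ w Ha) as [d [Hd H]].
      destruct (finite_isolated _ w Hb) as [d' [Hd' H']].
      apply (normal_at_omitting D F w a b (Rmin d d')); auto.
      - now apply Rmin_pos.
      - intros f p Hf Hp Hpw. assert (T1 := Rmin_l d d'). assert (T2 := Rmin_r d d').
        split; intros E; [apply (H p)|apply (H' p)]; try lra; split; auto; now exists f. }
    destruct (classic (exists a, exceptional D F a)) as [[a Ha]|Hno].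
    + exists 1%nat. split; [|lia].
      replace (exceptional D F) with (Ensembles.Add C (Empty_set C) a).
      * apply card_add; [constructor|]. intros [].
      * extensionality x. apply propositional_extensionality. split; intros Hx.
        -- destruct Hx as [x []|x Hx]. destruct Hx. exact Ha.
        -- right. rewrite (Huniq x a Hx Ha). constructor.
    + exists 0%nat. split; [|lia].
      replace (exceptional D F) with (Empty_set C); [constructor|].
      extensionality x. apply propositional_extensionality. split; intros Hx; [destruct Hx|].
      exfalso. apply Hno. now exists x.
Qed.
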